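(* Let $\Gamma\subset\mathbb{R}^2$ be a closed simple analytic curve with parametrization $\mathbf{x}$, and let $\phi$ be a real $2\pi$-periodic analytic function. Let $M\ge 0$ be an integer and suppose there exists $U_S:\mathbb{R}^2\times\Gamma\to\mathbb{R}$, with $U_S(\cdot,\mathbf{x}(t))$ harmonic in $\mathbb{R}^2$ for all $t\in[0,2\pi]$, such that its Neumann trace $Q_S(\tau,t)=\nabla U_S(\mathbf{x}(\tau),\mathbf{x}(t))\cdot\mathbf{n}(\tau)$ (gradient in the first variable) satisfies $$\lim_{\tau\to t}\frac{\partial^m}{\partial\tau^m}\{Q_S(\tau,t)-\phi(\tau)\}=0\quad\text{for } m=0,\dots,M$$ and all $t\in[0,2\pi]$. Let $P_S(\tau,t)=U_S(\mathbf{x}(\tau),\mathbf{x}(t))$ denote the Dirichlet trace of $U_S$. Then the single-layer operator can be expressed as $$\tilde S[\phi](t)=\frac{P_S(t,t)}{2}+\int_0^{2\pi}\left\{R^{(P)}_S(\tau,t)+R^{(Q)}_S(\tau,t)\right\}|\mathbf{x}'(\tau)|\,d\tau,$$ where $$R^{(P)}_S(\tau,t)=\begin{cases}\dfrac{1}{2\pi}\dfrac{\{\mathbf{x}(t)-\mathbf{x}(\tau)\}\cdot\mathbf{n}(\tau)}{|\mathbf{x}(t)-\mathbf{x}(\tau)|^2}P_S(\tau,t)&\text{if }\tau\ne t,\\[2mm] \dfrac{\mathbf{x}''(t)\cdot\mathbf{n}(t)}{4\pi|\mathbf{x}'(t)|^2}P_S(t,t)&\text{if }\tau=t,\end{cases}$$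 is an analytic $2\pi$-periodic function of $\tau\in[0,2\pi]$, and $$R^{(Q)}_S(\tau,t)=\begin{cases}-\dfrac{1}{2\pi}\log\left(|\mathbf{x}(t)-\mathbf{x}(\tau)|\right)\{\phi(\tau)-Q_S(\tau,t)\}&\text{if }\tau\ne t,\\[2mm] 0&\text{if }\tau=t,\end{cases}$$ is an $M$-times continuously differentiable $2\pi$-periodic function of $\tau\in[0,2\pi]$, for all $t\in[0,2\pi]$. Furthermore, the $(M+1)$-th derivative of $R^{(Q)}_S(\cdot,t)$ is an integrable function for all $t\in[0,2\pi]$.
   Context: The simple closed curve $\Gamma$ is given by a regular ($\mathbf{x}'(t)\neq 0$), real analytic, $2\pi$-periodic counterclockwise parametrization $\mathbf{x}(t)=(\mathrm{x}_1(t),\mathrm{x}_2(t))$, injective on $[0,2\pi)$. The unit normal is $\mathbf{n}(t)=(\mathrm{x}_2'(t),-\mathrm{x}_1'(t))/|\mathbf{x}'(t)|$ (outward). Functions of the parameters $\tau,t$ are extended $2\pi$-periodically, and ''$\tau=t$'', ''$\tau\neq t$'' are understood modulo $2\pi$. (The $(M+1)$-th derivative of $R_S^{(Q)}(\cdot,t)$ is understood at $\tau\ne t$.) Let $G(x,y)=-\frac{1}{2\pi}\log|x-y|$ be the free-space Green function of the Laplace equation in $\mathbb{R}^2$. The single-layer operator applied to $\varphi:\Gamma\to\mathbb{R}$ is $S[\varphi](x)=\int_\Gamma G(x,y)\varphi(y)\,ds(y)$, $x\in\Gamma$. In parameter space, $\tilde S[\phi](t)=S[\varphi](\mathbf{x}(t))=\int_0^{2\pi}G(\mathbf{x}(t),\mathbf{x}(\tau))\phi(\tau)|\mathbf{x}'(\tau)|\,d\tau$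 where $\phi(t)=\varphi(\mathbf{x}(t))$. *)

(* Defs.v *)
From HB Require Import structures.
From mathcomp Require Import all_boot all_order all_algebra.
From mathcomp Require Import all_classical all_reals all_analysis.

Set Implicit Arguments.
Unset Strict Implicit.
Unset Printing Implicit Defensive.

Import Order.TTheory GRing.Theory Num.Theory.
Import numFieldNormedType.Exports.

Local Open Scope ring_scope.
Local Open Scope classical_set_scope.

Section Plane.
Variable R : realType.
Implicit Types p q v : R * R.

Definition dot p q : R := p.1 * q.1 + p.2 * q.2.

(* The library norm on [R * R] is the sup norm; this is the Euclidean one. *)
Definition enorm p : R := Num.sqrt (dot p p).

Definition axes : set (R * R) := [set (1, 0); (0, 1)].

Definition grad (u : R * R -> R) p : R * R := ('D_(1, 0) u p, 'D_(0, 1) u p).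

Definition laplacian (u : R * R -> R) p : R :=
  'D_(1, 0) ('D_(1, 0) u) p + 'D_(0, 1) ('D_(0, 1) u) p.

Definition plane_C2 (u : R * R -> R) : Prop :=
  continuous u /\
  forall v, axes v ->
    [/\ forall p, derivable u p v,
        continuous ('D_v u) &
        forall w, axes w ->
          (forall p, derivable ('D_v u) p w) /\ continuous ('D_w ('D_v u))].

Definition harmonic_fun (u : R * R -> R) : Prop :=
  plane_C2 u /\ forall p, laplacian u p = 0.

(* The value at p = q is irrelevant (in the library [ln 0 = 0]). *)
Definition green p q : R := - (2 * pi)^-1 * ln (enorm (p - q)).

End Plane.

Section Line.
Variable R : realType.
Implicit Types f : R -> R.

Definition real_analytic f : Prop :=
  forall a : R, exists c : R^nat,
    \forall s \near a, pseries c (s - a) @ \oo --> f s.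

Definition cont_diff (k : nat) f : Prop :=
  (forall m s, (m < k)%N -> derivable (f^`(m)) s 1) /\
  (forall m, (m <= k)%N -> continuous (f^`(m))).

Definition eqmod2pi (s t : R) : Prop :=
  exists k : int, s = t + k%:~R * (2 * pi).

End Line.

Section Curve.
Variables (R : realType) (x : R -> R * R).
Implicit Types s t tau : R.

Local Notation mu := (@lebesgue_measure R).

Definition dcurve (n : nat) t : R * R :=
  ((fst \o x)^`(n) t, (snd \o x)^`(n) t).

Definition speed t : R := enorm (dcurve 1 t).

Definition normal t : R * R :=
  ((dcurve 1 t).2 / speed t, - (dcurve 1 t).1 / speed t).

Definition interior_domain : set (R * R) :=
  [set p | (~` range x) p /\ bounded_set (connected_component (~` range x) p)].

(* Winding number about p of the 2pi-periodic curve x: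
   (2 pi)^-1 times the integral of d arg (x - p). *)
Definition winding (p : R * R) : R :=
  (2 * pi)^-1 *
  \int[mu]_(s in `[0, 2 * pi])
    (((x s - p).1 * (dcurve 1 s).2 - (x s - p).2 * (dcurve 1 s).1)
       / enorm (x s - p) ^+ 2).

Definition counterclockwise : Prop :=
  forall p, interior_domain p -> winding p = 1.

Definition simple_closed_analytic_ccw : Prop :=
  [/\ real_analytic (fst \o x) /\ real_analytic (snd \o x),
      periodic x (2 * pi),
      forall t, dcurve 1 t != (0, 0),
      forall s t, 0 <= s < 2 * pi -> 0 <= t < 2 * pi -> x s = x t -> s = t &
      counterclockwise].

(* Extended-real valued Lebesgue integral, so that an equality with a finite
   quantity also asserts convergence of the weakly singular integral. *)
Definition single_layer (phi : R -> R) t : \bar R :=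
  (\int[mu]_(tau in `[0%R, (2 * pi)%R])
    (green (x t) (x tau) * phi tau * speed tau)%R%:E)%E.

Variable U : R * R -> R * R -> R.

Definition dirichlet_trace tau t : R := U (x tau) (x t).

Definition neumann_trace tau t : R :=
  dot (grad (U ^~ (x t)) (x tau)) (normal tau).

Definition RP tau t : R :=
  if `[< eqmod2pi tau t >] then
    dot (dcurve 2 t) (normal t) / (4 * pi * speed t ^+ 2)
      * dirichlet_trace t t
  else
    (2 * pi)^-1 * (dot (x t - x tau) (normal tau) / enorm (x t - x tau) ^+ 2)
      * dirichlet_trace tau t.

Definition RQ (phi : R -> R) tau t : R :=
  if `[< eqmod2pi tau t >] then 0
  else - (2 * pi)^-1 * ln (enorm (x t - x tau))
         * (phi tau - neumann_trace tau t).

End Curve.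

(* Main.v *)
(* Fix [t], put [u := U(., x t)], [D(tau) := x tau - x t] and
   [K := D x D' / |D|^2], the derivative of the angle of [D].

   [u] is harmonic on the whole plane, so a function [v] along the curve with
   [v' = (du/dn) |x'|] is [v(tau) = int_0^1 grad u(x t + s D) x D ds], a harmonic
   conjugate that vanishes at [t].  Averaging the identity
   [(g . D) (D x D') + (g x D) (D . D') = |D|^2 (g x D')] over the segment gives
   [v (log |D|)' + (u(x) - u(x t)) K = int_0^1 grad u(x t + s D) x D' ds], whose
   integral over the period vanishes for each [s].  Integrating
   [(v log |D|)'] then yields
   [int log|D| (du/dn) ds = int u K - u(x t) int K], and [int K = pi]: moving
   [x t] slightly off the curve along either normal changes [int K] by [+- pi],
   while both resulting winding numbers are [0] or [1].

   Near [t] one has [log |D| = log |tau - t| + analytic] and, by interpolation,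
   [Q - phi = (tau - t)^(M+1) E] with [E] analytic.  Hence [R^(Q)] has the form
   [(tau - t)^(M+1) (E1 log (tau - t)^2 + E2)], and differentiation lowers the
   exponent by one. *)

Require Import Defs.
From HB Require Import structures.
From mathcomp Require Import all_boot all_order all_algebra.
From mathcomp Require Import all_classical all_reals all_analysis.
From mathcomp Require Import measurable_realfun.
From mathcomp Require Import ring lra.

Set Implicit Arguments.
Unset Strict Implicit.
Unset Printing Implicit Defensive.

Import Order.TTheory GRing.Theory Num.Theory.
Import numFieldNormedType.Exports.

Local Open Scope ring_scope.
Local Open Scope classical_set_scope.

(** * Real-analytic functions of one variable *)

Section SeriesTools.
Variable R : realType.
Implicit Types (u v : R^nat).

(** Analyticity is handled through a majorant norm: a function carries a radius [rho] and a bound on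
    the sum of [|c_k| rho^k], so that products, compositions and infinite sums become estimates on
    one number. That a harmonic function is analytic along the curve comes from its gradient, which
    is up to a sign a Cauchy-Riemann pair on the whole plane: Cauchy's formula on a unit circle,
    written in real form, yields a Taylor series into which the parametrization is substituted. The
    function itself is then recovered as a primitive along the curve.

    All identities are one-dimensional. The conjugate [v] is defined on chords so that its
    periodicity is visible: it depends on [tau] only through [x tau]. The value of [int K] is forced
    by arithmetic: the winding numbers at the two shifted points differ by 1 and both lie in {0, 1},
    so they are 1 and 0, and [int K] is the mean of [2 pi] and [0]. The logarithm is taken of
    [(tau - t)^2] so that one formula serves both sides of [t]. *)

Lemma cvg_sum_nat (m : nat) (u : nat -> R^nat) (l : R^nat) :
  (forall n, u n @ \oo --> l n) ->
  (fun K => \sum_(0 <= n < m) u n K) @ \oo --> \sum_(0 <= n < m) l n.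
move=> ul; elim: m => [|m IH].
  rewrite big_nil; under eq_fun do rewrite big_nil; exact: cvg_cst.
rewrite big_nat_recr//=; under eq_fun do rewrite big_nat_recr//=.
exact: cvgD IH (ul m).
Qed.

Lemma cvg_series_tail_le u v (l e : R) (m : nat) :
  series u @ \oo --> l -> (forall n, `|u n| <= v n) ->
  (forall m', \sum_(m <= n < m') v n <= e) -> `|l - series u m| <= e.
Proof.
move=> ul uv ve.
have H : (fun m' => `|series u m' - series u m|) @ \oo --> `|l - series u m|.
  apply: cvg_norm; apply: cvgB => //; exact: cvg_cst.
apply: (cvgr_to_le H); exists m => // m' /= mm'.
rewrite /series /= (big_cat_nat (leq0n m) mm') /= addrAC subrr add0r.
apply: le_trans (ve m'); apply: le_trans (ler_norm_sum _ _ _) _.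
by apply: ler_sum => i _.
Qed.

Lemma cvg_series_le u v (l N : R) :
  series u @ \oo --> l -> (forall n, `|u n| <= v n) ->
  (forall K, \sum_(0 <= n < K) v n <= N) -> `|l| <= N.
Proof.
move=> ul uv vN; have := @cvg_series_tail_le u v l N 0 ul uv vN.
by rewrite /series /= big_nil subr0.
Qed.

Lemma bounded_series_cvg v (N : R) : (forall n, 0 <= v n) ->
  (forall K, \sum_(0 <= n < K) v n <= N) -> cvgn (series v).
Proof.
move=> v0 vN; apply: nondecreasing_is_cvgn.
  by apply: nondecreasing_series => n _ _.
by exists N => _ [n _ <-]; exact: vN.
Qed.

Lemma bounded_series_norm_cvg u v (N : R) : (forall n, `|u n| <= v n) ->
  (forall K, \sum_(0 <= n < K) v n <= N) -> cvgn (series u).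
Proof.
move=> uv vN; apply: normed_cvg; apply: (@bounded_series_cvg _ N) => //= K.
by apply: le_trans (vN K); apply: ler_sum => i _.
Qed.

Lemma bounded_series_tail v (N e : R) : (forall n, 0 <= v n) ->
  (forall K, \sum_(0 <= n < K) v n <= N) -> 0 < e ->
  exists m, forall m', \sum_(m <= n < m') v n <= e.
Proof.
move=> v0 vN e0; have cv := bounded_series_cvg v0 vN.
have nd : {homo series v : n m / (n <= m)%N >-> n <= m}.
  by apply: nondecreasing_series => n _ _.
have /cvgrPdist_le/(_ _ e0) [m _ /(_ m (leqnn m))] := cv.
rewrite /= => He; exists m => m'.
have [mm'|m'm] := leqP m m'; last by rewrite big_geq ?(ltW e0) 1?ltnW.
have -> : \sum_(m <= n < m') v n = series v m' - series v m.
  by rewrite /series /= (big_cat_nat (leq0n m) mm') /= addrAC subrr add0r.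
have := nondecreasing_cvgn_le nd cv m'.
have := ler_norm (limn (series v) - series v m); lra.
Qed.

End SeriesTools.

(** * Power series under a majorant norm *)

Section PowerSeries.
Variable R : realType.
Implicit Types (c : R^nat) (f g : R -> R) (rho N : R).

(** A weighted l1 norm of the coefficients, bounded by [N]. It is submultiplicative and controls the
    sup norm on the closed interval of radius [rho], which is what makes the class stable under the
    operations below. *)
Definition psbounded rho N f : Prop :=
  exists c : R^nat, (forall K, \sum_(0 <= k < K) `|c k| * rho ^+ k <= N) /\
    forall h, `|h| <= rho -> pseries c h @ \oo --> f h.

Lemma psbounded_ge0 rho N f : psbounded rho N f -> 0 <= N.
Proof. by move=> [c [/(_ 0%N)]]; rewrite big_nil. Qed.

Lemma psbounded_norm rho N f h : psbounded rho N f -> `|h| <= rho -> `|f h| <= N.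
Proof.
move=> [c [cN cf]] hr; apply: cvg_series_le (cf h hr) _ cN => n.
rewrite normrM normrX ler_wpM2l//; apply: lerXn2r => //; rewrite nnegrE.
exact: le_trans hr.
Qed.

(** Weierstrass double series theorem: summability of the norms [Nn] allows the exchange of the sum
    over functions with the sum over degrees. Products and compositions are both reduced to this
    lemma. *)
Lemma psbounded_series rho N (Nn : R^nat) (f : nat -> R -> R) (F : R -> R) :
  0 < rho -> (forall n, psbounded rho (Nn n) (f n)) ->
  (forall K, \sum_(0 <= n < K) Nn n <= N) ->
  (forall h, `|h| <= rho -> series (f ^~ h) @ \oo --> F h) ->
  psbounded rho N F.
Proof.
move=> rho0 fN NN fF.
have [c cP] := choice fN.
have N0 n : 0 <= Nn n := psbounded_ge0 (fN n).
have cb n k : `|c n k| <= Nn n / rho ^+ k.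
  rewrite ler_pdivlMr ?exprn_gt0//; have [cN _] := cP n.
  apply: le_trans (cN k.+1); rewrite big_nat_recr//= lerDr.
  by apply: sumr_ge0 => i _; rewrite mulr_ge0// exprn_ge0// ltW.
pose C k := limn (series (c ^~ k)).
have cC k : series (c ^~ k) @ \oo --> C k.
  apply: (@bounded_series_norm_cvg _ _ (fun n => Nn n / rho ^+ k)
    (N / rho ^+ k)) => // K.
  by rewrite -mulr_suml ler_wpM2r// invr_ge0 exprn_ge0// ltW.
have hb n K h : `|h| <= rho -> `|\sum_(0 <= k < K) c n k * h ^+ k| <= Nn n.
  move=> hr; have [cN _] := cP n; apply: le_trans (cN K).
  apply: le_trans (ler_norm_sum _ _ _) _; apply: ler_sum => i _.
  rewrite normrM normrX ler_wpM2l//; apply: lerXn2r => //; rewrite nnegrE.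
  exact: ltW.
exists C; split=> [K|h hr].
  have H : (fun m => \sum_(0 <= k < K) `|series (c ^~ k) m| * rho ^+ k) @ \oo
      --> \sum_(0 <= k < K) `|C k| * rho ^+ k.
    apply: (@cvg_sum_nat _ K (fun k m => `|series (c ^~ k) m| * rho ^+ k)) => k.
    by apply: cvgMl; apply: cvg_norm; exact: cC.
  apply: (cvgr_to_le H); exists 0%N => // m _ /=.
  apply: le_trans (NN m).
  apply: (@le_trans _ _ (\sum_(0 <= k < K) \sum_(0 <= n < m)
     `|c n k| * rho ^+ k)).
    apply: ler_sum => k _; rewrite -mulr_suml ler_wpM2r ?exprn_ge0 ?(ltW rho0)//.
    exact: ler_norm_sum.
  by rewrite exchange_big /=; apply: ler_sum => n _; case: (cP n).
apply/cvgrPdist_le => e e0.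
(* Keeping only the first [m] functions costs at most [e / 3], both for the full sums and, uniformly
   in [K], for the sums truncated at degree [K]. With [m] fixed, the remaining comparison involves
   finitely many convergent power series. *)
have e3 : 0 < e / 3 by lra.
have [m mP] := bounded_series_tail N0 NN e3.
have H1 : `|F h - series (f ^~ h) m| <= e / 3.
  by apply: cvg_series_tail_le (fF h hr) _ mP => n; exact: psbounded_norm (fN n) hr.
have H2 K : `|series (fun k => C k * h ^+ k) K -
   series (fun n => \sum_(0 <= k < K) c n k * h ^+ k) m| <= e / 3.
  apply: cvg_series_tail_le mP => [|n]; last exact: hb.
  rewrite /series /=; under eq_fun do rewrite exchange_big /=.
  apply: (@cvg_sum_nat _ K (fun k K0 => \sum_(0 <= n < K0) c n k * h ^+ k)) => k.
  by under eq_fun do rewrite -mulr_suml; apply: cvgMl; exact: cC.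
have H3 : (fun K => series (fun n => \sum_(0 <= k < K) c n k * h ^+ k) m) @ \oo
   --> series (f ^~ h) m.
  apply: (@cvg_sum_nat _ m (fun n K => \sum_(0 <= k < K) c n k * h ^+ k)) => n.
  by have [_ /(_ h hr)] := cP n.
move/cvgrPdist_le : H3 => /(_ _ e3) [K0 _ K0P]; exists K0 => // K /= /K0P H3.
rewrite /pseries.
have := H2 K; move: H1 H3 => /=.
set x1 := F h; set x2 := series _ m; set x3 := series _ m; set x4 := series _ K.
rewrite !ler_norml => /andP[? ?] /andP[? ?] /andP[? ?]; apply/andP; split; lra.
Qed.

Lemma psbounded_eq rho N f g : psbounded rho N f ->
  (forall h, `|h| <= rho -> f h = g h) -> psbounded rho N g.
Proof. by move=> [c [cN cf]] fg; exists c; split=> // h hr; rewrite -fg//; exact: cf. Qed.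

Lemma psboundedW rho rho' N N' f : psbounded rho N f -> 0 <= rho' <= rho -> N <= N' ->
  psbounded rho' N' f.
Proof.
move=> [c [cN cf]] /andP[r0 rr] NN; exists c; split=> [K|h hr].
  apply: le_trans NN; apply: le_trans (cN K); apply: ler_sum => i _.
  by rewrite ler_wpM2l//; apply: lerXn2r => //; rewrite nnegrE // (le_trans r0).
by apply: cf; exact: le_trans rr.
Qed.

Lemma psbounded_cst rho a : psbounded rho `|a| (fun=> a).
Proof.
exists (fun k => if k is 0 then a else 0); split=> [[|K]|h hr].
- by rewrite big_nil.
- rewrite big_nat_recl//= expr0 mulr1 big1 ?addr0// => i _.
  by rewrite normr0 mul0r.
- apply/cvgrPdist_le => e e0; exists 1%N => // -[//|K] _ /=.
  rewrite /pseries /series /= big_nat_recl//= expr0 mulr1 big1 ?addr0; last first.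
    by move=> i _; rewrite mul0r.
  by rewrite subrr normr0 ltW.
Qed.

Lemma psbounded_scale rho N f a : psbounded rho N f ->
  psbounded rho (`|a| * N) (fun h => a * f h).
Proof.
move=> [c [cN cf]]; exists (fun k => a * c k); split=> [K|h hr].
  under eq_bigr do rewrite normrM -mulrA.
  by rewrite -mulr_sumr ler_wpM2l.
rewrite /pseries /series /=.
under eq_fun do under eq_bigr do rewrite -mulrA.
under eq_fun do rewrite -mulr_sumr.
by apply: cvgMr; exact: cf.
Qed.

Lemma psbounded_mulX rho N f : 0 <= rho -> psbounded rho N f ->
  psbounded rho (rho * N) (fun h => h * f h).
Proof.
move=> r0 [c [cN cf]]; exists (fun k => if k is k'.+1 then c k' else 0); split=> [[|K]|h hr].
- by rewrite big_nil mulr_ge0//; apply: le_trans (cN 0%N); rewrite big_nil.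
- rewrite big_nat_recl//= normr0 mul0r add0r.
  under eq_bigr do rewrite exprS mulrCA.
  by rewrite -mulr_sumr ler_wpM2l.
- rewrite -(cvg_shiftS _) /pseries /series /=.
  under eq_fun => n.
    rewrite big_nat_recl// mul0r add0r.
    under eq_bigr do rewrite exprS mulrCA.
    rewrite -mulr_sumr; over.
  by apply: cvgMr; exact: cf.
Qed.

Lemma psbounded_add rho N N' f g : 0 <= rho -> psbounded rho N f -> psbounded rho N' g ->
  psbounded rho (N + N') (fun h => f h + g h).
Proof.
move=> r0 [c [cN cf]] [d [dN dg]]; exists (fun k => c k + d k); split=> [K|h hr].
  apply: le_trans (lerD (cN K) (dN K)); rewrite -big_split /=.
  by apply: ler_sum => i _; rewrite -mulrDl ler_wpM2r ?exprn_ge0 ?ler_normD.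
rewrite /pseries /series /=.
under eq_fun do under eq_bigr do rewrite mulrDl.
under eq_fun do rewrite big_split.
by apply: cvgD; [exact: cf|exact: dg].
Qed.

(** The product is summed as the series of functions [c n * (h ^+ n * g h)], each of norm at most
    [|c n| rho^n N']; this replaces the Cauchy product of coefficients. *)
Lemma psbounded_mul rho N N' f g : 0 < rho -> psbounded rho N f -> psbounded rho N' g ->
  psbounded rho (N * N') (fun h => f h * g h).
Proof.
move=> rho0 fN gN; have r0 := ltW rho0; have N'0 := psbounded_ge0 gN.
have gX n : psbounded rho (rho ^+ n * N') (fun h => h ^+ n * g h).
  elim: n => [|n IH].
    by apply: psboundedW (psbounded_eq gN _) _ _ => [h _||]; rewrite ?expr0 ?mul1r ?r0 /=.
  apply: psboundedW (psbounded_eq (psbounded_mulX r0 IH) _) _ _ => [h _||] /=.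
  - by rewrite exprS mulrA.
  - by rewrite r0 /=.
  - by rewrite exprS mulrA.
have [c [cN cf]] := fN.
apply: (@psbounded_series rho (N * N') (fun n => `|c n| * (rho ^+ n * N'))
   (fun n h => c n * (h ^+ n * g h))) => // [n|K|h hr].
- exact: psbounded_scale.
- under eq_bigr do rewrite mulrA.
  by rewrite -mulr_suml ler_wpM2r.
- rewrite /series /=; under eq_fun => n.
    under eq_bigr do rewrite mulrA.
    rewrite -mulr_suml; over.
  by apply: cvgMl; exact: cf.
Qed.

Lemma psbounded_exp rho N f n : 0 < rho -> psbounded rho N f ->
  psbounded rho (N ^+ n) (fun h => f h ^+ n).
Proof.
move=> r0 fN; elim: n => [|n IH].
  have := psbounded_cst rho 1; rewrite normr1 => H.
  by apply: psbounded_eq H _ => h _; rewrite expr0.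
rewrite exprS; apply: psbounded_eq (psbounded_mul r0 fN IH) _ => h _.
by rewrite exprS.
Qed.

(** The norm [q] of the inner function is the radius at which the outer one is controlled, so
    [c n * f ^+ n] has norm at most [|c n| q^n]. *)
Lemma psbounded_comp rho q N f g : 0 < rho -> psbounded q N g -> psbounded rho q f ->
  psbounded rho N (g \o f).
Proof.
move=> r0 [c [cN cg]] fq.
apply: (@psbounded_series rho N (fun n => `|c n| * q ^+ n)
   (fun n h => c n * f h ^+ n)) => // [n|h hr].
  by apply: psbounded_scale; exact: psbounded_exp.
by apply: cg; exact: psbounded_norm fq hr.
Qed.

(* The constant term vanishes, so the bound shrinks linearly with the radius. *)
Lemma psbounded_shrink rho N f : 0 < rho -> psbounded rho N f -> f 0 = 0 ->
  exists2 g, (forall h, `|h| <= rho -> f h = h * g h) & psbounded rho (N / rho) g.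
Proof.
move=> rho0 [c [cN cf]] f0.
have c0 : c 0%N = 0.
  have H : pseries c 0 @ \oo --> c 0%N.
    apply/cvgrPdist_le => e e0; exists 1%N => // -[//|K] _ /=.
    rewrite /pseries /series /= big_nat_recl//= expr0 mulr1 big1 ?addr0; last first.
      by move=> i _; rewrite exprS mul0r mulr0.
    by rewrite subrr normr0 ltW.
  have H0 : `|0 : R| <= rho by rewrite normr0 ltW.
  by rewrite -f0; apply: cvg_unique H (cf 0 H0).
have cv h : `|h| <= rho -> series (fun k => c k.+1 * h ^+ k) @ \oo -->
    limn (series (fun k => c k.+1 * h ^+ k)).
  move=> hr; apply: (@bounded_series_norm_cvg _ _ (fun k => `|c k.+1| * rho ^+ k)
     (N / rho)) => [n|K].
    rewrite normrM normrX ler_wpM2l//; apply: lerXn2r => //; rewrite nnegrE.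
    exact: ltW.
  rewrite ler_pdivlMr// mulr_suml; apply: le_trans (cN K.+1).
  rewrite big_nat_recl//= c0 normr0 mul0r add0r; apply: ler_sum => i _.
  by rewrite -mulrA exprSr.
exists (fun h => limn (series (fun k => c k.+1 * h ^+ k))) => [h hr|].
  have H : pseries c h @ \oo --> h * limn (series (fun k => c k.+1 * h ^+ k)).
    rewrite -(cvg_shiftS _) /pseries /series /=.
    under eq_fun => n.
      rewrite big_nat_recl// c0 mul0r add0r.
      under eq_bigr do rewrite exprS mulrCA.
      rewrite -mulr_sumr; over.
    by apply: cvgMr; exact: cv.
  by rewrite -(cvg_lim _ H)//; apply/esym/cvg_lim => //; exact: cf.
exists (fun k => c k.+1); split=> // K.
rewrite ler_pdivlMr// mulr_suml; apply: le_trans (cN K.+1).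
rewrite big_nat_recl//= c0 normr0 mul0r add0r; apply: ler_sum => i _.
by rewrite -mulrA exprSr.
Qed.

Lemma psbounded_small rho N f e : 0 < rho -> psbounded rho N f -> f 0 = 0 -> 0 < e ->
  exists2 r, 0 < r <= rho & psbounded r e f.
Proof.
move=> rho0 fN f0 e0; have N0 := psbounded_ge0 fN.
have [g fg gN] := psbounded_shrink rho0 fN f0.
(* The bound at radius [r] is [r * (N / rho)]; the [+ 1] keeps the divisor positive when [N] is
   0. *)
pose r := Num.min rho (e / (N / rho + 1)).
have d0 : 0 < N / rho + 1 by rewrite ltr_wpDl// divr_ge0// ltW.
have r0 : 0 < r by rewrite lt_min rho0 divr_gt0.
have rr : r <= rho by rewrite ge_min lexx.
exists r; first by rewrite r0.
have g' : psbounded r (N / rho) g by apply: psboundedW gN _ _ => //; rewrite ltW.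
apply: psboundedW (psbounded_eq (psbounded_mulX (ltW r0) g') _) _ _ => [h hr||].
- by rewrite fg//; exact: le_trans rr.
- by rewrite ltW /=.
- have : r <= e / (N / rho + 1) by rewrite ge_min lexx orbT.
  rewrite ler_pdivlMr// mulrDr mulr1; apply: le_trans.
  by rewrite lerDl ltW.
Qed.

Lemma psbounded_inv q : 0 < q < 1 -> psbounded q (1 - q)^-1 (fun y => (1 - y)^-1).
Proof.
move=> /andP[q0 q1]; exists (fun=> 1); split=> [K|h hr].
  have cg : series (geometric 1 q) @ \oo --> 1 / (1 - q).
    by apply: cvg_geometric_series; rewrite gtr0_norm.
  rewrite -div1r -(cvg_lim _ cg)//.
  have -> : \sum_(0 <= k < K) `|1 : R| * q ^+ k = series (geometric 1 q) K.
    by rewrite /series /=; apply: eq_bigr => i _; rewrite normr1.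
  apply: nondecreasing_cvgn_le; last by apply/cvg_ex; exists (1 / (1 - q)).
  by apply: nondecreasing_series => n _ _; rewrite /= mul1r exprn_ge0// ltW.
have := @cvg_geometric_series _ 1 h; rewrite div1r; apply.
exact: le_lt_trans q1.
Qed.

Lemma psbounded_expR q : 0 <= q -> psbounded q (expR q) expR.
Proof.
move=> q0; exists (fun n => (n`!%:R)^-1); split=> [K|h _].
  have -> : \sum_(0 <= k < K) `|(k`!%:R : R)^-1| * q ^+ k = series (exp_coeff q) K.
    rewrite /series /=; apply: eq_bigr => i _.
    by rewrite exp_coeffE ger0_norm ?invr_ge0.
  rewrite /expR; apply: nondecreasing_cvgn_le; last exact: is_cvg_series_exp_coeff.
  by apply: nondecreasing_series => n _ _; exact: exp_coeff_ge0.
have -> : pseries (fun n => (n`!%:R)^-1) h = series (exp_coeff h).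
  by rewrite /pseries exp_coeffE.
exact: is_cvg_series_exp_coeff.
Qed.

(** Halving the radius pays for the factor [i + 1] produced by differentiation, because
    [i + 1 <= 2 * 2^i]. *)
Lemma diffs_bounded (c : R^nat) rho N : 0 < rho ->
  (forall K, \sum_(0 <= k < K) `|c k| * rho ^+ k <= N) ->
  forall K, \sum_(0 <= k < K) `|pseries_diffs c k| * (rho / 2) ^+ k <= 2 * N / rho.
Proof.
move=> r0 cN K; rewrite ler_pdivlMr// mulr_suml.
apply: (@le_trans _ _ (2 * \sum_(0 <= k < K.+1) `|c k| * rho ^+ k)); last first.
  by rewrite ler_wpM2l.
rewrite big_nat_recl//= mulrDr mulr_sumr.
apply: (@le_trans _ _ (\sum_(0 <= i < K) 2 * (`|c i.+1| * rho ^+ i.+1))); last first.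
  by rewrite lerDr !mulr_ge0 ?expr0.
apply: ler_sum => i _; rewrite /pseries_diffs normrM normr_nat.
rewrite expr_div_n exprSr.
have -> : i.+1%:R * `|c i.+1| * (rho ^+ i / 2 ^+ i) * rho =
  (i.+1%:R / 2 ^+ i) * (`|c i.+1| * (rho ^+ i * rho)) by ring.
have rr := ltW r0.
apply: ler_wpM2r; first by rewrite !mulr_ge0 ?exprn_ge0.
rewrite ler_pdivrMr ?exprn_gt0// -exprS -natrX ler_nat.
exact: ltnW (ltn_expl _ _).
Qed.

(** Termwise differentiation asks for convergence of the series and of its first two formal
    derivatives at one point beyond [|h|]. Two formal derivatives halve the radius twice, hence
    [rho / 4]. *)
Lemma diffs_is_derive (c : R^nat) rho N (h : R) : 0 < rho ->
  (forall K, \sum_(0 <= k < K) `|c k| * rho ^+ k <= N) -> `|h| < rho / 4 ->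
  is_derive h 1 (fun h => limn (pseries c h)) (limn (pseries (pseries_diffs c) h)).
Proof.
move=> r0 cN hr.
have cv (d : R^nat) r M K : 0 <= K <= r -> (forall K, \sum_(0 <= k < K) `|d k| * r ^+ k <= M) ->
    cvgn (pseries d K).
  move=> /andP[K0 Kr] dM; apply: bounded_series_norm_cvg dM => n.
  rewrite normrM normrX ler_wpM2l//; apply: lerXn2r => //.
  - by rewrite nnegrE (le_trans K0).
  - by rewrite ger0_norm.
have r2 : 0 < rho / 2 by lra.
have c1 := diffs_bounded r0 cN; have c2 := diffs_bounded r2 c1.
apply: (@pseries_snd_diffs _ c (rho / 4)).
- by apply: (cv _ _ _ _ _ cN); lra.
- by apply: (cv _ _ _ _ _ c1); lra.
- by apply: (cv _ _ _ _ _ c2); lra.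
- by rewrite (ger0_norm (_ : 0 <= rho / 4))//; lra.
Qed.

Lemma norm_lt_near (h r : R) : `|h| < r -> \forall s \near h, `|s| < r.
Proof.
move=> hr; have d0 : 0 < r - `|h| by rewrite subr_gt0.
near=> s; rewrite -(subrK h s); apply: le_lt_trans (ler_normD _ _) _.
rewrite -ltrBrDr distrC; near: s; exact: cvgr_dist_lt.
Unshelve. all: by end_near. Qed.

Lemma psbounded_derive rho N f : 0 < rho -> psbounded rho N f ->
  exists2 g, psbounded (rho / 4) (2 * N / rho) g &
    forall h : R, `|h| < rho / 4 -> is_derive h 1 f (g h).
Proof.
move=> r0 [c [cN cf]]; have c1 := diffs_bounded r0 cN.
exists (fun h => limn (pseries (pseries_diffs c) h)) => [|h hr].
  have H : psbounded (rho / 2) (2 * N / rho) (fun h => limn (pseries (pseries_diffs c) h)).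
    exists (pseries_diffs c); split=> // h hr.
    apply: bounded_series_norm_cvg c1 => n.
    rewrite normrM normrX ler_wpM2l//; apply: lerXn2r => //; rewrite nnegrE; lra.
  by apply: psboundedW H _ _ => //; lra.
have D := diffs_is_derive r0 cN hr.
apply: near_eq_is_derive D.
have : \forall s \near h, `|s| < rho / 4 by exact: norm_lt_near.
apply: filterS => s sr; apply: cvg_lim => //; apply: cf; lra.
Qed.

Lemma is_derive0_cst rho f : (forall h : R, `|h| < rho -> is_derive h 1 f 0) ->
  forall h, `|h| < rho -> f h = f 0.
Proof.
move=> fD h hr.
have H (a b : R) : a <= b -> `|a| < rho -> `|b| < rho -> f b - f a = 0.
  move=> ab ar br.
  have I x : a <= x <= b -> `|x| < rho.
    by move: ar br; rewrite !ltr_norml => /andP[? ?] /andP[? ?] /andP[? ?]; apply/andP; split; lra.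
  have [||c _ ->] := @MVT_segment _ f (fun=> 0) a b ab.
  - by move=> x; rewrite in_itv/= => /andP[? ?]; apply: fD; apply: I; rewrite !ltW.
  - apply: derivable_within_continuous => x; rewrite in_itv/= => xab.
    by have [] := fD _ (I _ xab).
  - by rewrite mul0r.
have z0 : `|0 : R| < rho by rewrite normr0; apply: le_lt_trans hr.
have [h0|/ltW h0] := leP 0 h; apply/eqP; rewrite -subr_eq0.
  by rewrite H.
by rewrite -opprB oppr_eq0 H.
Qed.

(** The series of [g] is integrated termwise with constant term [f 0]; its difference from [f] has
    derivative 0 on the open interval of radius [rho / 4] and vanishes at 0. The closed interval of
    radius [rho / 8] lies safely inside. *)
Lemma psbounded_primitive rho N f g : 0 < rho -> psbounded rho N g ->
  (forall h : R, `|h| < rho -> is_derive h 1 f (g h)) ->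
  exists M, psbounded (rho / 8) M f.
Proof.
move=> r0 [c [cN cg]] fD.
pose d k := if k is k'.+1 then c k' / k'.+1%:R else f 0.
have dN K : \sum_(0 <= k < K) `|d k| * rho ^+ k <= `|f 0| + rho * N.
  have N0 : 0 <= N by apply: le_trans (cN 0%N); rewrite big_nil.
  case: K => [|K]; first by rewrite big_nil addr_ge0// mulr_ge0// ltW.
  rewrite big_nat_recl//= expr0 mulr1 lerD2l.
  apply: (@le_trans _ _ (rho * \sum_(0 <= k < K) `|c k| * rho ^+ k)).
    rewrite mulr_sumr; apply: ler_sum => i _.
    rewrite exprS mulrCA; apply: ler_wpM2l; first exact: ltW.
    apply: ler_wpM2r; first by rewrite exprn_ge0// ltW.
    rewrite normrM normfV normr_nat ler_pdivrMr// ler_peMr// ler1n//.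
  by rewrite ler_wpM2l// ltW.
have dc : pseries_diffs d = c.
  by apply/funext => k; rewrite /pseries_diffs /d mulrC divfK.
have cv h : `|h| <= rho -> pseries d h @ \oo --> limn (pseries d h).
  move=> hr; apply: bounded_series_norm_cvg dN => n.
  rewrite normrM normrX ler_wpM2l//; apply: lerXn2r => //; rewrite nnegrE; lra.
have FD (h : R) : `|h| < rho / 4 -> is_derive h 1 (fun h => f h - limn (pseries d h)) 0.
  move=> hr; have D := diffs_is_derive r0 dN hr.
  have D2 : is_derive h 1 f (g h) by apply: fD; lra.
  rewrite dc (cvg_lim _ (cg h _)) in D => //; last lra.
  by apply: is_derive_eq (is_deriveB D2 D) _; rewrite subrr.
have d0 : limn (pseries d 0) = f 0.
  apply: cvg_lim => //.
  apply/cvgrPdist_le => e e0; exists 1%N => // -[//|K] _ /=.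
  rewrite /pseries /series /= big_nat_recl//= expr0 mulr1 big1 ?addr0; last first.
    by move=> i _; rewrite exprS mul0r mulr0.
  by rewrite subrr normr0 ltW.
have H : psbounded rho (`|f 0| + rho * N) (fun h => limn (pseries d h)).
  by exists d.
exists (`|f 0| + rho * N).
apply: (psbounded_eq (f := fun h => limn (pseries d h))).
  apply: psboundedW H _ _ => //; lra.
move=> h hr; have := @is_derive0_cst _ _ FD h; rewrite d0 subrr => H1.
by apply/esym/eqP; rewrite -subr_eq0 H1//; lra.
Qed.

End PowerSeries.

(** * Analyticity at a point and its closure properties *)

Section AnalyticAt.
Variable R : realType.
Implicit Types (f g : R -> R) (a s : R).

Definition analytic_at f a : Prop :=
  exists rho N, 0 < rho /\ psbounded rho N (fun h => f (a + h)).

Lemma analytic_at_near f g a : (\forall s \near a, f s = g s) ->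
  analytic_at f a -> analytic_at g a.
Proof.
move=> /nbhs_ballP[e /= e0 fg] [rho [N [r0 fN]]].
pose r := Num.min rho (e / 2).
have r1 : 0 < r by rewrite lt_min r0 divr_gt0.
have [r2 r3] : r <= rho /\ r <= e / 2 by rewrite !ge_min !lexx orbT.
exists r, N; split=> //; apply: (psbounded_eq (f := fun h => f (a + h))).
  by apply: psboundedW fN _ _ => //; rewrite ltW.
move=> h hr; apply: fg; rewrite /ball/= opprD addNKr normrN; lra.
Qed.

(** The issue is to pass from mere convergence near [a] to a norm bound. As in Abel's lemma,
    convergence at [a + e / 2] bounds the terms there by some [B], and at radius [e / 4] they are
    dominated by [B / 2^n], with sum at most [2 B]. *)
Lemma real_analyticP f : real_analytic f <-> forall a, analytic_at f a.
Proof.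
split=> [fA a|fA a]; last first.
  have [rho [N [r0 [c [_ cf]]]]] := fA a.
  exists c; near=> s.
  have -> : f s = f (a + (s - a)) by rewrite addrC subrK.
  apply: cf.
  rewrite distrC; near: s; exact: cvgr_dist_le.
have [c /nbhs_ballP[e /= e0 cf]] := fA a.
have e2 : ball a e (a + e / 2).
  by rewrite /ball/= opprD addNKr normrN gtr0_norm; lra.
have /cvgP/cvg_series_cvg_0 := cf _ e2; rewrite addrAC subrr add0r => cv0.
have /cvg_seq_bounded : cvgn (fun n => c n * (e / 2) ^+ n) by apply/cvg_ex; exists 0.
case=> B0' [_ /(_ (B0' + 1))]; set B := B0' + 1 => HB.
have cB n : `|c n * (e / 2) ^+ n| <= B by apply: HB => //; rewrite ltrDl.
have B0 : 0 <= B by apply: le_trans (cB 0%N).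
exists (e / 4), (B * 2); split; first lra.
exists c; split=> [K|h hr].
  apply: (@le_trans _ _ (\sum_(0 <= k < K) B * (1 / 2) ^+ k)).
    apply: ler_sum => i _.
    have -> : e / 4 = e / 2 * (1 / 2) by lra.
    rewrite exprMn mulrA; apply: ler_wpM2r; first by rewrite exprn_ge0//; lra.
    by have := cB i; rewrite normrM normrX (ger0_norm (_ : 0 <= e / 2))//; lra.
  rewrite -mulr_sumr ler_wpM2l//.
  have cg : series (geometric 1 (1 / 2 : R)) @ \oo --> (1 / (1 - 1 / 2) : R).
    by apply: cvg_geometric_series; rewrite gtr0_norm; lra.
  have -> : \sum_(0 <= i < K) (1 / 2) ^+ i = series (geometric 1 (1 / 2 : R)) K.
    by rewrite /series /=; apply: eq_bigr => i _; rewrite [RHS]mul1r.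
  have l2 : limn (series (geometric 1 (1 / 2 : R))) = 2.
    by rewrite (cvg_lim _ cg)//; field.
  apply: (@le_trans _ _ (limn (series (geometric 1 (1 / 2 : R))))); last by rewrite l2.
  apply: nondecreasing_cvgn_le; last by apply/cvg_ex; exists (1 / (1 - 1 / 2)).
  by apply: nondecreasing_series => n _ _; rewrite /= mul1r exprn_ge0//; lra.
have := cf (a + h); rewrite addrAC subrr add0r; apply.
by rewrite /ball/= opprD addNKr normrN; lra.
Unshelve. all: by end_near. Qed.

Lemma analytic_at2 f g a : analytic_at f a -> analytic_at g a ->
  exists rho N N', [/\ 0 < rho, psbounded rho N (fun h => f (a + h)) &
    psbounded rho N' (fun h => g (a + h))].
Proof.
move=> [r [N [r0 fN]]] [r' [N' [r0' gN]]].
have m0 : 0 < Num.min r r' by rewrite lt_min r0.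
exists (Num.min r r'), N, N'; split=> //.
- by apply: psboundedW fN _ _ => //; rewrite (ltW m0) ge_min lexx.
- by apply: psboundedW gN _ _ => //; rewrite (ltW m0) ge_min lexx orbT.
Qed.

Lemma analytic_at_cst (b a : R) : analytic_at (fun=> b) a.
Proof. by exists 1, `|b|; split=> //; exact: psbounded_cst. Qed.

Lemma analytic_atD f g a : analytic_at f a -> analytic_at g a ->
  analytic_at (fun s => f s + g s) a.
Proof.
move=> fA gA; have [r [N [N' [r0 fN gN]]]] := analytic_at2 fA gA.
by exists r, (N + N'); split=> //; apply: psbounded_add => //; exact: ltW.
Qed.

Lemma analytic_atM f g a : analytic_at f a -> analytic_at g a ->
  analytic_at (fun s => f s * g s) a.
Proof.
move=> fA gA; have [r [N [N' [r0 fN gN]]]] := analytic_at2 fA gA.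
by exists r, (N * N'); split=> //; apply: psbounded_mul.
Qed.

Lemma analytic_atN f a : analytic_at f a -> analytic_at (fun s => - f s) a.
Proof.
move=> fA; have -> : (fun s => - f s) = (fun s => -1 * f s).
  by apply/funext => s; rewrite mulN1r.
exact: analytic_atM (analytic_at_cst _ _) fA.
Qed.

Lemma analytic_atB f g a : analytic_at f a -> analytic_at g a ->
  analytic_at (fun s => f s - g s) a.
Proof. by move=> fA gA; apply: analytic_atD => //; exact: analytic_atN. Qed.

Lemma analytic_at_id a : analytic_at id a.
Proof.
exists 1, (`|a| + 1 * `|1 : R|); split=> //=.
apply: psbounded_add => //; first exact: psbounded_cst.
apply: psbounded_eq (psbounded_mulX _ (psbounded_cst 1 1)) _ => // h _.
by rewrite mulr1.
Qed.

Lemma analytic_atX f a n : analytic_at f a -> analytic_at (fun s => f s ^+ n) a.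
Proof.
by move=> [r [N [r0 fN]]]; exists r, (N ^+ n); split=> //; exact: psbounded_exp.
Qed.

Lemma analytic_at_expR f a : analytic_at f a -> analytic_at (fun s => expR (f s)) a.
Proof.
move=> [r [N [r0 fN]]]; exists r, (expR N); split=> //.
exact: psbounded_comp (psbounded_expR (psbounded_ge0 fN)) fN.
Qed.

(** Write [1 / f] as [(1 / f a) * 1 / (1 - y)] with [y = 1 - f / f a]. Since [y] vanishes at [a],
    its norm drops to [1/2] on a small disc, where the geometric series can be composed with it. *)
Lemma analytic_atV f a : f a != 0 -> analytic_at f a -> analytic_at (fun s => (f s)^-1) a.
Proof.
move=> fa0 fA.
have : analytic_at (fun s => 1 - (f a)^-1 * f s) a.
  by apply: analytic_atB; [|apply: analytic_atM => //]; exact: analytic_at_cst.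
move=> [r [N [r0 gN]]].
have [||r' /andP[r'0 _] g'] := psbounded_small (e := 1 / 2) r0 gN.
- by rewrite addr0 mulVf// subrr.
- lra.
have I : psbounded (1 / 2 : R) (1 - 1 / 2)^-1 (fun y => (1 - y)^-1).
  by apply: psbounded_inv; lra.
exists r', (`|(f a)^-1| * (1 - 1 / 2)^-1); split=> //.
apply: psbounded_eq (psbounded_scale _ (psbounded_comp r'0 I g')) _ => h _ /=.
by rewrite opprB addrC subrK invfM invrK mulrA mulVf// mul1r.
Qed.

Lemma is_derive_shift f a (h d : R) : is_derive h 1 (fun h => f (a + h)) d ->
  is_derive (a + h) 1 f d.
Proof.
move=> D.
have -> : f = (fun h => f (a + h)) \o (fun s => s - a).
  by apply/funext => s /=; rewrite addrC subrK.
have E : a + h - a = h by rewrite addrAC subrr add0r.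
rewrite -(mulr1 d); apply: is_derive1_comp; first by rewrite E.
by apply: is_derive_eq; rewrite subr0.
Qed.

Lemma is_derive_unshift f a (h d : R) : is_derive (a + h) 1 f d ->
  is_derive h 1 (fun h => f (a + h)) d.
Proof.
move=> D; rewrite -(mulr1 d).
apply: (@is_derive1_comp _ f (fun h => a + h)) => //.
by rewrite -[X in is_derive _ _ _ X]add0r; exact: is_deriveD.
Qed.

Lemma analytic_at_is_derive f a : analytic_at f a ->
  exists2 g, analytic_at g a & \forall s \near a, is_derive (s : R) 1 f (g s).
Proof.
move=> [r [N [r0 fN]]]; have [g gN gD] := psbounded_derive r0 fN.
exists (fun s => g (s - a)).
  exists (r / 4), (2 * N / r); split; first lra.
  by apply: psbounded_eq gN _ => h _; rewrite addrAC subrr add0r.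
near=> s; rewrite -{1}(subrK a s) addrC; apply: is_derive_shift; apply: gD.
rewrite distrC; near: s; apply: cvgr_dist_lt => //; lra.
Unshelve. all: by end_near. Qed.

Lemma analytic_at_derivable f a : analytic_at f a ->
  \forall s \near a, derivable f s 1.
Proof. by move=> /analytic_at_is_derive[g _]; apply: filterS => s []. Qed.

Lemma analytic_at_derive1 f a : analytic_at f a -> analytic_at f^`() a.
Proof.
move=> /analytic_at_is_derive[g gA gD]; apply: analytic_at_near gA.
by apply: filterS gD => s [_ <-]; rewrite derive1E.
Qed.

Lemma analytic_at_derive1n n f a : analytic_at f a -> analytic_at f^`(n) a.
Proof. by move=> fA; elim: n => // n IH; rewrite derive1nS; exact: analytic_at_derive1. Qed.

Lemma analytic_at_continuous f a : analytic_at f a -> {for a, continuous f}.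
Proof.
move=> /analytic_at_derivable/nbhs_singleton D.
by apply: differentiable_continuous; exact/derivable1_diffP.
Qed.

Lemma analytic_at_primitive f g a : analytic_at g a ->
  (\forall s \near a, is_derive (s : R) 1 f (g s)) -> analytic_at f a.
Proof.
move=> [r [N [r0 gN]]] /nbhs_ballP[e /= e0 fD].
pose r' := Num.min r e.
have r1 : 0 < r' by rewrite lt_min r0.
have [r2 r3] : r' <= r /\ r' <= e by rewrite !ge_min !lexx orbT.
have gN' : psbounded r' N (fun h => g (a + h)).
  by apply: psboundedW gN _ _ => //; rewrite ltW.
have [|M fM] := psbounded_primitive (f := fun h => f (a + h)) r1 gN'.
  move=> h hr; apply: is_derive_unshift; apply: fD.
  by rewrite /ball/= opprD addNKr normrN; lra.
by exists (r' / 8), M; split=> //; lra.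
Qed.

Lemma continuous_gt0_near f a : {for a, continuous f} -> 0 < f a -> \forall s \near a, 0 < f s.
Proof. by move=> fc fa; exact: (cvgr_gt _ fc). Qed.

(** [ln f] is obtained as a primitive of the analytic function [f' / f]. *)
Lemma analytic_at_ln f a : 0 < f a -> analytic_at f a -> analytic_at (fun s => ln (f s)) a.
Proof.
move=> fa fA; have [g gA gD] := analytic_at_is_derive fA.
apply: (@analytic_at_primitive _ (fun s => (f s)^-1 * g s)).
  by apply: analytic_atM => //; apply: analytic_atV => //; rewrite gt_eqF.
near=> s; apply: (@is_derive1_comp _ (@ln R) f).
  apply: is_derive1_ln; near: s.
  by apply: continuous_gt0_near => //; exact: analytic_at_continuous.
by near: s.
Unshelve. all: by end_near. Qed.

(** Near [a] the square root is [expR (ln f / 2)]. *)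
Lemma analytic_at_sqrt f a : 0 < f a -> analytic_at f a ->
  analytic_at (fun s => Num.sqrt (f s)) a.
Proof.
move=> fa fA.
apply: (@analytic_at_near (fun s => expR (ln (f s) * 2^-1))); last first.
  apply: analytic_at_expR; apply: analytic_atM (analytic_at_cst _ _).
  exact: analytic_at_ln.
have := continuous_gt0_near (analytic_at_continuous fA) fa.
apply: filterS => s s0; apply/eqP; rewrite -(@eqrXn2 _ 2%N)// ?expR_ge0//.
rewrite sqr_sqrtr ?ltW// -expRM_natr -mulrA mulVf// mulr1 lnK//.
Qed.

Lemma analytic_at_divX f a : f a = 0 -> analytic_at f a ->
  exists2 g, analytic_at g a & forall s, s != a -> g s = f s / (s - a).
Proof.
move=> fa [r [N [r0 fN]]].
have [|g fg gN] := psbounded_shrink r0 fN; first by rewrite addr0.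
exists (fun s => if s == a then g 0 else f s / (s - a)); last first.
  by move=> s /negPf ->.
exists r, (N / r); split=> //; apply: psbounded_eq gN _ => h hr.
have [->|h0] := eqVneq h 0; first by rewrite addr0 eqxx.
rewrite -subr_eq0 addrAC subrr add0r (negPf h0) fg// mulrC.
by rewrite mulrA mulVf// mul1r.
Qed.

End AnalyticAt.

(** * One-dimensional integrals *)

Section IntegralTools.
Variable R : realType.
Implicit Types (f g F : R -> R) (a b c : R).
Local Notation mu := (@lebesgue_measure R).

Lemma continuous_pair (T U V : topologicalType) (f : T -> U) (g : T -> V) x :
  {for x, continuous f} -> {for x, continuous g} ->
  {for x, continuous (fun t => (f t, g t))}.
Proof. by move=> fx gx; apply: cvg_pair. Qed.

Lemma continuous_integrable f a b : continuous f -> mu.-integrable `[a, b] (EFin \o f).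
Proof.
move=> fc; apply: continuous_compact_integrable; first exact: segment_compact.
exact: continuous_subspaceT.
Qed.

Lemma ge0_gt0_itv a b : a <= b -> a = b \/ a < b.
Proof. by rewrite le_eqVlt => /predU1P. Qed.

Lemma Rintegral_id_itv f a : \int[mu]_(x in `[a, a]) f x = 0.
Proof. by rewrite set_itv1 Rintegral_set1. Qed.

Lemma is_derive0_itv F a b : a <= b ->
  (forall s, a <= s <= b -> is_derive (s : R) 1 F 0) -> F b = F a.
Proof.
move=> ab FD.
have [||c _] := @MVT_segment _ F (fun=> 0) a b ab.
- by move=> x; rewrite in_itv/= => /andP[? ?]; apply: FD; lra.
- apply: derivable_within_continuous => x; rewrite in_itv/= => xab.
  by have [] := FD x xab.
- by rewrite mul0r => /eqP; rewrite subr_eq0 => /eqP.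
Qed.

Lemma is_derive_mull (c s : R) : is_derive s 1 (fun x => c * x) c.
Proof.
rewrite -[X in is_derive _ _ _ X](_ : c *: 1 + s *: 0 = _).
  exact: (is_deriveM (is_derive_cst c s 1) (is_derive_id s 1)).
by rewrite scaler0 addr0 /GRing.scale /= mulr1.
Qed.

(** The integrand may be singular at the ends, where [F] has only one-sided limits. Comparing [F]
    with the indefinite integral [G]: [F - G] has derivative 0 inside, hence is constant, and its
    limits at the two ends are [Fa] and [Fb - G b]. This form serves both the logarithmic
    singularities and the jump of the arctangent. *)
Lemma FTC_lim f F a b (Fa Fb : R) : a < b ->
  mu.-integrable `[a, b] (EFin \o f) ->
  (forall s, a < s < b -> {for s, continuous f}) ->
  (forall s, a < s < b -> is_derive (s : R) 1 F (f s)) ->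
  F s @[s --> a^'+] --> Fa -> F s @[s --> b^'-] --> Fb ->
  \int[mu]_(s in `[a, b]) f s = Fb - Fa.
Proof.
move=> ab fi fc FD cFa cFb.
pose G y := \int[mu]_(s in `[a, y]) f s.
have GD s : a < s < b -> is_derive (s : R) 1 G (f s).
  move=> /andP[as_ sb].
  have sab : a < s < b by rewrite as_.
  have [d e] := continuous_FTC1_closed sb fi as_ (fc s sab).
  by split; [exact: d|rewrite -derive1E e].
have cGa : G s @[s --> a^'+] --> 0.
  apply: cvg_at_right_filter; exact: parameterized_integral_cvg_left ab fi.
have cGb : G s @[s --> b^'-] --> G b := parameterized_integral_cvg_at_left ab fi.
pose H s := F s - G s.
have HD s : a < s < b -> is_derive (s : R) 1 H 0.
  by move=> sab; apply: is_derive_eq (is_deriveB (FD _ sab) (GD _ sab)) _; rewrite subrr.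
have Hc s1 s2 : a < s1 < b -> a < s2 < b -> s1 <= s2 -> H s1 = H s2.
  move=> /andP[? ?] /andP[? ?] s12.
  by apply/esym; apply: is_derive0_itv => // s /andP[? ?]; apply: HD; lra.
pose m := (a + b) / 2.
have mab : a < m < b by rewrite /m; lra.
have Hm s : a < s < b -> H s = H m.
  move=> sab; have [sm|/ltW ms] := leP s m; first exact: Hc.
  by apply/esym; exact: Hc.
have : H s @[s --> a^'+] --> Fa - 0 by apply: cvgB.
have : H s @[s --> b^'-] --> Fb - G b by apply: cvgB.
have lim1 (T : set_system R) (l : R) : ProperFilter T ->
    (\forall s \near T, a < s < b) -> H s @[s --> T] --> l -> l = H m.
  move=> PT nT cT; apply: cvg_unique cT _ => //.
  have -> : nbhs (H s @[s --> T]) = nbhs (H s @[s --> T]) by [].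
  apply: cvg_near_cst; apply: filterS nT => s sab; exact: Hm.
move=> cHb cHa.
have eb : Fb - G b = H m.
  apply: (lim1 (b^'-) _ _ _ cHb).
  near=> s; apply/andP; split; near: s; [exact: nbhs_left_gt|exact: nbhs_left_lt].
have ea : Fa - 0 = H m.
  apply: (lim1 (a^'+) _ _ _ cHa).
  near=> s; apply/andP; split; near: s; [exact: nbhs_right_gt|exact: nbhs_right_lt].
by rewrite -/(G b); lra.
Unshelve. all: by end_near. Qed.

Lemma FTC2_continuous f F a b : a <= b -> continuous f ->
  (forall s, is_derive (s : R) 1 F (f s)) ->
  \int[mu]_(s in `[a, b]) f s = F b - F a.
Proof.
move=> /ge0_gt0_itv[->|ab] fc FD; first by rewrite Rintegral_id_itv subrr.
have Fc : continuous F.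
  move=> s; apply: differentiable_continuous; apply/derivable1_diffP.
  by have [] := FD s.
apply: (FTC_lim (F := F) ab) => //.
- exact: continuous_integrable.
- by move=> s _; exact: fc.
- by apply: cvg_at_right_filter; exact: Fc.
- by apply: cvg_at_left_filter; exact: Fc.
Qed.

Lemma continuous_RintegralD f g a b : continuous f -> continuous g ->
  \int[mu]_(s in `[a, b]) (f s + g s) =
  \int[mu]_(s in `[a, b]) f s + \int[mu]_(s in `[a, b]) g s.
Proof. by move=> fc gc; apply: RintegralD => //; exact: continuous_integrable. Qed.

Lemma continuous_RintegralB f g a b : continuous f -> continuous g ->
  \int[mu]_(s in `[a, b]) (f s - g s) =
  \int[mu]_(s in `[a, b]) f s - \int[mu]_(s in `[a, b]) g s.
Proof. by move=> fc gc; apply: RintegralB => //; exact: continuous_integrable. Qed.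

Lemma continuous_RintegralZ f a b c : continuous f ->
  \int[mu]_(s in `[a, b]) (c * f s) = c * \int[mu]_(s in `[a, b]) f s.
Proof. by move=> fc; apply: RintegralZl => //; exact: continuous_integrable. Qed.

Lemma Rintegral_cst_itv a b c : a <= b -> \int[mu]_(s in `[a, b]) c = c * (b - a).
Proof.
move=> ab; rewrite (FTC2_continuous (F := fun s => c * s) ab _ (is_derive_mull c)) ?mulrBr//.
by move=> ?; exact: cvg_cst.
Qed.

Lemma continuous_Rintegral_le f a b c : a <= b -> continuous f ->
  (forall s, a <= s <= b -> `|f s| <= c) ->
  `|\int[mu]_(s in `[a, b]) f s| <= c * (b - a).
Proof.
move=> ab fc fle; rewrite -Rintegral_cst_itv//.
have nc : continuous (fun s => `|f s|).
  by move=> s; apply: (@cvg_comp _ _ _ f Num.norm _ _ _ (fc s)); exact: norm_continuous.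
apply: le_trans (le_normr_Rintegral _ _) _ => //; first exact: continuous_integrable.
apply: le_Rintegral => //.
- exact: continuous_integrable.
- by apply: continuous_integrable => ?; exact: cvg_cst.
Qed.

Lemma continuous_bounded_box (K : R -> R -> R) (u v a b : R) :
  continuous (fun p : R * R => K p.1 p.2) ->
  exists C : R, forall s th, u <= s <= v -> a <= th <= b -> `|K s th| <= C.
Proof.
move=> Kc.
have [ne|e] := pselect (`[u, v]%classic `*` `[a, b]%classic !=set0); last first.
  exists 0 => s th su ta; exfalso; apply: e; exists (s, th).
  by split => /=; rewrite in_itv.
have cp : compact (`[u, v]%classic `*` `[a, b]%classic).
  by apply: compact_setX; exact: segment_compact.
have nc : {within `[u, v]%classic `*` `[a, b]%classic,
    continuous (fun p : R * R => `|K p.1 p.2|)}.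
  apply: continuous_subspaceT => p.
  by apply: (@cvg_comp _ _ _ (fun p => K p.1 p.2) Num.norm _ _ _ (Kc p)); exact: norm_continuous.
have [c _ cP] := compact_EVT_max ne cp nc.
exists `|K c.1 c.2| => s th su ta; apply: (cP (s, th)).
by rewrite inE; split => /=; rewrite in_itv.
Qed.

Lemma continuous_section1 (K : R -> R -> R) s :
  continuous (fun p : R * R => K p.1 p.2) -> continuous (K s).
Proof.
move=> Kc th; apply: (@continuous_comp _ _ _ (fun th => (s, th)) (fun p : R * R => K p.1 p.2)).
  by apply: continuous_pair; [exact: cvg_cst|exact: cvg_id].
exact: Kc.
Qed.

Lemma continuous_section2 (K : R -> R -> R) th :
  continuous (fun p : R * R => K p.1 p.2) -> continuous (K ^~ th).
Proof.
move=> Kc s; apply: (@continuous_comp _ _ _ (fun s => (s, th)) (fun p : R * R => K p.1 p.2)).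
  by apply: continuous_pair; [exact: cvg_id|exact: cvg_cst].
exact: Kc.
Qed.

(** A bound of the continuous [dK] on a compact box supplies the constant dominating function. *)
Lemma is_derive_under_integral (K dK : R -> R -> R) (a b u v s : R) :
  (forall s, continuous (K s)) ->
  continuous (fun p : R * R => dK p.1 p.2) ->
  (forall s th, u < s < v -> is_derive (s : R) 1 (K ^~ th) (dK s th)) -> u < s < v ->
  is_derive (s : R) 1 (fun s => \int[mu]_(th in `[a, b]) K s th)
    (\int[mu]_(th in `[a, b]) dK s th).
Proof.
move=> Kc dKc KD suv.
have [C CP] := continuous_bounded_box u v a b dKc.
have I : `]u, v[%classic s by rewrite /= in_itv.
have pE x y : u < x < v -> partial1of2 K x y = dK x y.
  by move=> xuv; rewrite /partial1of2 derive1E; have [_] := KD x y xuv.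
have ic x : `]u, v[%classic x -> mu.-integrable `[a, b] (EFin \o K x).
  by move=> _; exact: continuous_integrable.
have dc x y : `]u, v[%classic x -> `[a, b]%classic y -> derivable (K ^~ y) x 1.
  by rewrite /= in_itv/= => xuv _; have [] := KD x y xuv.
have Gi : mu.-integrable `[a, b] (EFin \o (fun=> `|C|)).
  by apply: continuous_integrable => ?; exact: cvg_cst.
have Gub x y : `]u, v[%classic x -> `[a, b]%classic y ->
    `|partial1of2 K x y| <= `|C|.
  rewrite /= !in_itv/= => xuv yab; rewrite pE//; apply: le_trans (ler_norm _).
  by apply: CP => //; lra.
have mab : measurable `[a, b]%classic by [].
have D := @derivable_under_integral _ _ _ mu K _ mab _ _ _ I ic dc
  (fun=> `|C|) (fun=> normr_ge0 C) Gi Gub.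
have E := @differentiation_under_integral _ _ _ mu K _ mab _ _ _ I ic dc
  (fun=> `|C|) (fun=> normr_ge0 C) Gi Gub.
split=> //; rewrite -derive1E E.
by apply: eq_Rintegral => y _; rewrite pE.
Qed.

Lemma continuous_under_integral (K : R -> R -> R) (a b : R) :
  continuous (fun p : R * R => K p.1 p.2) ->
  continuous (fun s => \int[mu]_(th in `[a, b]) K s th).
Proof.
move=> Kc s.
have [C CP] := continuous_bounded_box (s - 1) (s + 1) a b Kc.
have I : (s : R) \in `](s - 1), (s + 1)[%classic by rewrite inE/= in_itv/=; lra.
have mab : measurable `[a, b]%classic by [].
have Gi : mu.-integrable `[a, b] (EFin \o (fun=> `|C|)).
  by apply: continuous_integrable => ?; exact: cvg_cst.
have ic x : `]s - 1, s + 1[%classic x -> mu.-integrable `[a, b] (EFin \o K x).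
  by move=> _; apply: continuous_integrable; exact: continuous_section1.
have cf : {ae mu, forall y, `[a, b]%classic y -> {in `]s - 1, s + 1[%classic, continuous (K ^~ y)}}.
  by apply/aeW => y _ x _; exact: (@continuous_section2 K y Kc x).
have gub x : `]s - 1, s + 1[%classic x ->
    {ae mu, forall y, `[a, b]%classic y -> `|K x y| <= `|C|}.
  rewrite /= in_itv/= => /andP[? ?]; apply/aeW => y.
  rewrite /= in_itv/= => yab; apply: le_trans (ler_norm _).
  by apply: CP => //; lra.
exact: (@continuity_under_integral _ _ _ mu K `[a, b]%classic mab _ _ ic cf _ Gi gub s I).
Qed.

Lemma Rintegral_itv_split f a b c : a <= b -> b <= c ->
  mu.-integrable `[a, c] (EFin \o f) ->
  \int[mu]_(s in `[a, c]) f s =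
  \int[mu]_(s in `[a, b]) f s + \int[mu]_(s in `[b, c]) f s.
Proof.
move=> ab bc fi.
have E : `[a, c]%classic = `[a, b]%classic `|` `]b, c]%classic.
  by rewrite -itv_bndbnd_setU// bnd_simp.
rewrite E Rintegral_setU//=; last 2 first.
- by rewrite -E.
- apply/disj_set2P; rewrite -subset0 => z/=; rewrite !in_itv/= => -[/andP[_]].
  by rewrite leNgt => /negbTE ->.
congr (_ + _); rewrite (@Rintegral_itv_obnd_cbnd _ b (BRight c) f)//.
apply: integrableS fi => //.
by apply: subset_itvScc; rewrite bnd_simp.
Qed.

(** The instance of Fubini's theorem that is used later. With [L] a primitive of [K] in [s], the
    function [Y y], the integral of [L y], has derivative equal to the integral of [K y], which is
    0; so [Y 1 = Y 0]. *)
Lemma Rintegral_iterated_eq0 (K : R -> R -> R) (a b : R) :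
  continuous (fun p : R * R => K p.1 p.2) ->
  (forall s, \int[mu]_(th in `[a, b]) K s th = 0) ->
  \int[mu]_(th in `[a, b]) (\int[mu]_(s in `[0, 1]) K s th) = 0.
Proof.
move=> Kc K0.
have Kc' : continuous (fun p : R * R => K p.2 p.1).
  move=> p; apply: (@continuous_comp _ _ _ (fun p : R * R => (p.2, p.1))
    (fun p : R * R => K p.1 p.2)); last exact: Kc.
  by apply: continuous_pair; [exact: cvg_snd|exact: cvg_fst].
(* Starting the integral at -1 places 0 and 1 in the interior of the range where [L] has a two-sided
   derivative. *)
pose L (y th : R) := \int[mu]_(s in `[-1, y]) K s th.
have Lc y : continuous (L y).
  exact: (@continuous_under_integral (fun th s => K s th)).
have LD (y th : R) : -1 < y < 2 -> is_derive y 1 (L ^~ th) (K y th).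
  move=> /andP[y1 y2].
  have Kt : continuous (K ^~ th) by exact: continuous_section2.
  have [|//|d e] := @continuous_FTC1_closed _ (K ^~ th) (-1) y (y + 1) _ _ y1 (Kt y).
  - by rewrite ltrDl.
  - exact: continuous_integrable.
  by apply: DeriveDef; [exact: d|rewrite -derive1E; exact: e].
have LE th : \int[mu]_(s in `[0, 1]) K s th = L 1 th - L 0 th.
  rewrite /L (@Rintegral_itv_split _ (-1) 0 1)//.
  - by rewrite addrC addKr.
  - by apply: continuous_integrable; exact: continuous_section2.
move: L Lc LD LE => L Lc LD LE.
under eq_Rintegral do rewrite LE.
rewrite continuous_RintegralB//.
pose Y y := \int[mu]_(th in `[a, b]) L y th.
have YD (y : R) : 0 <= y <= 1 -> is_derive y 1 Y 0.
  move=> /andP[y0 y1]; rewrite -(K0 y).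
  have yy : -1 < y < 2 by lra.
  exact: (@is_derive_under_integral L K a b (-1) 2 y Lc Kc LD yy).
by rewrite -/(Y 1) -/(Y 0) (is_derive0_itv ler01 YD) subrr.
Qed.

End IntegralTools.

(** * Differentiation rules for explicit real functions *)

Section DeriveRules.
Variable R : realType.
Implicit Types (f g : R -> R) (s df dg c : R).

Lemma is_derive_cst1 c s : is_derive s 1 (fun=> c) 0.
Proof. exact: is_derive_cst. Qed.

Lemma is_derive_id1 s : is_derive s 1 (fun x => x) 1.
Proof. exact: is_derive_id. Qed.

Lemma is_derive_add f g s df dg : is_derive s 1 f df -> is_derive s 1 g dg ->
  is_derive s 1 (fun x => f x + g x) (df + dg).
Proof. exact: is_deriveD. Qed.

Lemma is_derive_sub f g s df dg : is_derive s 1 f df -> is_derive s 1 g dg ->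
  is_derive s 1 (fun x => f x - g x) (df - dg).
Proof. exact: is_deriveB. Qed.

Lemma is_derive_opp f s df : is_derive s 1 f df -> is_derive s 1 (fun x => - f x) (- df).
Proof. exact: is_deriveN. Qed.

Lemma is_derive_mul f g s df dg : is_derive s 1 f df -> is_derive s 1 g dg ->
  is_derive s 1 (fun x => f x * g x) (df * g s + f s * dg).
Proof.
move=> fD gD; apply: is_derive_eq (is_deriveM fD gD) _.
by rewrite /GRing.scale /= addrC [g s * _]mulrC.
Qed.

Lemma is_derive_inv f s df : f s != 0 -> is_derive s 1 f df ->
  is_derive s 1 (fun x => (f x)^-1) (- df / f s ^+ 2).
Proof.
move=> f0 fD; apply: is_derive_eq (is_deriveV f0 fD) _.
by rewrite /GRing.scale /= mulrC mulNr mulrN.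
Qed.

Lemma is_derive_ln f s df : 0 < f s -> is_derive s 1 f df ->
  is_derive s 1 (fun x => ln (f x)) (df / f s).
Proof.
move=> f0 fD; rewrite mulrC; apply: (@is_derive1_comp _ (@ln R) f) => //.
exact: is_derive1_ln.
Qed.

Lemma is_derive_atan f s df : is_derive s 1 f df ->
  is_derive s 1 (fun x => atan (f x)) (df / (1 + f s ^+ 2)).
Proof. by move=> fD; rewrite mulrC; apply: (@is_derive1_comp _ (@atan R) f). Qed.

Lemma is_derive_continuous f s df : is_derive s 1 f df -> {for s, continuous f}.
Proof. by move=> [fD _]; apply: differentiable_continuous; exact/derivable1_diffP. Qed.

End DeriveRules.

(** * Analyticity of harmonic functions *)

Section PlaneCalculus.
Variable R : realType.
Implicit Types (u a b : R * R -> R).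

(** C^1 regularity in coordinate form: each partial is a one-variable derivative along a section, so
    the one-variable rules apply to it, and continuity of the partials stands in for total
    differentiability. *)
Definition has_partials u (u1 u2 : R * R -> R) : Prop :=
  [/\ forall x y, is_derive (x : R) 1 (fun x => u (x, y)) (u1 (x, y)),
      forall x y, is_derive (y : R) 1 (fun y => u (x, y)) (u2 (x, y)),
      continuous u1 & continuous u2].

(** Both orders of [a] and [b] are covered, and the intermediate point is located only by its
    distance to [a]; this is the form needed to squeeze it as [b] tends to [a]. *)
Lemma mean_value (f df : R -> R) (a b : R) : (forall s, is_derive (s : R) 1 f (df s)) ->
  exists2 c, `|c - a| <= `|b - a| & f b - f a = df c * (b - a).
Proof.
move=> fD.
have fc x y : {within `[x, y], continuous f}.
  by apply: derivable_within_continuous => z _; have [] := fD z.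
have [ab|/ltW ba] := leP a b.
  have [c] := MVT_segment ab (fun s _ => fD s) (fc a b).
  rewrite in_itv/= => /andP[? ?] E; exists c => //.
  by rewrite !ger0_norm ?subr_ge0// lerD2r.
have [c] := MVT_segment ba (fun s _ => fD s) (fc b a).
rewrite in_itv/= => /andP[? ?] E; exists c.
  by rewrite !ler0_norm ?subr_le0// !opprB lerD2l lerN2.
by rewrite -opprB E -mulrN opprB.
Qed.

Lemma is_derive_cvg (f : R -> R) (s d : R) : is_derive s 1 f d ->
  (fun h => h^-1 * (f (h + s) - f s)) @ 0^' --> d.
Proof.
move=> [fD <-]; rewrite /derive.
have -> : (fun h => h^-1 * (f (h + s) - f s)) =
   (fun h => h^-1 *: ((f \o shift s) (h *: 1) - f s)).
  by apply/funext => h; rewrite /= /GRing.scale /= mulr1.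
exact: fD.
Qed.

Lemma cvg_is_derive (f : R -> R) (s d : R) :
  (fun h => h^-1 * (f (h + s) - f s)) @ 0^' --> d -> is_derive s 1 f d.
Proof.
have -> : (fun h => h^-1 * (f (h + s) - f s)) =
   (fun h => h^-1 *: ((f \o shift s) (h *: 1) - f s)).
  by apply/funext => h; rewrite /= /GRing.scale /= mulr1.
move=> fd; apply: DeriveDef; first by apply/cvg_ex; exists d.
by rewrite /derive; apply: cvg_lim.
Qed.

Lemma cvg_shift0 (f : R -> R) (s : R) : {for s, continuous f} ->
  (fun h => f (h + s)) @ 0^' --> f s.
Proof.
move=> fc; apply: cvg_within_filter.
have H : (fun h => h + s) @ (0 : R) --> s.
  by rewrite -[X in _ --> X]add0r; apply: cvgD; [exact: cvg_id|exact: cvg_cst].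
exact: (@cvg_comp _ _ _ (fun h => h + s) f _ _ _ H fc).
Qed.

Lemma cvg_squeeze_pt (T : Type) (F : set_system T) (FF : Filter F) (f g : T -> R) (l : R) :
  (forall x, `|f x - l| <= `|g x - l|) -> g @ F --> l -> f @ F --> l.
Proof.
move=> fg /cvgrPdist_le gl; apply/cvgrPdist_le => e e0.
by apply: filterS (gl e e0) => x; rewrite !(distrC l); exact: le_trans.
Qed.

(** The increment is split along an L-shaped path. The mean value theorem on each leg gives
    intermediate points [xi h] and [et h], which converge to [c1 s] and [c2 s]; continuity of the
    partials then gives the limit. *)
Lemma chain_rule2 u u1 u2 (c1 c2 : R -> R) (s d1 d2 : R) : has_partials u u1 u2 ->
  is_derive s 1 c1 d1 -> is_derive s 1 c2 d2 ->
  is_derive s 1 (fun s => u (c1 s, c2 s)) (u1 (c1 s, c2 s) * d1 + u2 (c1 s, c2 s) * d2).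
Proof.
move=> [uD1 uD2 u1c u2c] cD1 cD2.
have /choice[xi xiP] h : exists c, `|c - c1 s| <= `|c1 (h + s) - c1 s| /\
    u (c1 (h + s), c2 (h + s)) - u (c1 s, c2 (h + s)) =
    u1 (c, c2 (h + s)) * (c1 (h + s) - c1 s).
  by have [c] := mean_value (c1 s) (c1 (h + s)) (uD1 ^~ (c2 (h + s))); exists c.
have /choice[et etP] h : exists c, `|c - c2 s| <= `|c2 (h + s) - c2 s| /\
    u (c1 s, c2 (h + s)) - u (c1 s, c2 s) = u2 (c1 s, c) * (c2 (h + s) - c2 s).
  by have [c] := mean_value (c2 s) (c2 (h + s)) (uD2 (c1 s)); exists c.
have c1c := cvg_shift0 (is_derive_continuous cD1).
have c2c := cvg_shift0 (is_derive_continuous cD2).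
have xic : xi @ 0^' --> c1 s by apply: cvg_squeeze_pt c1c => h; have [] := xiP h.
have etc : et @ 0^' --> c2 s by apply: cvg_squeeze_pt c2c => h; have [] := etP h.
apply: cvg_is_derive.
have -> : (fun h => h^-1 * (u (c1 (h + s), c2 (h + s)) - u (c1 s, c2 s))) =
  (fun h => u1 (xi h, c2 (h + s)) * (h^-1 * (c1 (h + s) - c1 s)) +
    u2 (c1 s, et h) * (h^-1 * (c2 (h + s) - c2 s))).
  apply/funext => h; have [_ e1] := xiP h; have [_ e2] := etP h.
  rewrite mulrCA -e1 [X in _ = _ + X]mulrCA -e2 -mulrDr; congr (_ * _).
  by rewrite addrA subrK.
apply: cvgD; apply: cvgM; [|exact: is_derive_cvg| |exact: is_derive_cvg].
- by apply: (@cvg_comp _ _ _ _ u1 _ _ _ (cvg_pair xic c2c)); exact: u1c.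
- by apply: (@cvg_comp _ _ _ _ u2 _ _ _ (cvg_pair (cvg_cst (c1 s)) etc)); exact: u2c.
Qed.

(** Schwarz's argument: the second difference of [u] over a square of side [h], evaluated in the two
    orders, is both [u12 p * h^2] and [u21 q * h^2], with [p] and [q] within [|h|] of the corner in
    each coordinate. *)
Lemma mixed_partials u u1 u2 u12 u21 :
  (forall x y, is_derive (x : R) 1 (fun x => u (x, y)) (u1 (x, y))) ->
  (forall x y, is_derive (y : R) 1 (fun y => u (x, y)) (u2 (x, y))) ->
  (forall x y, is_derive (y : R) 1 (fun y => u1 (x, y)) (u12 (x, y))) ->
  (forall x y, is_derive (x : R) 1 (fun x => u2 (x, y)) (u21 (x, y))) ->
  continuous u12 -> continuous u21 -> u12 = u21.
Proof.
move=> D1 D2 D12 D21 c12 c21; apply/funext => -[x y].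
have E (h : R) : h != 0 -> exists p q, [/\ `|p.1 - x| <= `|h|, `|p.2 - y| <= `|h|,
    `|q.1 - x| <= `|h|, `|q.2 - y| <= `|h| & u12 p = u21 q].
  move=> h0.
  have xh : x + h - x = h by rewrite addrAC subrr add0r.
  have yh : y + h - y = h by rewrite addrAC subrr add0r.
  have [c1 b1 e1] := mean_value x (x + h) (fun s => is_derive_sub (D1 s (y + h)) (D1 s y)).
  have [c2 b2 e2] := mean_value y (y + h) (D12 c1).
  have [c3 b3 e3] := mean_value y (y + h) (fun s => is_derive_sub (D2 (x + h) s) (D2 x s)).
  have [c4 b4 e4] := mean_value x (x + h) (D21 ^~ c3).
  rewrite !xh !yh in b1 b2 b3 b4 e1 e2 e3 e4.
  exists (c1, c2), (c4, c3); split=> //=.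
  apply: (mulIf h0); apply: (mulIf h0).
  by rewrite -e2 -e4 -e1 -e3; ring.
apply/eqP; rewrite -subr_eq0 -normr_le0; apply/ler_addgt0Pr => e e0; rewrite add0r.
have e2 : 0 < e / 2 by lra.
have /cvgrPdist_le/(_ _ e2)/nbhs_ballP[d /= d0 H1] := c12 (x, y).
have /cvgrPdist_le/(_ _ e2)/nbhs_ballP[d' /= d'0 H2] := c21 (x, y).
pose h := Num.min d d' / 2.
have m0 : 0 < Num.min d d' by rewrite lt_min d0.
have hd : `|h| < d.
  rewrite gtr0_norm ?divr_gt0// /h; have : Num.min d d' <= d by rewrite ge_min lexx.
  lra.
have hd' : `|h| < d'.
  rewrite gtr0_norm ?divr_gt0// /h; have : Num.min d d' <= d' by rewrite ge_min lexx orbT.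
  lra.
have h0 : h != 0 by rewrite gt_eqF// divr_gt0.
have [p [q [p1 p2 q1 q2 epq]]] := E h h0.
have P1 : ball (x, y) d p.
  by split => /=; rewrite /ball/= distrC; [apply: le_lt_trans p1 _|apply: le_lt_trans p2 _].
have Q1 : ball (x, y) d' q.
  by split => /=; rewrite /ball/= distrC; [apply: le_lt_trans q1 _|apply: le_lt_trans q2 _].
have := H1 _ P1; have := H2 _ Q1; rewrite /= epq.
rewrite !ler_norml => /andP[? ?] /andP[? ?]; apply/andP; split; lra.
Qed.

End PlaneCalculus.

(** * Cauchy's formula and Taylor expansion on a unit circle, in real form *)

Section CauchyFormula.
Variable R : realType.
Local Notation mu := (@lebesgue_measure R).
Local Notation "'\oint' f" := (\int[mu]_(th in `[0, 2 * pi]) (f th))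
  (at level 36, f at level 36).

Lemma continuous_pairT (T U V : topologicalType) (f : T -> U) (g : T -> V) :
  continuous f -> continuous g -> continuous (fun t => (f t, g t)).
Proof. by move=> fc gc t; apply: cvg_pair; [exact: fc|exact: gc]. Qed.

Lemma continuous_fst2 (f : R -> R) : continuous f -> continuous (fun p : R * R => f p.1).
Proof. by move=> fc p; apply: (@continuous_comp _ _ _ fst f); [exact: cvg_fst|exact: fc]. Qed.

Lemma continuous_snd2 (f : R -> R) : continuous f -> continuous (fun p : R * R => f p.2).
Proof. by move=> fc p; apply: (@continuous_comp _ _ _ snd f); [exact: cvg_snd|exact: fc]. Qed.

Lemma two_pi_ge0 : 0 <= 2 * pi :> R.
Proof. by rewrite mulr_ge0// pi_ge0. Qed.

Lemma cos_sin_nat2pi n : cos (n%:R * (2 * pi)) = 1 :> R /\ sin (n%:R * (2 * pi)) = 0 :> R.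
Proof.
elim: n => [|n [IHc IHs]]; first by rewrite mul0r cos0 sin0.
rewrite -natr1 mulrDl mul1r cosD sinD IHc IHs.
have -> : 2 * pi = pi *+ 2 :> R by rewrite mulr_natl.
by rewrite cos2pi sin2pi; split; ring.
Qed.

Lemma is_derive_cosn (n s : R) : is_derive s 1 (fun s => cos (n * s)) (- sin (n * s) * n).
Proof. by apply: (@is_derive1_comp _ (@cos R)); exact: is_derive_mull. Qed.

Lemma is_derive_sinn (n s : R) : is_derive s 1 (fun s => sin (n * s)) (cos (n * s) * n).
Proof. by apply: (@is_derive1_comp _ (@sin R)); exact: is_derive_mull. Qed.

Lemma continuous_cosn (n : R) : continuous (fun s => cos (n * s)).
Proof. by move=> s; exact: is_derive_continuous (is_derive_cosn n s). Qed.

Lemma continuous_sinn (n : R) : continuous (fun s => sin (n * s)).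
Proof. by move=> s; exact: is_derive_continuous (is_derive_sinn n s). Qed.

Lemma oint_cosn n : \oint (fun th => cos (n.+1%:R * th)) = 0.
Proof.
have n0 : n.+1%:R != 0 :> R by rewrite pnatr_eq0.
have FD (s : R) : is_derive s 1 (fun s => n.+1%:R^-1 * sin (n.+1%:R * s)) (cos (n.+1%:R * s)).
  apply: is_derive_eq (is_derive_mul (is_derive_cst1 _ _) (is_derive_sinn _ _)) _.
  by rewrite mul0r add0r mulrCA mulVf// mulr1.
rewrite (FTC2_continuous two_pi_ge0 (@continuous_cosn _) FD).
by have [_ ->] := cos_sin_nat2pi n.+1; rewrite mulr0 mulr0 sin0 mulr0 subrr.
Qed.

Lemma oint_sinn n : \oint (fun th => sin (n.+1%:R * th)) = 0.
Proof.
have n0 : n.+1%:R != 0 :> R by rewrite pnatr_eq0.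
have FD (s : R) : is_derive s 1 (fun s => - n.+1%:R^-1 * cos (n.+1%:R * s)) (sin (n.+1%:R * s)).
  apply: is_derive_eq (is_derive_mul (is_derive_cst1 _ _) (is_derive_cosn _ _)) _.
  by rewrite mul0r add0r; move: (sin _) n0; move: (n.+1%:R : R) => N S N0; field.
rewrite (FTC2_continuous two_pi_ge0 (@continuous_sinn _) FD).
by have [-> _] := cos_sin_nat2pi n.+1; rewrite mulr0 cos0 subrr.
Qed.

(* Real and imaginary parts of the powers of [z.1 + i z.2]. *)
Fixpoint cpow (n : nat) (z : R * R) : R * R :=
  if n is n'.+1 then
    let p := cpow n' z in (z.1 * p.1 - z.2 * p.2, z.1 * p.2 + z.2 * p.1)
  else (1, 0).

Lemma cpow_le n z q : `|z.1| <= q -> `|z.2| <= q ->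
  `|(cpow n z).1| <= (2 * q) ^+ n /\ `|(cpow n z).2| <= (2 * q) ^+ n.
Proof.
move=> z1 z2; have q0 : 0 <= q by exact: le_trans z1.
elim: n => [|n [IH1 IH2]] /=; first by rewrite expr0 normr1 normr0.
have H (a b c d : R) : `|a| <= q -> `|b| <= q -> `|c| <= (2 * q) ^+ n -> `|d| <= (2 * q) ^+ n ->
    `|a * c| + `|b * d| <= (2 * q) ^+ n.+1.
  move=> ? ? ? ?; rewrite !normrM exprS.
  have -> : 2 * q * (2 * q) ^+ n = q * (2 * q) ^+ n + q * (2 * q) ^+ n by ring.
  by apply: lerD; apply: ler_pM.
by split; [apply: le_trans (ler_normB _ _) _|apply: le_trans (ler_normD _ _) _]; exact: H.
Qed.

Variable z : R * R.
(** The bound [1/4] keeps [z] strictly inside the unit circle and makes the ratio [2 q] of [cpow_le]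
    equal to [1/2]. *)
Hypotheses (z1 : `|z.1| <= 4^-1) (z2 : `|z.2| <= 4^-1).

(* [k1 + i k2 = w / (w - z)] with [w = exp (i th)]. *)
Let D th := (cos th - z.1) ^+ 2 + (sin th - z.2) ^+ 2.
Let k1 th := (cos th * (cos th - z.1) + sin th * (sin th - z.2)) / D th.
Let k2 th := (sin th * (cos th - z.1) - cos th * (sin th - z.2)) / D th.

Let D0 th : D th != 0.
Proof.
apply/negP => /eqP DE.
have /eqP := DE; rewrite /D paddr_eq0 ?sqr_ge0// !sqrf_eq0 !subr_eq0 => /andP[/eqP c /eqP s].
have := cos2Dsin2 th; rewrite c s => e.
move: z1 z2; rewrite !ler_norml => /andP[? ?] /andP[? ?]; nra.
Qed.

Let Dc : continuous D.
Proof.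
move=> th; apply: cvgD; (rewrite /GRing.exp /=; apply: cvgM; apply: cvgB; first [exact: cvg_cst|exact: continuous_cos|exact: continuous_sin]).
Qed.

Let k1c : continuous k1.
Proof.
move=> th; apply: cvgM; last by apply: cvgV => //; exact: Dc.
by apply: cvgD; apply: cvgM; [exact: continuous_cos|apply: cvgB; [exact: continuous_cos|exact: cvg_cst]|exact: continuous_sin|apply: cvgB; [exact: continuous_sin|exact: cvg_cst]].
Qed.

Let k2c : continuous k2.
Proof.
move=> th; apply: cvgM; last by apply: cvgV => //; exact: Dc.
by apply: cvgB; apply: cvgM; [exact: continuous_sin|apply: cvgB; [exact: continuous_cos|exact: cvg_cst]|exact: continuous_cos|apply: cvgB; [exact: continuous_sin|exact: cvg_cst]].
Qed.

(** [m1 n + i m2 n] is [(z / w)^n], and [m_step] is multiplication by [z / w]. *)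
Let m1 n th := (cpow n z).1 * cos (n%:R * th) + (cpow n z).2 * sin (n%:R * th).
Let m2 n th := (cpow n z).2 * cos (n%:R * th) - (cpow n z).1 * sin (n%:R * th).

Let m1c n : continuous (m1 n).
Proof.
by move=> th; apply: cvgD; apply: cvgMr; [exact: continuous_cosn|exact: continuous_sinn].
Qed.

Let m2c n : continuous (m2 n).
Proof.
by move=> th; apply: cvgB; apply: cvgMr; [exact: continuous_cosn|exact: continuous_sinn].
Qed.

Let m_step n th :
  m1 n.+1 th = m1 n th * (z.1 * cos th + z.2 * sin th) - m2 n th * (z.2 * cos th - z.1 * sin th) /\
  m2 n.+1 th = m1 n th * (z.2 * cos th - z.1 * sin th) + m2 n th * (z.1 * cos th + z.2 * sin th).
Proof.
have E : n.+1%:R * th = n%:R * th + th by rewrite -natr1 mulrDl mul1r.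
rewrite /m1 /m2 /= E cosD sinD; split; ring.
Qed.

Let k_mul th : (cos th - z.1) * k1 th - (sin th - z.2) * k2 th = cos th /\
    (cos th - z.1) * k2 th + (sin th - z.2) * k1 th = sin th.
Proof. by move: (D0 th); rewrite /k1 /k2 /D => d0; split; field. Qed.

(** In complex form, [k = 1 + (z / w) k]: the recursion whose iteration is the geometric
    expansion. *)
Let k_step th :
  k1 th = 1 + ((z.1 * cos th + z.2 * sin th) * k1 th - (z.2 * cos th - z.1 * sin th) * k2 th) /\
  k2 th = (z.1 * cos th + z.2 * sin th) * k2 th + (z.2 * cos th - z.1 * sin th) * k1 th.
Proof.
have e := cos2Dsin2 th; have [e1 e2] := k_mul th.
(* These products multiply [(w - z) k = w] by the conjugate of [w]; the next ones use
   [|w|^2 = 1]. *)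
have f1 := congr1 (fun t => cos th * t) e1; have f2 := congr1 (fun t => sin th * t) e2.
have f3 := congr1 (fun t => sin th * t) e1; have f4 := congr1 (fun t => cos th * t) e2.
have f5 := congr1 (fun t => t * k1 th) e; have f6 := congr1 (fun t => t * k2 th) e.
rewrite /= in f1 f2 f3 f4 f5 f6.
by move: (k1 th) (k2 th) (cos th) (sin th) e f1 f2 f3 f4 f5 f6 => K1 K2 c s *; split; lra.
Qed.

Let m_le n th : `|m1 n th| <= 2 * (2^-1) ^+ n /\ `|m2 n th| <= 2 * (2^-1) ^+ n.
Proof.
have [] := cpow_le n z1 z2; have -> : 2 * 4^-1 = 2^-1 :> R by lra.
move=> h1 h2.
have H (a b c d : R) : `|a| <= 2^-1 ^+ n -> `|b| <= 2^-1 ^+ n -> `|c| <= 1 -> `|d| <= 1 ->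
    `|a * c| + `|b * d| <= 2 * 2^-1 ^+ n.
  move=> ? ? ? ?; rewrite !normrM.
  have -> : 2 * 2^-1 ^+ n = 2^-1 ^+ n * 1 + 2^-1 ^+ n * 1 :> R by ring.
  by apply: lerD; apply: ler_pM.
have hc (t : R) : `|cos t| <= 1 by rewrite ler_norml cos_le1 cos_geN1.
have hs (t : R) : `|sin t| <= 1 by rewrite ler_norml sin_le1 sin_geN1.
by split; [apply: le_trans (ler_normD _ _) _|apply: le_trans (ler_normB _ _) _]; exact: H.
Qed.

(* Geometric expansion of [w / (w - z)] in powers of [z / w], integrated against
   [H1 + i H2]; the remainder after [n] terms is the integrand [r n]. *)
Lemma oint_geometric (H1 H2 : R -> R) : continuous H1 -> continuous H2 ->
  series (fun n =>
    (cpow n z).1 * \oint (fun th => H1 th * cos (n%:R * th) + H2 th * sin (n%:R * th)) -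
    (cpow n z).2 * \oint (fun th => H2 th * cos (n%:R * th) - H1 th * sin (n%:R * th))) @ \oo
  --> \oint (fun th => H1 th * k1 th - H2 th * k2 th).
Proof.
move=> c1 c2.
pose t n th := H1 th * m1 n th - H2 th * m2 n th.
pose r n th := t n th * k1 th - (H1 th * m2 n th + H2 th * m1 n th) * k2 th.
have tc n : continuous (t n).
  by move=> th; apply: cvgB; apply: cvgM; [exact: c1|exact: m1c|exact: c2|exact: m2c].
have rc n : continuous (r n).
  move=> th; apply: cvgB; apply: cvgM; [exact: tc|exact: k1c| |exact: k2c].
  by apply: cvgD; apply: cvgM; [exact: c1|exact: m2c|exact: c2|exact: m1c].
have Hc n : continuous (fun th => H1 th * cos (n%:R * th) + H2 th * sin (n%:R * th)).
  by move=> th; apply: cvgD; apply: cvgM; [exact: c1|exact: continuous_cosn|exact: c2|exact: continuous_sinn].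
have Hc' n : continuous (fun th => H2 th * cos (n%:R * th) - H1 th * sin (n%:R * th)).
  by move=> th; apply: cvgB; apply: cvgM; [exact: c2|exact: continuous_cosn|exact: c1|exact: continuous_sinn].
set T := fun n => _ - _.
have TE n : T n = \oint (t n).
  rewrite /T -!continuous_RintegralZ// -continuous_RintegralB//; last 2 first.
  - by move=> th; apply: cvgMr; exact: Hc.
  - by move=> th; apply: cvgMr; exact: Hc'.
  by apply: eq_Rintegral => th _; rewrite /t /m1 /m2; ring.
have rE n : \oint (r n) = T n + \oint (r n.+1).
  rewrite TE -continuous_RintegralD//; apply: eq_Rintegral => th _.
  have [e1 e2] := k_step th; have [e3 e4] := m_step n th.
  have f1 := congr1 (fun y => t n th * y) e1.
  have f2 := congr1 (fun y => (H1 th * m2 n th + H2 th * m1 n th) * y) e2.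
  rewrite /= in f1 f2; rewrite /r; move: f1 f2; rewrite /t e3 e4.
  by move: (k1 th) (k2 th) (m1 n th) (m2 n th) (cos th) (sin th) (H1 th) (H2 th) => *; lra.
have sE n : \oint (r 0%N) = series T n + \oint (r n).
  elim: n => [|n IH]; first by rewrite /series /= big_nil add0r.
  by rewrite IH rE seriesSr addrA.
have r0E : \oint (r 0%N) = \oint (fun th => H1 th * k1 th - H2 th * k2 th).
  by apply: eq_Rintegral => th _; rewrite /r /t /m1 /m2 /= mul0r cos0 sin0; ring.
rewrite -r0E.
have bd (f : R -> R) : continuous f -> exists2 C, 0 <= C & forall th, 0 <= th <= 2 * pi -> `|f th| <= C.
  move=> fc; have [C CP] := continuous_bounded_box (K := fun=> f) 0 0 0 (2 * pi) (continuous_snd2 fc).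
  by exists `|C| => // th th0; apply: le_trans (ler_norm C); apply: (CP 0) => //; rewrite lexx.
have [B1 B10 B1P] := bd _ c1; have [B2 B20 B2P] := bd _ c2.
have [K1 K10 K1P] := bd _ k1c; have [K2 K20 K2P] := bd _ k2c.
pose B := (2 * (B1 + B2)) * (K1 + K2) * (2 * pi).
have rle n : `|\oint (r n)| <= B * 2^-1 ^+ n.
  apply: le_trans (continuous_Rintegral_le (c := (2 * (B1 + B2)) * (K1 + K2) * 2^-1 ^+ n)
    two_pi_ge0 (rc n) _) _; last by rewrite /B subr0; lra.
  move=> th th0; have [h1 h2] := m_le n th.
  have P (a b A' B' : R) : `|a| <= A' -> `|b| <= B' -> `|a * b| <= A' * B'.
    by move=> ? ?; rewrite normrM; apply: ler_pM.
  apply: le_trans (ler_normB _ _) _.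
  have -> : 2 * (B1 + B2) * (K1 + K2) * 2^-1 ^+ n =
    (B1 * (2 * 2^-1 ^+ n) + B2 * (2 * 2^-1 ^+ n)) * K1 +
    (B1 * (2 * 2^-1 ^+ n) + B2 * (2 * 2^-1 ^+ n)) * K2 by ring.
  apply: lerD; apply: (P _ _ _ _); [|exact: K1P| |exact: K2P].
  - apply: le_trans (ler_normB _ _) _; apply: lerD; apply: (P _ _ _ _) => //; [exact: B1P|exact: B2P].
  - apply: le_trans (ler_normD _ _) _; apply: lerD; apply: (P _ _ _ _) => //; [exact: B1P|exact: B2P].
have c0 : (fun n => B * 2^-1 ^+ n) @ \oo --> 0.
  rewrite -(mulr0 B); apply: cvgMr; apply: cvg_expr.
  by rewrite ger0_norm// invf_lt1// ltr1n.
have rc0 : (fun n => \oint (r n)) @ \oo --> 0.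
  apply: cvg_squeeze_pt c0 => n; rewrite !subr0; apply: le_trans (rle n) _; exact: ler_norm.
have -> : series T = (fun n => \oint (r 0%N) - \oint (r n)).
  by apply/funext => n; rewrite (sE n) addrK.
by rewrite -[X in _ --> X]subr0; apply: cvgB => //; exact: cvg_cst.
Qed.

Section CauchyRiemann.
Variables (a a1 a2 b : R * R -> R) (q : R * R).
Hypotheses (aP : has_partials a a1 a2) (bP : has_partials b (fun p => - a2 p) a1).

(** With [f = a + i b] holomorphic, contract the circle to the point [q + z] along
    [P(s) = q + z + s (w - z)]. The [s]-derivative of [Re (f(P) w / (w - z))] is [Re (f'(P) w)], and
    [s] times it is the [th]-derivative of [Im f(P)], whose integral over a period is 0. So the
    integral is the same at [s = 1] and at [s = 0]. *)
Lemma cauchy_formula :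
  \oint (fun th => a (q.1 + cos th, q.2 + sin th) * k1 th - b (q.1 + cos th, q.2 + sin th) * k2 th) =
  a (q.1 + z.1, q.2 + z.2) * \oint k1 - b (q.1 + z.1, q.2 + z.2) * \oint k2.
Proof.
pose P1 (s th : R) := q.1 + z.1 + s * (cos th - z.1).
pose P2 (s th : R) := q.2 + z.2 + s * (sin th - z.2).
pose K s th := a (P1 s th, P2 s th) * k1 th - b (P1 s th, P2 s th) * k2 th.
pose dK s th := a1 (P1 s th, P2 s th) * cos th + a2 (P1 s th, P2 s th) * sin th.
have P1s (s th : R) : is_derive s 1 (P1 ^~ th) (cos th - z.1).
  apply: is_derive_eq (is_derive_add (is_derive_cst1 _ _)
    (is_derive_mul (is_derive_id1 _) (is_derive_cst1 _ _))) _; ring.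
have P2s (s th : R) : is_derive s 1 (P2 ^~ th) (sin th - z.2).
  apply: is_derive_eq (is_derive_add (is_derive_cst1 _ _)
    (is_derive_mul (is_derive_id1 _) (is_derive_cst1 _ _))) _; ring.
have P1t (s th : R) : is_derive th 1 (P1 s) (s * - sin th).
  apply: is_derive_eq (is_derive_add (is_derive_cst1 _ _)
    (is_derive_mul (is_derive_cst1 _ _) (is_derive_sub (is_derive_cos _) (is_derive_cst1 _ _)))) _; ring.
have P2t (s th : R) : is_derive th 1 (P2 s) (s * cos th).
  apply: is_derive_eq (is_derive_add (is_derive_cst1 _ _)
    (is_derive_mul (is_derive_cst1 _ _) (is_derive_sub (is_derive_sin _) (is_derive_cst1 _ _)))) _; ring.
have P1c : continuous (fun p : R * R => P1 p.1 p.2).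
  move=> p; apply: cvgD; [exact: cvg_cst|apply: cvgM; [exact: cvg_fst|apply: cvgB; last exact: cvg_cst]].
  exact: (continuous_snd2 (@continuous_cos R)).
have P2c : continuous (fun p : R * R => P2 p.1 p.2).
  move=> p; apply: cvgD; [exact: cvg_cst|apply: cvgM; [exact: cvg_fst|apply: cvgB; last exact: cvg_cst]].
  exact: (continuous_snd2 (@continuous_sin R)).
have Pc := continuous_pairT P1c P2c.
have [_ _ a1c a2c] := aP.
have dKc : continuous (fun p : R * R => dK p.1 p.2).
  move=> p; apply: cvgD; apply: cvgM.
  - by apply: (@continuous_comp _ _ _ (fun p : R * R => (P1 p.1 p.2, P2 p.1 p.2)) a1); [exact: Pc|exact: a1c].
  - exact: (continuous_snd2 (@continuous_cos R)).
  - by apply: (@continuous_comp _ _ _ (fun p : R * R => (P1 p.1 p.2, P2 p.1 p.2)) a2); [exact: Pc|exact: a2c].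
  - exact: (continuous_snd2 (@continuous_sin R)).
have Kt (s th : R) : is_derive th 1 (fun th => a (P1 s th, P2 s th))
    (s * (a2 (P1 s th, P2 s th) * cos th - a1 (P1 s th, P2 s th) * sin th)).
  by apply: is_derive_eq (chain_rule2 aP (P1t s th) (P2t s th)) _; ring.
have Kt' (s th : R) : is_derive th 1 (fun th => b (P1 s th, P2 s th)) (s * dK s th).
  by apply: is_derive_eq (chain_rule2 bP (P1t s th) (P2t s th)) _; rewrite /dK; ring.
have Kc s : continuous (K s).
  move=> th; apply: cvgB; apply: cvgM; [exact: is_derive_continuous (Kt s th)|exact: k1c
    |exact: is_derive_continuous (Kt' s th)|exact: k2c].
have KD (s th : R) : is_derive s 1 (K ^~ th) (dK s th).
  apply: is_derive_eq (is_derive_sub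
    (is_derive_mul (chain_rule2 aP (P1s s th) (P2s s th)) (is_derive_cst1 _ _))
    (is_derive_mul (chain_rule2 bP (P1s s th) (P2s s th)) (is_derive_cst1 _ _))) _.
  rewrite /dK; have [e1 e2] := k_mul th.
  have f1 := congr1 (fun y => a1 (P1 s th, P2 s th) * y) e1.
  have f2 := congr1 (fun y => a2 (P1 s th, P2 s th) * y) e2.
  by rewrite /= in f1 f2; rewrite -f1 -f2; ring.
have dKsc s : continuous (dK s) := @continuous_section1 _ dK s dKc.
have dK0 s : \oint (dK s) = 0.
  (* At [s = 0] the factor [s] cannot be cancelled; the integrand is then a combination of [cos] and
     [sin] with constant coefficients and is integrated directly. *)
  have [->|s0] := eqVneq s 0.
    pose c1 := a1 (q.1 + z.1, q.2 + z.2); pose c2 := a2 (q.1 + z.1, q.2 + z.2).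
    have E th : dK 0 th = c1 * cos th + c2 * sin th.
      by rewrite /dK /P1 /P2 !mul0r !addr0.
    have FD (th : R) : is_derive th 1 (fun th => c1 * sin th - c2 * cos th) (dK 0 th).
      apply: is_derive_eq (is_derive_sub (is_derive_mul (is_derive_cst1 _ _) (is_derive_sin _))
        (is_derive_mul (is_derive_cst1 _ _) (is_derive_cos _))) _.
      by rewrite E; ring.
    rewrite (FTC2_continuous two_pi_ge0 (dKsc 0) FD).
    by rewrite mulr_natl cos2pi sin2pi cos0 sin0 subrr.
  apply: (mulfI s0); rewrite mulr0 -continuous_RintegralZ//.
  rewrite (FTC2_continuous two_pi_ge0 _ (Kt' s)).
    by rewrite /P1 /P2 mulr_natl cos2pi sin2pi cos0 sin0 subrr.
  by move=> th; apply: cvgMr; exact: dKsc.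
pose Phi s := \oint (K s).
have PhiD (s : R) : 0 <= s <= 1 -> is_derive s 1 Phi 0.
  move=> s01; rewrite -(dK0 s).
  have ss : s - 1 < s < s + 1 by lra.
  exact: (@is_derive_under_integral _ K dK 0 (2 * pi) (s - 1) (s + 1) s Kc dKc (fun s th _ => KD s th) ss).
have E : Phi 1 = Phi 0 := is_derive0_itv ler01 PhiD.
transitivity (Phi 1).
  by apply: eq_Rintegral => th _; rewrite /K /P1 /P2; congr (a (_, _) * _ - b (_, _) * _); ring.
rewrite E -!continuous_RintegralZ// -continuous_RintegralB//; last 2 first.
- by move=> th; apply: cvgMr; exact: k1c.
- by move=> th; apply: cvgMr; exact: k2c.
by apply: eq_Rintegral => th _; rewrite /K /P1 /P2 !mul0r !addr0.
Qed.

End CauchyRiemann.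

Section PowerSeriesExpansion.
Variables (a a1 a2 b : R * R -> R) (q : R * R).
Hypotheses (aP : has_partials a a1 a2) (bP : has_partials b (fun p => - a2 p) a1).

Let ac : continuous (fun th => a (q.1 + cos th, q.2 + sin th)).
Proof.
move=> th; exact: (is_derive_continuous (chain_rule2 aP
  (is_derive_add (is_derive_cst1 _ _) (is_derive_cos _))
  (is_derive_add (is_derive_cst1 _ _) (is_derive_sin _)))).
Qed.

Let bc : continuous (fun th => b (q.1 + cos th, q.2 + sin th)).
Proof.
move=> th; exact: (is_derive_continuous (chain_rule2 bP
  (is_derive_add (is_derive_cst1 _ _) (is_derive_cos _))
  (is_derive_add (is_derive_cst1 _ _) (is_derive_sin _)))).
Qed.

(** [al n + i be n] is the integral of [(a + i b) w^(-n)] over the circle, that is, [2 pi] times the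
    [n]-th Taylor coefficient of [a + i b] at [q]. *)
Let al n := \oint (fun th => a (q.1 + cos th, q.2 + sin th) * cos (n%:R * th) +
  b (q.1 + cos th, q.2 + sin th) * sin (n%:R * th)).
Let be n := \oint (fun th => b (q.1 + cos th, q.2 + sin th) * cos (n%:R * th) -
  a (q.1 + cos th, q.2 + sin th) * sin (n%:R * th)).

Lemma cauchy_expansion_at :
  series (fun n => (cpow n z).1 * al n - (cpow n z).2 * be n) @ \oo -->
  2 * pi * a (q.1 + z.1, q.2 + z.2).
Proof.
have := oint_geometric ac bc; rewrite (cauchy_formula q aP bP).
suff -> : a (q.1 + z.1, q.2 + z.2) * \oint k1 - b (q.1 + z.1, q.2 + z.2) * \oint k2 =
  2 * pi * a (q.1 + z.1, q.2 + z.2) by [].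
(* The integrals of [k1] and [k2] are not computed separately: for the constant boundary values [A]
   and [B], the geometric expansion reduces to its term of index 0, which is [2 pi A]. *)
set A := a _; set B := b _.
have Ac : continuous (fun _ : R => A) by move=> ?; exact: cvg_cst.
have Bc : continuous (fun _ : R => B) by move=> ?; exact: cvg_cst.
have := oint_geometric Ac Bc.
rewrite continuous_RintegralB; last 2 first.
- by move=> th; apply: cvgMr; exact: k1c.
- by move=> th; apply: cvgMr; exact: k2c.
rewrite !continuous_RintegralZ// => H.
apply: (cvg_unique _ H) => //.
apply/cvgrPdist_le => e e0; exists 1%N => // -[//|N] _ /=.
rewrite /series /= big_nat_recl//= big1_seq; last first.
  move=> n _.
  rewrite continuous_RintegralD; last 2 first.
  - by move=> th; apply: cvgMr; exact: continuous_cosn.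
  - by move=> th; apply: cvgMr; exact: continuous_sinn.
  rewrite continuous_RintegralB; last 2 first.
  - by move=> th; apply: cvgMr; exact: continuous_cosn.
  - by move=> th; apply: cvgMr; exact: continuous_sinn.
  rewrite !continuous_RintegralZ; try exact: continuous_cosn; try exact: continuous_sinn.
  by rewrite oint_cosn oint_sinn; ring.
have -> : \int[mu]_(th in `[0, 2 * pi]) (A * cos (0%:R * th) + B * sin (0%:R * th)) = 2 * pi * A.
  transitivity (\oint (fun=> A)).
    by apply: eq_Rintegral => th _; rewrite mul0r cos0 sin0; ring.
  by rewrite Rintegral_cst_itv ?two_pi_ge0// subr0 mulrC.
by rewrite mul1r mul0r subr0 addr0 subrr normr0 ltW.
Qed.

End PowerSeriesExpansion.
End CauchyFormula.

(** * Harmonic functions along analytic curves *)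

Section HarmonicAnalytic.
Variable R : realType.
Local Notation mu := (@lebesgue_measure R).

(** Here the coefficients are chosen before [z] and uniformly bounded, so that a function of one
    variable can be substituted for [z]. *)
Lemma cauchy_expansion (a a1 a2 b : R * R -> R) (q : R * R) :
  has_partials a a1 a2 -> has_partials b (fun p => - a2 p) a1 ->
  exists (al be : R^nat) (C : R), (forall n, `|al n| <= C /\ `|be n| <= C) /\
  forall z : R * R, `|z.1| <= 4^-1 -> `|z.2| <= 4^-1 ->
    series (fun n => (cpow n z).1 * al n - (cpow n z).2 * be n) @ \oo -->
    2 * pi * a (q.1 + z.1, q.2 + z.2).
Proof.
move=> aP bP.
pose A th := a (q.1 + cos th, q.2 + sin th).
pose B th := b (q.1 + cos th, q.2 + sin th).
pose f n th := A th * cos (n%:R * th) + B th * sin (n%:R * th).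
pose g n th := B th * cos (n%:R * th) - A th * sin (n%:R * th).
have Ac : continuous A.
  move=> th; exact: (is_derive_continuous (chain_rule2 aP
    (is_derive_add (is_derive_cst1 _ _) (is_derive_cos _))
    (is_derive_add (is_derive_cst1 _ _) (is_derive_sin _)))).
have Bc : continuous B.
  move=> th; exact: (is_derive_continuous (chain_rule2 bP
    (is_derive_add (is_derive_cst1 _ _) (is_derive_cos _))
    (is_derive_add (is_derive_cst1 _ _) (is_derive_sin _)))).
have fc n : continuous (f n).
  by move=> th; apply: cvgD; apply: cvgM; [exact: Ac|exact: continuous_cosn|exact: Bc|exact: continuous_sinn].
have gc n : continuous (g n).
  by move=> th; apply: cvgB; apply: cvgM; [exact: Bc|exact: continuous_cosn|exact: Ac|exact: continuous_sinn].
have [C1 C1P] := continuous_bounded_box (K := fun=> A) 0 0 0 (2 * pi) (continuous_snd2 Ac).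
have [C2 C2P] := continuous_bounded_box (K := fun=> B) 0 0 0 (2 * pi) (continuous_snd2 Bc).
exists (fun n => \int[mu]_(th in `[0, 2 * pi]) f n th).
exists (fun n => \int[mu]_(th in `[0, 2 * pi]) g n th).
exists ((C1 + C2) * (2 * pi - 0)); split=> [n|z z1 z2]; last first.
  exact: (cauchy_expansion_at z1 z2 aP bP).
have H (x y c d : R) : `|c| <= 1 -> `|d| <= 1 -> `|x| <= C1 -> `|y| <= C2 ->
    `|x * c| + `|y * d| <= C1 + C2.
  move=> ? ? ? ?; rewrite !normrM -[C1]mulr1 -[C2]mulr1.
  by apply: lerD; apply: ler_pM.
have hc (t : R) : `|cos t| <= 1 by rewrite ler_norml cos_le1 cos_geN1.
have hs (t : R) : `|sin t| <= 1 by rewrite ler_norml sin_le1 sin_geN1.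
have {}C1P th : 0 <= th <= 2 * pi -> `|A th| <= C1.
  by move=> th0; apply: (C1P 0) => //; rewrite lexx.
have {}C2P th : 0 <= th <= 2 * pi -> `|B th| <= C2.
  by move=> th0; apply: (C2P 0) => //; rewrite lexx.
split; apply: continuous_Rintegral_le; rewrite ?two_pi_ge0//.
- by move=> th th0; apply: le_trans (ler_normD _ _) _; apply: H => //; [exact: C1P|exact: C2P].
- move=> th th0; apply: le_trans (ler_normB _ _) _; rewrite addrC.
  by apply: H => //; [exact: C1P|exact: C2P].
Qed.

Lemma psbounded_cpow (rho q : R) (f g : R -> R) n : 0 < rho ->
  psbounded rho q f -> psbounded rho q g ->
  psbounded rho ((2 * q) ^+ n) (fun h => (cpow n (f h, g h)).1) /\
  psbounded rho ((2 * q) ^+ n) (fun h => (cpow n (f h, g h)).2).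
Proof.
move=> r0 fq gq; have q0 := psbounded_ge0 fq.
elim: n => [|n [IH1 IH2]] /=.
  rewrite expr0; split.
    by have := psbounded_cst rho (1 : R); rewrite normr1.
  by apply: psboundedW (psbounded_cst rho (0 : R)) _ _; rewrite ?(ltW r0) ?lexx// normr0.
have E : (2 * q) ^+ n.+1 = q * (2 * q) ^+ n + q * (2 * q) ^+ n by rewrite exprS; ring.
rewrite E; split; last first.
  by apply: psbounded_add; rewrite ?(ltW r0)//; apply: psbounded_mul.
apply: psbounded_add; rewrite ?(ltW r0)//; first exact: psbounded_mul.
have := psbounded_scale (-1) (psbounded_mul r0 gq IH2); rewrite normrN1 mul1r => H.
by apply: psbounded_eq H _ => h _; rewrite mulN1r.
Qed.

(** The displacement of the curve from its point at [s] vanishes at [s], so on a small disc both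
    coordinates have norm at most [1/8]. Its [n]-th complex power then has norm at most [(1/4)^n],
    and the Taylor series is a summable series of analytic functions. *)
Lemma conjugate_pair_comp_analytic (a a1 a2 b : R * R -> R) (c1 c2 : R -> R) (s : R) :
  has_partials a a1 a2 -> has_partials b (fun p => - a2 p) a1 ->
  analytic_at c1 s -> analytic_at c2 s -> analytic_at (fun s => a (c1 s, c2 s)) s.
Proof.
move=> aP bP c1A c2A.
have [al [be [C [alC]]]] := cauchy_expansion (c1 s, c2 s) aP bP.
move=> /= expand.
have C0 : 0 <= C by apply: le_trans (alC 0%N).1.
have e8 : 0 < 8^-1 :> R by [].
have z1A : analytic_at (fun t => c1 t - c1 s) s by apply: analytic_atB => //; exact: analytic_at_cst.
have z2A : analytic_at (fun t => c2 t - c2 s) s by apply: analytic_atB => //; exact: analytic_at_cst.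
have [rho [N1 [r10 H1]]] := z1A; have [rho2 [N2 [r20 H2]]] := z2A.
have [|r /andP[r0 _] K1] := psbounded_small r10 H1 _ e8; first by rewrite addr0 subrr.
have [|r' /andP[r'0 _] K2] := psbounded_small r20 H2 _ e8; first by rewrite addr0 subrr.
pose m := Num.min r r'.
have m0 : 0 < m by rewrite lt_min r0.
have L1 : psbounded m 8^-1 (fun h => c1 (s + h) - c1 s).
  by apply: psboundedW K1 _ _ => //; rewrite (ltW m0) ge_min lexx.
have L2 : psbounded m 8^-1 (fun h => c2 (s + h) - c2 s).
  by apply: psboundedW K2 _ _ => //; rewrite (ltW m0) ge_min lexx orbT.
have S : psbounded m (2 * C * 2) (fun h => 2 * pi * a (c1 (s + h), c2 (s + h))).
  apply: (@psbounded_series _ m _ (fun n => 2 * C * 2^-1 ^+ n) (fun n h =>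
    (cpow n (c1 (s + h) - c1 s, c2 (s + h) - c2 s)).1 * al n -
    (cpow n (c1 (s + h) - c1 s, c2 (s + h) - c2 s)).2 * be n)) => //.
  - move=> n; have [M1 M2] := psbounded_cpow n m0 L1 L2; have [aC bC] := alC n.
    have Ml : (2 * 8^-1 : R) ^+ n <= 2^-1 ^+ n.
      by apply: lerXn2r; rewrite ?nnegrE//; lra.
    have E : 2 * C * 2^-1 ^+ n = C * 2^-1 ^+ n + C * 2^-1 ^+ n by ring.
    rewrite E; apply: psbounded_add; rewrite ?(ltW m0)//.
      apply: psboundedW (psbounded_eq (psbounded_scale (al n) M1) _) _ _.
      - by move=> h _; rewrite mulrC.
      - by rewrite (ltW m0) lexx.
      - by apply: ler_pM => //; rewrite exprn_ge0.
    apply: psboundedW (psbounded_eq (psbounded_scale (- be n) M2) _) _ _.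
    - by move=> h _; rewrite mulrC mulrN.
    - by rewrite (ltW m0) lexx.
    - by rewrite normrN; apply: ler_pM => //; rewrite exprn_ge0.
  - move=> K; rewrite -mulr_sumr; apply: ler_wpM2l; first by rewrite mulr_ge0.
    have cg : series (geometric 1 (2^-1 : R)) @ \oo --> (1 / (1 - 2^-1) : R).
      by apply: cvg_geometric_series; rewrite ger0_norm// invf_lt1// ltr1n.
    have l2 : limn (series (geometric 1 (2^-1 : R))) = 2.
      by rewrite (cvg_lim _ cg)//; field.
    have -> : \sum_(0 <= i < K) 2^-1 ^+ i = series (geometric 1 (2^-1 : R)) K.
      by rewrite /series /=; apply: eq_bigr => i _; rewrite mul1r.
    apply: (@le_trans _ _ (limn (series (geometric 1 (2^-1 : R))))); last by rewrite l2.
    apply: nondecreasing_cvgn_le; last by apply/cvg_ex; exists (1 / (1 - 2^-1)).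
    by apply: nondecreasing_series => n _ _; rewrite /= mul1r exprn_ge0.
  - move=> h hm.
    have b1 := psbounded_norm L1 hm; have b2 := psbounded_norm L2 hm.
    have E1 (x y : R) : x + (y - x) = y by rewrite addrC subrK.
    have := expand (c1 (s + h) - c1 s, c2 (s + h) - c2 s); rewrite /= !E1; apply; lra.
have pi0 : (2 * pi : R) != 0 by rewrite gt_eqF// mulr_gt0// pi_gt0.
exists m, (`|(2 * pi)^-1| * (2 * C * 2)); split=> //.
apply: psbounded_eq (psbounded_scale _ S) _ => h _.
by rewrite mulrA mulVf// mul1r.
Qed.

Lemma is_derive_partial1 (u : R * R -> R) (x y : R) : derivable u (x, y) (1, 0) ->
  is_derive x 1 (fun x => u (x, y)) ('D_(1, 0) u (x, y)).
Proof.
move=> du.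
have E : (fun h => h^-1 *: ((u \o shift (x, y)) (h *: (1, 0)) - u (x, y))) =
  (fun h => h^-1 *: (((fun x => u (x, y)) \o shift x) (h *: 1) - u (x, y))).
  apply/funext => h /=; congr (_ *: (u _ - _)).
  transitivity (h *: 1 + x, h *: 0 + y : R) => //.
  by rewrite scaler0 add0r.
by apply: DeriveDef; move: du; rewrite /derivable /derive E.
Qed.

Lemma is_derive_partial2 (u : R * R -> R) (x y : R) : derivable u (x, y) (0, 1) ->
  is_derive y 1 (fun y => u (x, y)) ('D_(0, 1) u (x, y)).
Proof.
move=> du.
have E : (fun h => h^-1 *: ((u \o shift (x, y)) (h *: (0, 1)) - u (x, y))) =
  (fun h => h^-1 *: (((fun y => u (x, y)) \o shift y) (h *: 1) - u (x, y))).
  apply/funext => h /=; congr (_ *: (u _ - _)).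
  transitivity (h *: 0 + x : R, h *: 1 + y) => //.
  by rewrite scaler0 add0r.
by apply: DeriveDef; move: du; rewrite /derivable /derive E.
Qed.

(** Symmetry of the mixed derivatives and Laplace's equation leave only two independent entries in
    the Hessian. In this form the Cauchy-Riemann equations for the gradient can be read off. *)
Lemma harmonic_partials (u : R * R -> R) : harmonic_fun u ->
  exists g11 g12 : R * R -> R,
  [/\ has_partials u ('D_(1, 0) u) ('D_(0, 1) u),
      has_partials ('D_(1, 0) u) g11 g12 &
      has_partials ('D_(0, 1) u) g12 (fun p => - g11 p)].
Proof.
move=> [[uc C2] lap].
have a1 : axes ((1, 0) : R * R) by left.
have a2 : axes ((0, 1) : R * R) by right.
have [d1 c1 H1] := C2 _ a1; have [d2 c2 H2] := C2 _ a2.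
have [d11 c11] := H1 _ a1; have [d12 c12] := H1 _ a2.
have [d21 c21] := H2 _ a1; have [d22 c22] := H2 _ a2.
have p1 x y := is_derive_partial1 (d1 (x, y)).
have p2 x y := is_derive_partial2 (d2 (x, y)).
have p12 x y := is_derive_partial2 (d12 (x, y)).
have p21 x y := is_derive_partial1 (d21 (x, y)).
have E12 := @mixed_partials _ u ('D_(1, 0) u) ('D_(0, 1) u) ('D_(0, 1) ('D_(1, 0) u))
  ('D_(1, 0) ('D_(0, 1) u)) p1 p2 p12 p21 c12 c21.
have E22 : 'D_(0, 1) ('D_(0, 1) u) = (fun p => - 'D_(1, 0) ('D_(1, 0) u) p).
  by apply/funext => p; apply/eqP; rewrite -addr_eq0 addrC; apply/eqP; exact: lap.
exists ('D_(1, 0) ('D_(1, 0) u)), ('D_(0, 1) ('D_(1, 0) u)); split.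
- exact: And4 p1 p2 c1 c2.
- exact: And4 (fun x y => is_derive_partial1 (d11 (x, y))) p12 c11 c12.
- have H3 : has_partials ('D_(0, 1) u) ('D_(1, 0) ('D_(0, 1) u)) ('D_(0, 1) ('D_(0, 1) u)).
    exact: And4 p21 (fun x y => is_derive_partial2 (d22 (x, y))) c21 c22.
  have G (f g g' h h' : R * R -> R) : has_partials f g h -> g = g' -> h = h' ->
      has_partials f g' h' by move=> + <- <-.
  exact: (G _ _ _ _ _ H3 (esym E12) E22).
Qed.

Lemma has_partialsN (a a1 a2 : R * R -> R) : has_partials a a1 a2 ->
  has_partials (fun p => - a p) (fun p => - a1 p) (fun p => - a2 p).
Proof.
move=> [D1 D2 c1 c2]; split.
- by move=> x y; exact: is_derive_opp.
- by move=> x y; exact: is_derive_opp.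
- by move=> p; apply: cvgN; exact: c1.
- by move=> p; apply: cvgN; exact: c2.
Qed.

(** The gradient carries its own conjugates: [u_x - i u_y] is holomorphic. Working with it first
    avoids constructing a conjugate of [u] in the plane. *)
Lemma harmonic_grad_comp_analytic (u : R * R -> R) (c1 c2 : R -> R) (s : R) :
  harmonic_fun u -> analytic_at c1 s -> analytic_at c2 s ->
  analytic_at (fun s => 'D_(1, 0) u (c1 s, c2 s)) s /\
  analytic_at (fun s => 'D_(0, 1) u (c1 s, c2 s)) s.
Proof.
move=> /harmonic_partials[g11 [g12 [_ P1 P2]]] c1A c2A.
have E : (fun p => - - g11 p) = g11 by apply/funext => p; rewrite opprK.
split.
- apply: (@conjugate_pair_comp_analytic _ _ _ (fun p => - 'D_(0, 1) u p) _ _ _ P1 _ c1A c2A).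
  by have := has_partialsN P2; rewrite E.
- apply: (@conjugate_pair_comp_analytic _ _ _ ('D_(1, 0) u) _ _ _ P2 _ c1A c2A).
  by rewrite E.
Qed.

(** Along the curve, [u] is a primitive of [grad u . c'], whose factors are already known to be
    analytic. *)
Lemma harmonic_comp_analytic (u : R * R -> R) (c1 c2 : R -> R) (s : R) :
  harmonic_fun u -> analytic_at c1 s -> analytic_at c2 s ->
  analytic_at (fun s => u (c1 s, c2 s)) s.
Proof.
move=> uh c1A c2A; have [g11 [g12 [P _ _]]] := harmonic_partials uh.
have [A1 A2] := harmonic_grad_comp_analytic uh c1A c2A.
have [d1 d1A d1D] := analytic_at_is_derive c1A.
have [d2 d2A d2D] := analytic_at_is_derive c2A.
apply: (@analytic_at_primitive _ _ (fun s => 'D_(1, 0) u (c1 s, c2 s) * d1 s +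
  'D_(0, 1) u (c1 s, c2 s) * d2 s)).
  by apply: analytic_atD; apply: analytic_atM.
near=> t; apply: (chain_rule2 P); by near: t.
Unshelve. all: by end_near. Qed.

End HarmonicAnalytic.

(** * The winding number and the double-layer kernel *)

Section Curve.
Variable R : realType.
Local Notation mu := (@lebesgue_measure R).

Lemma pi2_gt0 : 0 < 2 * pi :> R.
Proof. by rewrite mulr_gt0// pi_gt0. Qed.

Lemma periodic_int (V : zmodType) (f : R -> V) (T : R) (k : int) :
  periodic f T -> forall s, f (s + k%:~R * T) = f s.
Proof.
move=> fT s; case: k => n.
  by rewrite -pmulrn -mulr_natl mulr1 mulr_natl (periodicn fT).
by rewrite NegzE mulrNz mulNr -[LHS](periodicn fT n.+1) -mulr_natl subrK.
Qed.

Lemma norm_sub_lt_near (a e : R) : 0 < e -> \forall s \near a, `|s - a| < e.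
Proof.
move=> e0; near=> s; rewrite distrC; near: s; exact: cvgr_dist_lt.
Unshelve. all: by end_near. Qed.

Lemma eqmod2pi_refl (t : R) : eqmod2pi t t.
Proof. by exists 0; rewrite mul0r addr0. Qed.

Lemma eqmod2pi_addr (s t : R) : eqmod2pi (s + 2 * pi) t <-> eqmod2pi s t.
Proof.
split=> -[k E].
  by exists (k - 1); rewrite -(addrK (2 * pi) s) E intrB; ring.
by exists (k + 1); rewrite E intrD; ring.
Qed.

Lemma eqmod2pi_near (s t : R) : eqmod2pi s t -> `|s - t| < 2 * pi -> s = t.
Proof.
move=> [k ->]; rewrite addrAC subrr add0r normrM (gtr0_norm pi2_gt0).
rewrite -ltr_pdivlMr ?pi2_gt0// divff ?gt_eqF ?pi2_gt0// -intr_norm.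
rewrite (_ : 1 = 1%:~R :> R)// ltr_int.
by case: k => [[|n]|n]// _; rewrite mul0r addr0.
Qed.

Lemma eqmod2pi_trans (s t u : R) : eqmod2pi s t -> eqmod2pi u t -> eqmod2pi s u.
Proof. by move=> [k ->] [l ->]; exists (k - l); rewrite intrB; ring. Qed.

Lemma eqmod2pi_itv (s : R) : exists2 s0, 0 <= s0 < 2 * pi & eqmod2pi s s0.
Proof.
have p0 := pi2_gt0.
pose k := Num.floor (s / (2 * pi)).
have /andP[k1 k2] := floor_itv (s / (2 * pi)).
exists (s - k%:~R * (2 * pi)); last by exists k; rewrite subrK.
rewrite subr_ge0 -ler_pdivlMr// k1 /=.
rewrite ltrBlDl -{2}[2 * pi]mul1r -mulrDl -ltr_pdivrMr//.
by move: k2; rewrite intrD.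
Qed.

Lemma eqmod2pi_near_neq (t a : R) : ~ eqmod2pi a t -> \forall s \near a, ~ eqmod2pi s t.
Proof.
move=> nat_; have [a0 /andP[a00 a02] [k E]] := eqmod2pi_itv (a - t).
have a0_gt0 : 0 < a0.
  rewrite lt_neqAle a00 andbT; apply/eqP => e.
  by apply: nat_; exists k; rewrite -[LHS](subrK t) E -e; ring.
have d1 : 0 < 2 * pi - a0 by lra.
near=> s => -[j Ej].
have e1 : `|s - a| < a0 by near: s; exact: (norm_sub_lt_near a a0_gt0).
have e2 : `|s - a| < 2 * pi - a0 by near: s; exact: (norm_sub_lt_near a d1).
have e : eqmod2pi (s - k%:~R * (2 * pi)) t by exists (j - k); rewrite Ej intrB; ring.
have Ea : a = t + a0 + k%:~R * (2 * pi) by rewrite -[LHS](subrK t) E; ring.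
move: e1 e2; rewrite !ltr_norml => /andP[? ?] /andP[? ?].
have := eqmod2pi_near e; rewrite ltr_norml => H.
have : s - k%:~R * (2 * pi) = t by apply: H; apply/andP; split; lra.
lra.
Unshelve. all: by end_near. Qed.

Lemma eqmod2pi_near_punctured (t a : R) : \forall s \near a^', ~ eqmod2pi s t.
Proof.
have [at_|nat_] := pselect (eqmod2pi a t); last first.
  rewrite near_withinE; apply: filterS (eqmod2pi_near_neq nat_) => s + _; exact.
rewrite near_withinE; near=> s => sa st.
have e : eqmod2pi s a := eqmod2pi_trans st at_.
move/eqP: sa; apply; apply: (eqmod2pi_near e).
by near: s; apply: norm_sub_lt_near; exact: pi2_gt0.
Unshelve. all: by end_near. Qed.

Lemma analytic_at_periodic (f : R -> R) (a : R) (k : int) : periodic f (2 * pi) ->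
  analytic_at f a -> analytic_at f (a + k%:~R * (2 * pi)).
Proof.
move=> fp [rho [N [r0 fN]]]; exists rho, N; split=> //.
by apply: psbounded_eq fN _ => h _; rewrite addrAC (periodic_int _ fp).
Qed.

Lemma periodic_derive1 (f : R -> R) (T : R) : periodic f T -> periodic f^`() T.
Proof.
move=> fT s; rewrite !derive1E /derive.
have -> // : (fun h => h^-1 *: ((f \o shift (s + T)) (h *: 1) - f (s + T))) =
  (fun h => h^-1 *: ((f \o shift s) (h *: 1) - f s)).
by apply/funext => h /=; rewrite addrA !fT.
Qed.

Lemma periodic_derive1n n (f : R -> R) (T : R) : periodic f T -> periodic f^`(n) T.
Proof. by move=> fT; elim: n => // n IH; rewrite derive1nS; exact: periodic_derive1. Qed.

(** The two values at [t] come from [f' = g + (s - t) g']. They give the limit of the angular kernel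
    on the diagonal. *)
Lemma analytic_at_sub_factor (f : R -> R) (t : R) : analytic_at f t ->
  exists2 g, analytic_at g t & [/\ forall s, f s - f t = (s - t) * g s,
    g t = derive1 f t & derive1n 2 f t = 2 * derive1 g t].
Proof.
move=> fA.
have dA : analytic_at (fun s => f s - f t) t.
  by apply: analytic_atB => //; exact: analytic_at_cst.
have [|g gA gE] := @analytic_at_divX _ _ _ _ dA; first by rewrite subrr.
have fE s : f s - f t = (s - t) * g s.
  have [->|st] := eqVneq s t; first by rewrite !subrr mul0r.
  by rewrite gE// mulrC divfK// subr_eq0.
have f1 : \forall s \near t, derive1 f s = g s + (s - t) * derive1 g s.
  have := analytic_at_derivable gA; apply: filterS => s gd.
  have gD : is_derive s 1 g (derive1 g s) by split=> //; rewrite derive1E.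
  have -> : f = (fun s => f t + (s - t) * g s).
    by apply/funext => u; rewrite -fE addrC subrK.
  have D : is_derive s 1 (fun s => f t + (s - t) * g s) (g s + (s - t) * derive1 g s).
    apply: is_derive_eq (is_derive_add (is_derive_cst1 _ _)
     (is_derive_mul (is_derive_sub (is_derive_id1 _) (is_derive_cst1 _ _)) gD)) _.
    by ring.
  by rewrite derive1E; have [_ ->] := D.
exists g => //; split=> //.
  by rewrite (nbhs_singleton f1) subrr mul0r addr0.
have gA1 := analytic_at_derive1 gA.
have d1 : is_derive t 1 g (derive1 g t).
  by split; [exact: nbhs_singleton (analytic_at_derivable gA)|rewrite derive1E].
have d2 : is_derive t 1 (derive1 g) (derive1 (derive1 g) t).
  by split; [exact: nbhs_singleton (analytic_at_derivable gA1)|rewrite derive1E].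
have D : is_derive t 1 (fun s => g s + (s - t) * derive1 g s) (2 * derive1 g t).
  apply: is_derive_eq (is_derive_add d1
   (is_derive_mul (is_derive_sub (is_derive_id1 _) (is_derive_cst1 _ _)) d2)) _.
  by ring.
rewrite derive1nS derive1n1 derive1E.
rewrite (near_eq_derive _ f1); by have [_ ->] := D.
Qed.

(** Compactness is used with the constant [C] running along the filter at [+oo]; since [g] is
    nonnegative, a local bound persists for all larger constants. *)
Lemma local_to_segment_bound (f g : R -> R) (a b : R) : (forall s, 0 <= g s) ->
  (forall s0, a <= s0 <= b -> exists C, \forall s \near s0, `|f s| <= C * g s) ->
  exists C, forall s, a <= s <= b -> `|f s| <= C * g s.
Proof.
move=> g0 loc.
have /compact_near_coveringP cov := @segment_compact R a b.
have H := cov R (pinfty_nbhs R) (fun C s => `|f s| <= C * g s) _.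
have : \forall C \near +oo, `[a, b]%classic `<=` (fun s => `|f s| <= C * g s).
  apply: H => s0; rewrite /= in_itv/= => s0ab; have [C HC] := loc _ s0ab.
  near=> s C' => /=.
  have h1 : `|f s| <= C * g s by near: s.
  apply: le_trans h1 _; apply: ler_wpM2r => //; near: C'.
move=> [M [_ /(_ (M + 1))]]; rewrite ltrDl => /(_ ltr01) HM.
by exists (M + 1) => s sab; apply: HM; rewrite /= in_itv.
Unshelve. all: by end_near. Qed.

(** The integral over [[y, y + T]] has derivative [f (y + T) - f y = 0]. The shift will place the
    singular parameter at the ends of the interval. *)
Lemma Rintegral_periodic_shift (f : R -> R) (T t : R) : continuous f -> periodic f T ->
  0 <= T -> 0 <= t -> \int[mu]_(s in `[t, t + T]) f s = \int[mu]_(s in `[0, T]) f s.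
Proof.
move=> fc fT T0 t0.
pose F y := \int[mu]_(s in `[-1, y]) f s.
have FD (y : R) : -1 < y -> is_derive y 1 F (f y).
  move=> y1.
  have [|//|d e] := @continuous_FTC1_closed _ f (-1) y (y + 1) _ _ y1 (fc y).
  - by rewrite ltrDl.
  - exact: continuous_integrable.
  by apply: DeriveDef; [exact: d|rewrite -derive1E; exact: e].
have FE a b : 0 <= a -> a <= b -> \int[mu]_(s in `[a, b]) f s = F b - F a.
  move=> a0 ab; rewrite /F (@Rintegral_itv_split _ f (-1) a b)//; last exact: continuous_integrable.
    by rewrite addrC addKr.
  lra.
rewrite !FE ?lerDl//.
have GD (y : R) : 0 <= y <= t -> is_derive y 1 (fun y => F (y + T) - F y) 0.
  move=> /andP[y0 yt].
  have D1 : is_derive (y + T) 1 F (f (y + T)) by apply: FD; lra.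
  have D2 : is_derive y 1 F (f y) by apply: FD; lra.
  have D3 : is_derive y 1 (fun y => F (y + T)) (f y).
    rewrite fT in D1; rewrite -[f y]mulr1; apply: (@is_derive1_comp _ F (fun y => y + T)).
    by apply: is_derive_eq (is_derive_add (is_derive_id1 _) (is_derive_cst1 _ _)) _; rewrite addr0.
  by apply: is_derive_eq (is_derive_sub D3 D2) _; rewrite subrr.
by have := is_derive0_itv t0 GD; rewrite add0r.
Qed.

(** The arctangent of cross product over dot product is, modulo [pi], the angle from [A] to [B]; its
    derivative is [d arg B - d arg A]. A nonzero dot product avoids the branch jump. *)
Lemma is_derive_angle (A1 A2 B1 B2 : R -> R) (s a1 a2 b1 b2 : R) :
  is_derive s 1 A1 a1 -> is_derive s 1 A2 a2 ->
  is_derive s 1 B1 b1 -> is_derive s 1 B2 b2 ->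
  A1 s * B1 s + A2 s * B2 s != 0 ->
  is_derive s 1 (fun s => atan ((A1 s * B2 s - A2 s * B1 s) / (A1 s * B1 s + A2 s * B2 s)))
    ((B1 s * b2 - B2 s * b1) / (B1 s ^+ 2 + B2 s ^+ 2) -
     (A1 s * a2 - A2 s * a1) / (A1 s ^+ 2 + A2 s ^+ 2)).
Proof.
move=> DA1 DA2 DB1 DB2 n0.
have D := is_derive_atan (is_derive_mul
  (is_derive_sub (is_derive_mul DA1 DB2) (is_derive_mul DA2 DB1))
  (is_derive_inv (f := fun s => A1 s * B1 s + A2 s * B2 s) n0 (is_derive_add (is_derive_mul DA1 DB1) (is_derive_mul DA2 DB2)))).
apply: is_derive_eq D _.
move: (A1 s) (A2 s) (B1 s) (B2 s) n0 => p q u v n0.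
have nA : p ^+ 2 + q ^+ 2 != 0.
  apply/eqP => /eqP; rewrite paddr_eq0 ?sqr_ge0// !sqrf_eq0 => /andP[/eqP e1 /eqP e2].
  by move: n0; rewrite e1 e2 !mul0r addr0 eqxx.
have nB : u ^+ 2 + v ^+ 2 != 0.
  apply/eqP => /eqP; rewrite paddr_eq0 ?sqr_ge0// !sqrf_eq0 => /andP[/eqP e1 /eqP e2].
  by move: n0; rewrite e1 e2 !mulr0 addr0 eqxx.
have nAB : (p * u + q * v) ^+ 2 + (p * v - q * u) ^+ 2 != 0.
  have -> : (p * u + q * v) ^+ 2 + (p * v - q * u) ^+ 2 =
    (p ^+ 2 + q ^+ 2) * (u ^+ 2 + v ^+ 2) by ring.
  exact: mulf_neq0.
have n1 : 1 + ((p * v - q * u) / (p * u + q * v)) ^+ 2 != 0.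
  have -> : 1 + ((p * v - q * u) / (p * u + q * v)) ^+ 2 =
     ((p * u + q * v) ^+ 2 + (p * v - q * u) ^+ 2) / (p * u + q * v) ^+ 2 by field.
  by rewrite mulf_neq0// invr_neq0// expf_neq0.
by field; rewrite n0 nA nB nAB.
Qed.

Lemma cvg_atan_quotient (F : set_system R) (f g : R -> R) (n : R) : ProperFilter F ->
  f @ F --> n -> 0 < n -> g @ F --> 0 -> (\forall s \near F, 0 < g s) ->
  (fun s => atan (f s / g s)) @ F --> pi / 2.
Proof.
move=> PF fn n0 g0 gp.
apply: (@cvg_comp _ _ _ (fun s => f s / g s) (@atan R) F (pinfty_nbhs R)); last exact: cvgy_atan.
apply/cvgryPge => B.
have B0 : 0 < n / 2 / (`|B| + 1) by rewrite !divr_gt0// ltr_wpDl.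
have f2 : n / 2 < n by lra.
near=> s.
have gs : 0 < g s by near: s.
rewrite ler_pdivlMr//.
have h1 : n / 2 < f s by near: s; exact: (cvgr_gt _ fn).
have h2 : g s < n / 2 / (`|B| + 1) by near: s; exact: (cvgr_lt _ g0).
rewrite ltr_pdivlMr ?ltr_wpDl// in h2.
have : B * g s <= g s * (`|B| + 1).
  by rewrite mulrC; apply: ler_wpM2l; [exact: ltW|have := ler_norm B; lra].
lra.
Unshelve. all: by end_near. Qed.

End Curve.

(** * Winding numbers of the curve and its angular kernel *)

Section ClosedCurve.
Variables (R : realType) (x : R -> R * R).
Local Notation mu := (@lebesgue_measure R).
Implicit Types (s t : R).

Hypotheses (x1A : forall a, analytic_at (fst \o x) a)
  (x2A : forall a, analytic_at (snd \o x) a)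
  (xper : periodic x (2 * pi))
  (xreg : forall t, dcurve x 1 t != (0, 0))
  (xinj : forall s t, 0 <= s < 2 * pi -> 0 <= t < 2 * pi -> x s = x t -> s = t).

Definition arg_form (p : R * R) (s : R) : R :=
  ((x s - p).1 * (dcurve x 1 s).2 - (x s - p).2 * (dcurve x 1 s).1) / dot (x s - p) (x s - p).

(** The value on the diagonal is the limit of [arg_form (x t)]: half the signed curvature times the
    speed. *)
Definition arg_kernel (t s : R) : R :=
  if `[< eqmod2pi s t >] then
    ((dcurve x 1 t).1 * (dcurve x 2 t).2 - (dcurve x 1 t).2 * (dcurve x 2 t).1) /
      (2 * dot (dcurve x 1 t) (dcurve x 1 t))
  else arg_form (x t) s.

Lemma dot_self (p : R * R) : dot p p = p.1 ^+ 2 + p.2 ^+ 2.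
Proof. by rewrite /dot !expr2. Qed.

Lemma dot_self_ge0 (p : R * R) : 0 <= dot p p.
Proof. by rewrite dot_self addr_ge0// sqr_ge0. Qed.

Lemma dot_self_gt0 (p : R * R) : p != (0, 0) -> 0 < dot p p.
Proof.
move=> p0; rewrite lt_neqAle dot_self_ge0 andbT eq_sym dot_self.
apply: contra p0; rewrite paddr_eq0 ?sqr_ge0// !sqrf_eq0 => /andP[/eqP e1 /eqP e2].
by rewrite [p]surjective_pairing e1 e2.
Qed.

Lemma sqr_enorm (p : R * R) : enorm p ^+ 2 = dot p p.
Proof. by rewrite /enorm sqr_sqrtr// dot_self_ge0. Qed.

Lemma curve_eqmod s t : eqmod2pi s t -> x s = x t.
Proof. by move=> [k ->]; rewrite (periodic_int k xper). Qed.

Lemma curve_2pi : x (2 * pi) = x 0.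
Proof. by rewrite -[RHS](xper 0) add0r. Qed.

Lemma curve_inj s t : x s = x t -> eqmod2pi s t.
Proof.
have [s0 s0i [k Es]] := eqmod2pi_itv s; have [t0 t0i [l Et]] := eqmod2pi_itv t.
rewrite Es Et !(periodic_int _ xper) => /(xinj s0i t0i) ->.
by exists (k - l); rewrite intrB; ring.
Qed.

Lemma chord_neq0 s t : ~ eqmod2pi s t -> x s - x t != 0.
Proof. by move=> st; rewrite subr_eq0; apply/eqP => /curve_inj. Qed.

Lemma chord_sqr_gt0 s t : ~ eqmod2pi s t -> 0 < dot (x s - x t) (x s - x t).
Proof. by move=> /chord_neq0/dot_self_gt0. Qed.

Lemma speed_sqr_gt0 t : 0 < dot (dcurve x 1 t) (dcurve x 1 t).
Proof. exact: dot_self_gt0. Qed.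

Lemma derive1_curve1 s : is_derive s 1 (fst \o x) (dcurve x 1 s).1.
Proof.
by split; [exact: nbhs_singleton (analytic_at_derivable (x1A s))|rewrite -derive1E].
Qed.

Lemma derive1_curve2 s : is_derive s 1 (snd \o x) (dcurve x 1 s).2.
Proof.
by split; [exact: nbhs_singleton (analytic_at_derivable (x2A s))|rewrite -derive1E].
Qed.

Lemma dcurve1_analytic n a : analytic_at (fun s => (dcurve x n s).1) a.
Proof. exact: analytic_at_derive1n. Qed.

Lemma dcurve2_analytic n a : analytic_at (fun s => (dcurve x n s).2) a.
Proof. exact: analytic_at_derive1n. Qed.

Lemma chord1_analytic (p : R * R) a : analytic_at (fun s => (x s - p).1) a.
Proof. by apply: (@analytic_atB _ (fst \o x) (fun=> p.1)) => //; exact: analytic_at_cst. Qed.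

Lemma chord2_analytic (p : R * R) a : analytic_at (fun s => (x s - p).2) a.
Proof. by apply: (@analytic_atB _ (snd \o x) (fun=> p.2)) => //; exact: analytic_at_cst. Qed.

Lemma chord_sqr_analytic (p : R * R) a : analytic_at (fun s => dot (x s - p) (x s - p)) a.
Proof.
apply: analytic_atD; apply: analytic_atM; by [exact: chord1_analytic|exact: chord2_analytic].
Qed.

Lemma arg_form_analytic (p : R * R) a : x a != p -> analytic_at (arg_form p) a.
Proof.
move=> xap; apply: analytic_atM.
  apply: analytic_atB; apply: analytic_atM.
  - exact: chord1_analytic.
  - exact: dcurve2_analytic.
  - exact: chord2_analytic.
  - exact: dcurve1_analytic.
apply: analytic_atV; last exact: chord_sqr_analytic.
by rewrite gt_eqF//; apply: dot_self_gt0; move: xap; rewrite -subr_eq0.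
Qed.

Lemma dcurve_periodic n : periodic (dcurve x n) (2 * pi).
Proof.
move=> s; rewrite /dcurve; congr (_, _); apply: periodic_derive1n => u /=;
  by rewrite xper.
Qed.

Lemma arg_form_periodic p : periodic (arg_form p) (2 * pi).
Proof. by move=> s; rewrite /arg_form xper dcurve_periodic. Qed.

Lemma arg_kernel_periodic t : periodic (arg_kernel t) (2 * pi).
Proof.
move=> s; rewrite /arg_kernel arg_form_periodic.
by rewrite (_ : `[< eqmod2pi (s + 2 * pi) t >] = `[< eqmod2pi s t >])//;
  apply: asbool_equiv_eq; exact: eqmod2pi_addr.
Qed.

Lemma chord_factor t : exists d1 d2 : R -> R,
  [/\ analytic_at d1 t, analytic_at d2 t,
    forall s, x s - x t = ((s - t) * d1 s, (s - t) * d2 s),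
    (d1 t, d2 t) = dcurve x 1 t &
    (2 * derive1 d1 t, 2 * derive1 d2 t) = dcurve x 2 t].
Proof.
have [d1 d1A [E1 F1 G1]] := analytic_at_sub_factor (x1A t).
have [d2 d2A [E2 F2 G2]] := analytic_at_sub_factor (x2A t).
exists d1, d2; split=> //.
- by move=> s; rewrite -E1 -E2.
- by rewrite F1 F2.
- by rewrite -G1 -G2.
Qed.

(* Dividing numerator and denominator of the kernel by [(s - t)^2] removes the singularity. *)
Lemma arg_kernel_analytic_diag t : analytic_at (arg_kernel t) t.
Proof.
have [d1 [d2 [d1A d2A E F G]]] := chord_factor t.
pose q s := (d1 s * derive1 d2 s - d2 s * derive1 d1 s) / (d1 s * d1 s + d2 s * d2 s).
have den : d1 t * d1 t + d2 t * d2 t != 0.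
  by have := speed_sqr_gt0 t; rewrite -F /dot /= => /gt_eqF ->.
have denA : analytic_at (fun s => d1 s * d1 s + d2 s * d2 s) t.
  by apply: analytic_atD; apply: analytic_atM.
have denp : \forall s \near t, 0 < d1 s * d1 s + d2 s * d2 s.
  apply: (continuous_gt0_near (analytic_at_continuous denA)).
  by have := speed_sqr_gt0 t; rewrite -F.
have qA : analytic_at q t.
  apply: analytic_atM; last exact: analytic_atV.
  by apply: analytic_atB; apply: analytic_atM => //; exact: analytic_at_derive1.
apply: analytic_at_near qA.
have [e1 e1A D1] := analytic_at_is_derive d1A.
have [e2 e2A D2] := analytic_at_is_derive d2A.
have pn := eqmod2pi_near_punctured t t; rewrite near_withinE in pn.
near=> s.
have [->|st] := eqVneq s t.
  rewrite /q /arg_kernel asboolT; last exact: eqmod2pi_refl.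
  rewrite -F -G /dot /=; field; exact: den.
have ns : ~ eqmod2pi s t by move: st; near: s.
rewrite /arg_kernel asboolF// /arg_form.
have D1s : is_derive s 1 d1 (e1 s) by near: s.
have D2s : is_derive s 1 d2 (e2 s) by near: s.
have dE (f d : R -> R) (e : R) : is_derive s 1 d e -> (forall s, f s - f t = (s - t) * d s) ->
    derive1 f s = d s + (s - t) * e.
  move=> D fE; have -> : f = (fun s => f t + (s - t) * d s).
    by apply/funext => u; rewrite -fE addrC subrK.
  have D' : is_derive s 1 (fun s => f t + (s - t) * d s) (d s + (s - t) * e).
    apply: is_derive_eq (is_derive_add (is_derive_cst1 _ _)
     (is_derive_mul (is_derive_sub (is_derive_id1 _) (is_derive_cst1 _ _)) D)) _.
    by ring.
  by rewrite derive1E; have [_ ->] := D'.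
have -> : (dcurve x 1 s).1 = d1 s + (s - t) * e1 s.
  by apply: dE => // u; have := congr1 fst (E u).
have -> : (dcurve x 1 s).2 = d2 s + (s - t) * e2 s.
  by apply: dE => // u; have := congr1 snd (E u).
have E1 : derive1 d1 s = e1 s by rewrite derive1E; have [_ ->] := D1s.
have E2 : derive1 d2 s = e2 s by rewrite derive1E; have [_ ->] := D2s.
rewrite E /q E1 E2 /dot /=.
have dens : d1 s * d1 s + d2 s * d2 s != 0 by rewrite gt_eqF//; near: s.
have st0 : (s - t) ^+ 2 != 0 by rewrite expf_neq0// subr_eq0.
have -> : (s - t) * d1 s * ((s - t) * d1 s) + (s - t) * d2 s * ((s - t) * d2 s) =
  (s - t) ^+ 2 * (d1 s * d1 s + d2 s * d2 s) by ring.
have -> : (s - t) * d1 s * (d2 s + (s - t) * e2 s) - (s - t) * d2 s * (d1 s + (s - t) * e1 s) =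
  (s - t) ^+ 2 * (d1 s * e2 s - d2 s * e1 s) by ring.
by rewrite invfM mulrACA divff// mul1r.
Unshelve. all: by end_near. Qed.

Lemma arg_kernel_analytic t a : analytic_at (arg_kernel t) a.
Proof.
have [[k ->]|nat_] := pselect (eqmod2pi a t).
  exact: analytic_at_periodic (@arg_kernel_periodic t) (arg_kernel_analytic_diag t).
apply: (analytic_at_near (f := arg_form (x t))).
  by have := eqmod2pi_near_neq nat_; apply: filterS => s ns; rewrite /arg_kernel asboolF.
apply: arg_form_analytic; apply: contra_notN nat_ => /eqP; exact: curve_inj.
Qed.

Lemma windingE p : winding x p = (2 * pi)^-1 * \int[mu]_(s in `[0, 2 * pi]) arg_form p s.
Proof.
by rewrite /winding; congr (_ * _); apply: eq_Rintegral => s _; rewrite /arg_form sqr_enorm.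
Qed.

Lemma arg_form_continuous p : (~` range x) p -> continuous (arg_form p).
Proof.
move=> px s; apply: analytic_at_continuous; apply: arg_form_analytic.
by apply: contra_notN px => /eqP <-; exists s.
Qed.

Lemma dot_gt0_neq (p q : R * R) : 0 < dot p q -> p != 0 /\ q != 0.
Proof.
move=> pq; split; apply/negP => /eqP e; move: pq; rewrite e /dot /=.
  by rewrite !mul0r addr0 ltxx.
by rewrite !mulr0 addr0 ltxx.
Qed.

(** Seen from each point of the curve, [p] and [q] subtend an acute angle, so the difference of the
    two arguments is a single-valued arctangent and returns to its value after one period. *)
Lemma winding_eq p q : (forall s, 0 < dot (x s - q) (x s - p)) -> winding x p = winding x q.
Proof.
move=> pq.
have px : (~` range x) p.
  by move=> [s _ e]; have [_] := dot_gt0_neq (pq s); rewrite e subrr eqxx.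
have qx : (~` range x) q.
  by move=> [s _ e]; have [] := dot_gt0_neq (pq s); rewrite e subrr eqxx.
rewrite !windingE; congr (_ * _); apply/eqP; rewrite -subr_eq0.
rewrite -continuous_RintegralB; try exact: arg_form_continuous.
pose F s := atan (((x s - q).1 * (x s - p).2 - (x s - q).2 * (x s - p).1) /
  dot (x s - q) (x s - p)).
have FD s : is_derive s 1 F (arg_form p s - arg_form q s).
  have D1 (r : R * R) : is_derive s 1 (fun s => (x s - r).1) (dcurve x 1 s).1.
    by apply: is_derive_eq (is_derive_sub (derive1_curve1 s) (is_derive_cst1 r.1 s)) _; rewrite subr0.
  have D2 (r : R * R) : is_derive s 1 (fun s => (x s - r).2) (dcurve x 1 s).2.
    by apply: is_derive_eq (is_derive_sub (derive1_curve2 s) (is_derive_cst1 r.2 s)) _; rewrite subr0.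
  have := is_derive_angle (D1 q) (D2 q) (D1 p) (D2 p); rewrite /arg_form !dot_self.
  by apply; rewrite gt_eqF//; exact: pq.
rewrite (FTC2_continuous (two_pi_ge0 R) _ FD); last first.
  by move=> s; apply: cvgB; exact: arg_form_continuous.
by rewrite /F curve_2pi subrr.
Qed.

(** Seen from [p], the curve stays in an open half-plane, so its argument relative to [d] is a
    periodic arctangent. *)
Lemma winding_eq0 p d : (forall s, 0 < dot d (x s - p)) -> winding x p = 0.
Proof.
move=> dp.
have px : (~` range x) p.
  by move=> [s _ e]; have [_] := dot_gt0_neq (dp s); rewrite e subrr eqxx.
rewrite windingE.
pose F s := atan ((d.1 * (x s - p).2 - d.2 * (x s - p).1) / dot d (x s - p)).
have FD s : is_derive s 1 F (arg_form p s).
  have D1 : is_derive s 1 (fun s => (x s - p).1) (dcurve x 1 s).1.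
    by apply: is_derive_eq (is_derive_sub (derive1_curve1 s) (is_derive_cst1 p.1 s)) _; rewrite subr0.
  have D2 : is_derive s 1 (fun s => (x s - p).2) (dcurve x 1 s).2.
    by apply: is_derive_eq (is_derive_sub (derive1_curve2 s) (is_derive_cst1 p.2 s)) _; rewrite subr0.
  have := is_derive_angle (is_derive_cst1 d.1 s) (is_derive_cst1 d.2 s) D1 D2.
  rewrite /arg_form !dot_self !mulr0 subrr mul0r subr0.
  by apply; rewrite gt_eqF//; exact: dp.
rewrite (FTC2_continuous (two_pi_ge0 R) _ FD); last exact: arg_form_continuous.
by rewrite /F curve_2pi subrr mulr0.
Qed.



Lemma curve_itv s : exists2 s0, 0 <= s0 <= 2 * pi & x s = x s0.
Proof.
have [s0 /andP[s00 s01] e] := eqmod2pi_itv s; exists s0; first by rewrite s00 ltW.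
exact: curve_eqmod.
Qed.

Lemma dist_curve_gt0 p : (~` range x) p ->
  exists2 e, 0 < e & forall s, e <= dot (x s - p) (x s - p).
Proof.
move=> px; pose f s := dot (x s - p) (x s - p).
have fc : {within `[0, 2 * pi], continuous f}.
  by apply: continuous_subspaceT => s; exact: analytic_at_continuous (chord_sqr_analytic p s).
have [c _ cmin] := EVT_min (two_pi_ge0 R) fc.
exists (f c).
  apply: dot_self_gt0; apply/eqP => e; apply: px; exists c => //.
  by apply/eqP; rewrite -subr_eq0; apply/eqP.
move=> s; have [s0 s0i ->] := curve_itv s.
by apply: cmin; rewrite in_itv.
Qed.

Lemma curve_bounded : exists B, forall s, `|(x s).1| <= B /\ `|(x s).2| <= B.
Proof.
have [B1 H1] := continuous_bounded_box (K := fun=> fst \o x) 0 0 0 (2 * pi)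
  (continuous_snd2 (fun s => analytic_at_continuous (x1A s))).
have [B2 H2] := continuous_bounded_box (K := fun=> snd \o x) 0 0 0 (2 * pi)
  (continuous_snd2 (fun s => analytic_at_continuous (x2A s))).
exists (`|B1| + `|B2|) => s; have [s0 s0i ->] := curve_itv s.
have h1 : `|(x s0).1| <= B1 by apply: (H1 0) => //; rewrite lexx.
have h2 : `|(x s0).2| <= B2 by apply: (H2 0) => //; rewrite lexx.
have := ler_norm B1; have := ler_norm B2; have := normr_ge0 B1; have := normr_ge0 B2.
by move=> *; split; lra.
Qed.

Lemma winding_locally_cst p : (~` range x) p ->
  \forall q \near p, (~` range x) q /\ winding x q = winding x p.
Proof.
move=> px; have [e e0 eP] := dist_curve_gt0 px.
have [B BP] := curve_bounded.
(* [C] bounds the coordinates of [x s - p]. For [q] within [e / (4 C)] of [p], each of the two error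
   terms in the dot product is at most [e / 4], which leaves at least [e / 2]. *)
pose C := `|B| + `|p.1| + `|p.2| + 1.
have C0 : 0 < C by rewrite ltr_wpDl// !addr_ge0.
pose d := e / (4 * C).
have d0 : 0 < d by rewrite divr_gt0// mulr_gt0.
apply/nbhs_ballP; exists d => //= -[q1 q2] [] /=; rewrite /ball/= => h1 h2.
have pos s : 0 < dot (x s - p) (x s - (q1, q2)).
  have [b1 b2] := BP s; have := eP s; rewrite /dot /=.
  have := ler_norm B => hB.
  have c1 : `|(x s).1 - p.1| <= C.
    by apply: le_trans (ler_normB _ _) _; rewrite /C; have := normr_ge0 p.2; lra.
  have c2 : `|(x s).2 - p.2| <= C.
    by apply: le_trans (ler_normB _ _) _; rewrite /C; have := normr_ge0 p.1; lra.
  have m1 : `|((x s).1 - p.1) * (p.1 - q1)| <= e / 4.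
    rewrite normrM (_ : e / 4 = C * d); last by rewrite /d; field; rewrite gt_eqF.
    by apply: ler_pM => //; exact: ltW.
  have m2 : `|((x s).2 - p.2) * (p.2 - q2)| <= e / 4.
    rewrite normrM (_ : e / 4 = C * d); last by rewrite /d; field; rewrite gt_eqF.
    by apply: ler_pM => //; exact: ltW.
  move: m1 m2; rewrite !ler_norml => /andP[? ?] /andP[? ?] ?.
  have -> : ((x s).1 - p.1) * ((x s).1 - q1) + ((x s).2 - p.2) * ((x s).2 - q2) =
   (((x s).1 - p.1) * ((x s).1 - p.1) + ((x s).2 - p.2) * ((x s).2 - p.2)) +
   ((x s).1 - p.1) * (p.1 - q1) + ((x s).2 - p.2) * (p.2 - q2) by ring.
  lra.
split; last exact: winding_eq.
by move=> [s _ e1]; have [_] := dot_gt0_neq (pos s); rewrite e1 subrr eqxx.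
Qed.

(** Local constancy makes the level set of the winding number and its complement off the curve both
    open, so the level set is all of any connected set it meets. *)
Lemma winding_connected p q : connected_component (~` range x) p q ->
  winding x q = winding x p.
Proof.
move=> [C [Cp CA Cc] Cq].
pose W := [set r | (~` range x) r /\ winding x r = winding x p].
pose W' := [set r | (~` range x) r /\ winding x r <> winding x p].
have oW : open W.
  rewrite openE => r [rx rw]; have := winding_locally_cst rx.
  by apply: filterS => r' [? e]; split=> //; rewrite e.
have oW' : open W'.
  rewrite openE => r [rx rw]; have := winding_locally_cst rx.
  by apply: filterS => r' [? e]; split=> //; rewrite e.
have E : C `&` W = C.
  apply: Cc.
  - by exists p; split=> //; split=> //; exact: CA.
  - by exists W.
  - exists (~` W'); first by rewrite closedC.
    apply/seteqP; split=> r [Cr].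
      by move=> [_ rw]; split=> // -[_ ].
    move=> nr; split=> //; split; first exact: CA.
    by apply: contrapT => h; apply: nr; split=> //; exact: CA.
by have : (C `&` W) q; [rewrite E|move=> [_ []]].
Qed.

(** An unbounded component contains a point [q] so far away that the whole curve lies in the
    half-plane seen from [q] in the direction [- q]. *)
Lemma winding_unbounded p : (~` range x) p ->
  ~ bounded_set (connected_component (~` range x) p) -> winding x p = 0.
Proof.
move=> px nb; have [B BP] := curve_bounded.
have [q qC qB] : exists2 q, connected_component (~` range x) p q & 4 * (`|B| + 1) < `|q|.
  apply: contrapT => h; apply: nb; exists (4 * (`|B| + 1)); split; first exact: num_real.
  move=> M hM q qC /=; rewrite leNgt; apply/negP => hq.
  by apply: h; exists q => //; exact: lt_trans hq.
rewrite -(winding_connected qC); apply: (@winding_eq0 _ (- q)) => s.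
have [b1 b2] := BP s; have hB := ler_norm B.
have B0 := normr_ge0 B.
have P (a b c1 c2 : R) : 4 * (`|B| + 1) < `|a| -> `|b| <= `|a| -> `|c1| <= B -> `|c2| <= B ->
    0 < a ^+ 2 + b ^+ 2 - a * c1 - b * c2.
  move=> ha ba h1 h2.
  have k1 : `|a * c1| <= `|a| * `|B| by rewrite normrM; apply: ler_pM => //; lra.
  have k2 : `|b * c2| <= `|a| * `|B| by rewrite normrM; apply: ler_pM => //; lra.
  have k3 : `|a| * (4 * (`|B| + 1)) <= `|a| * `|a| by apply: ler_wpM2l => //; exact: ltW.
  have k4 : `|a| * `|a| = a ^+ 2 by rewrite -expr2 real_normK ?num_real.
  have k5 : 0 <= b ^+ 2 := sqr_ge0 b.
  have k6 : 0 <= `|a| * `|B| by rewrite mulr_ge0.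
  have := ler_norm (a * c1); have := ler_norm (b * c2); lra.
have -> : dot (- q) (x s - q) = q.1 ^+ 2 + q.2 ^+ 2 - q.1 * (x s).1 - q.2 * (x s).2.
  by rewrite /dot /=; ring.
(* The norm on pairs is the larger coordinate, which takes the role of [a] in [P]. *)
move: qB; rewrite prod_normE /=; case: (leP `|q.1| `|q.2|) => h qB.
  rewrite (addrC (q.1 ^+ 2)) addrAC; exact: P.
by apply: P => //; exact: ltW.
Qed.

Lemma local_bound_continuous (f g : R -> R) (s0 : R) : {for s0, continuous f} ->
  {for s0, continuous g} -> 0 < g s0 -> exists2 C, 0 <= C & \forall s \near s0, `|f s| <= C * g s.
Proof.
move=> fc gc g0; exists ((`|f s0| + 1) / (g s0 / 2)).
  by rewrite divr_ge0 ?addr_ge0// ltW// divr_gt0.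
have g2 : g s0 / 2 < g s0 by lra.
have fc' : (fun s => `|f s|) @ s0 --> `|f s0| by apply: cvg_norm.
near=> s.
have h1 : g s0 / 2 < g s by near: s; exact: (cvgr_gt _ gc).
have h2 : `|f s| < `|f s0| + 1 by near: s; apply: (cvgr_lt _ fc'); rewrite ltrDl.
apply: (@le_trans _ _ (`|f s0| + 1)); first exact: ltW.
rewrite -mulrA ler_peMr ?addr_ge0// mulrC ler_pdivlMr ?divr_gt0// mul1r; exact: ltW.
Unshelve. all: by end_near. Qed.

Lemma cvg_atan_quotient_sg (F : set_system R) (f g : R -> R) (n c : R) : ProperFilter F ->
  f @ F --> n -> 0 < n -> g @ F --> 0 -> (\forall s \near F, 0 < g s) -> c != 0 ->
  (fun s => atan (c * f s / g s)) @ F --> Num.sg c * (pi / 2).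
Proof.
move=> PF fn n0 g0 gp c0.
have -> : (fun s => atan (c * f s / g s)) = (fun s => Num.sg c * atan (`|c| * f s / g s)).
  apply/funext => s; have [cp|cn|c00] := ltgtP c 0; last by rewrite c00 eqxx in c0.
    by rewrite ltr0_sg// ltr0_norm// mulN1r -atanN !mulNr opprK.
  by rewrite gtr0_sg// gtr0_norm// mul1r.
apply: cvgMr; apply: (@cvg_atan_quotient _ _ _ _ (`|c| * n)) => //; first exact: cvgMr.
by rewrite mulr_gt0// normr_gt0.
Qed.

(** The tangent turned counterclockwise by a right angle, left unnormalized. *)
Let nu t : R * R := (- (dcurve x 1 t).2, (dcurve x 1 t).1).

(* The chord is tangent to the curve to first order. *)
Lemma chord_normal_le t : exists2 C, 0 < C & forall s,
  `|dot (x s - x t) (nu t)| <= C * dot (x s - x t) (x s - x t).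
Proof.
pose f s := dot (x s - x t) (nu t); pose g s := dot (x s - x t) (x s - x t).
have fA a : analytic_at f a.
  by apply: analytic_atD; apply: analytic_atM; by [exact: chord1_analytic|exact: chord2_analytic|exact: analytic_at_cst].
have gA a : analytic_at g a := chord_sqr_analytic (x t) a.
have loc s0 : t - pi <= s0 <= t + pi -> exists C, \forall s \near s0, `|f s| <= C * g s.
  move=> s0i; have [st|ns] := eqVneq s0 t; last first.
    have [|C _ HC] := local_bound_continuous (analytic_at_continuous (fA s0)) (analytic_at_continuous (gA s0)).
      apply: chord_sqr_gt0 => e; move/eqP: ns; apply; apply: (eqmod2pi_near e).
      by rewrite ltr_norml; have := @pi_gt0 R; lra.
    by exists C.
  rewrite st.
  have [d1 [d2 [d1A d2A E F G]]] := chord_factor t.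
  have eA : analytic_at (fun s => d1 s * (nu t).1 + d2 s * (nu t).2) t.
    by apply: analytic_atD; apply: analytic_atM => //; exact: analytic_at_cst.
  have [|eta etaA etaE] := analytic_at_divX _ eA.
    have e1 : d1 t = (dcurve x 1 t).1 by rewrite -F.
    have e2 : d2 t = (dcurve x 1 t).2 by rewrite -F.
    by rewrite e1 e2 /nu /=; ring.
  have dA : analytic_at (fun s => d1 s * d1 s + d2 s * d2 s) t.
    by apply: analytic_atD; apply: analytic_atM.
  have [|C _ HC] := local_bound_continuous (analytic_at_continuous etaA) (analytic_at_continuous dA).
    by have := speed_sqr_gt0 t; rewrite -F.
  exists C; apply: filterS HC => s hs.
  have -> : g s = (s - t) ^+ 2 * (d1 s * d1 s + d2 s * d2 s) by rewrite /g E /dot /=; ring.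
  have -> : f s = (s - t) ^+ 2 * eta s.
    have [->|sn] := eqVneq s t; first by rewrite /f !subrr /dot /= !mul0r addr0 expr2 !mul0r.
    rewrite etaE// /f E /dot /=; field; by rewrite subr_eq0.
  by rewrite normrM (ger0_norm (sqr_ge0 _)) mulrCA; apply: ler_wpM2l; rewrite ?sqr_ge0.
have [C HC] := local_to_segment_bound (fun s => dot_self_ge0 (x s - x t)) loc.
exists (`|C| + 1) => [|s]; first by rewrite ltr_wpDl.
have [s0 /andP[s00 s01] e] := eqmod2pi_itv (s - (t - pi)).
have xs : x s = x (t - pi + s0).
  by apply: curve_eqmod; case: e => k e; exists k; rewrite -[LHS](subrK (t - pi)) e; ring.
rewrite xs; apply: (le_trans (HC _ _)); first by apply/andP; split; lra.
apply: ler_wpM2r; first exact: dot_self_ge0.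
by have := ler_norm C; lra.
Qed.

(** The dot product is [|chord|^2 - c (chord . nu)]. By [chord_normal_le] the second term is of the
    same order as the first even as [s] tends to [t], so a single bound on [c] works for all [s]. *)
Lemma chord_shift_pos t : exists2 e, 0 < e & forall c : R, `|c| < e -> forall s, ~ eqmod2pi s t ->
  0 < dot (x s - x t) (x s - (x t + (c * (nu t).1, c * (nu t).2))).
Proof.
have [C C0 HC] := chord_normal_le t.
exists C^-1; first by rewrite invr_gt0.
move=> c cC s ns; have g0 := chord_sqr_gt0 ns.
have -> : dot (x s - x t) (x s - (x t + (c * (nu t).1, c * (nu t).2))) =
  dot (x s - x t) (x s - x t) - c * dot (x s - x t) (nu t) by rewrite /dot /=; ring.
have := HC s; set f := dot _ (nu t); move: g0; set g := dot _ _ => g0 fg.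
have h : `|c * f| < g.
  have [->|c0] := eqVneq c 0; first by rewrite mul0r normr0.
  rewrite normrM; apply: (@le_lt_trans _ _ (`|c| * (C * g))); first exact: ler_wpM2l.
  by rewrite mulrA -[ltRHS]mul1r ltr_pM2r// -ltr_pdivlMr// div1r.
have := ler_norm (c * f); lra.
Qed.

(** The angle [A] from [x s - x t] to [x s - p] stays acute on the open period, and its derivative
    there is [arg_form p - arg_kernel t]. At both ends the chord direction becomes tangent while
    [x s - p] becomes normal, so [A] goes from [- sg c * pi / 2] to [sg c * pi / 2]. *)
Lemma winding_jump t c : c != 0 -> 0 <= t ->
  (forall s, ~ eqmod2pi s t -> 0 < dot (x s - x t) (x s - (x t + (c * (nu t).1, c * (nu t).2)))) ->
  (~` range x) (x t + (c * (nu t).1, c * (nu t).2)) /\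
  2 * pi * winding x (x t + (c * (nu t).1, c * (nu t).2)) =
  \int[mu]_(s in `[0, 2 * pi]) arg_kernel t s + Num.sg c * pi.
Proof.
move=> c0 t0; set p := x t + _ => pos.
have px : (~` range x) p.
  move=> [s _ e]; have [st|ns] := pselect (eqmod2pi s t); last first.
    by have [_] := dot_gt0_neq (pos s ns); rewrite e subrr eqxx.
  move: e; rewrite (curve_eqmod st) /p => /eqP; rewrite -subr_eq0 opprD addrA subrr add0r oppr_eq0.
  rewrite xpair_eqE !mulf_eq0 (negPf c0) /= /nu /= oppr_eq0 => /andP[/eqP e2 /eqP e1].
  by have /eqP := xreg t; apply; rewrite [LHS]surjective_pairing; congr (_, _).
split=> //.
have pi0 : 2 * pi != 0 :> R by rewrite gt_eqF// pi2_gt0.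
rewrite windingE mulrA mulfV// mul1r.
have fc := arg_form_continuous px.
have kc : continuous (arg_kernel t) by move=> s; exact: analytic_at_continuous (arg_kernel_analytic t s).
rewrite -(Rintegral_periodic_shift fc (@arg_form_periodic p) (two_pi_ge0 R) t0).
rewrite -(Rintegral_periodic_shift kc (@arg_kernel_periodic t) (two_pi_ge0 R) t0).
suff : \int[mu]_(s in `[t, t + 2 * pi]) arg_form p s -
  \int[mu]_(s in `[t, t + 2 * pi]) arg_kernel t s = Num.sg c * pi by lra.
rewrite -continuous_RintegralB//.
have [d1 [d2 [d1A d2A E F G]]] := chord_factor t.
(* Up to the factor [- c] for [w], these are the cross and dot products after division by [s - t]:
   [w] is positive at [t], while [D] vanishes there and has the sign of [s - t]. *)
pose w s := d1 s * (dcurve x 1 t).1 + d2 s * (dcurve x 1 t).2.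
pose D s := (s - t) * (d1 s * d1 s + d2 s * d2 s) - c * (d1 s * (nu t).1 + d2 s * (nu t).2).
pose A s := atan (((x s - x t).1 * (x s - p).2 - (x s - x t).2 * (x s - p).1) /
  ((x s - x t).1 * (x s - p).1 + (x s - x t).2 * (x s - p).2)).
have dtE s : (x s - x t).1 * (x s - p).1 + (x s - x t).2 * (x s - p).2 = (s - t) * D s.
  have -> : x s - p = (x s - x t) - (c * (nu t).1, c * (nu t).2) by rewrite /p opprD addrA.
  by rewrite E /D /=; ring.
have crE s : (x s - x t).1 * (x s - p).2 - (x s - x t).2 * (x s - p).1 = (s - t) * - (c * w s).
  have -> : x s - p = (x s - x t) - (c * (nu t).1, c * (nu t).2) by rewrite /p opprD addrA.
  by rewrite E /w /nu /=; ring.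
have AE s : s != t -> A s = - atan (c * w s / D s).
  by move=> st; rewrite /A dtE crE -mulf_div divff ?subr_eq0// mul1r mulNr atanN.
(* Used at the right end: after a shift by one period, [s - t] is negative and so is [D], and the
   limit lemma requires a positive denominator. *)
have AE' s : s != t -> A s = atan (c * w s / - D s).
  by move=> st; rewrite AE// -atanN invrN mulrN.
have dpos s : ~ eqmod2pi s t -> 0 < (s - t) * D s.
  by move=> ns; rewrite -dtE; exact: pos.
have Aper s : A (s - 2 * pi) = A s.
  by rewrite /A -(xper (s - 2 * pi)) subrK.
have AD s : t < s < t + 2 * pi -> is_derive s 1 A (arg_form p s - arg_kernel t s).
  move=> /andP[s1 s2].
  have ns : ~ eqmod2pi s t.
    move=> e; have es : s = t by apply: (eqmod2pi_near e); rewrite gtr0_norm ?subr_gt0//; lra.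
    by move: s1; rewrite es ltxx.
  have D1 (r : R * R) : is_derive s 1 (fun s => (x s - r).1) (dcurve x 1 s).1.
    by apply: is_derive_eq (is_derive_sub (derive1_curve1 s) (is_derive_cst1 r.1 s)) _; rewrite subr0.
  have D2 (r : R * R) : is_derive s 1 (fun s => (x s - r).2) (dcurve x 1 s).2.
    by apply: is_derive_eq (is_derive_sub (derive1_curve2 s) (is_derive_cst1 r.2 s)) _; rewrite subr0.
  have := is_derive_angle (D1 (x t)) (D2 (x t)) (D1 p) (D2 p).
  rewrite /arg_kernel asboolF// /arg_form !dot_self.
  by apply; rewrite gt_eqF// dtE; exact: dpos.
have wA : analytic_at w t.
  by apply: analytic_atD; apply: analytic_atM => //; exact: analytic_at_cst.
have DA : analytic_at D t.
  apply: analytic_atB.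
    apply: analytic_atM; first by apply: analytic_atB; [exact: analytic_at_id|exact: analytic_at_cst].
    by apply: analytic_atD; apply: analytic_atM.
  apply: analytic_atM; first exact: analytic_at_cst.
  by apply: analytic_atD; apply: analytic_atM => //; exact: analytic_at_cst.
have ed1 : d1 t = (dcurve x 1 t).1 by rewrite -F.
have ed2 : d2 t = (dcurve x 1 t).2 by rewrite -F.
have w0 : 0 < w t by rewrite /w ed1 ed2; exact: speed_sqr_gt0.
have D0 : D t = 0 by rewrite /D ed1 ed2 /nu /=; ring.
have wc := analytic_at_continuous wA; have Dc := analytic_at_continuous DA.
have p20 := @pi2_gt0 R.
have tt : t < t + 2 * pi by lra.
have lim0 : A s @[s --> t^'+] --> - (Num.sg c * (pi / 2)).
  have L : (fun s => - atan (c * w s / D s)) @ t^'+ --> - (Num.sg c * (pi / 2)).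
    apply: cvgN; apply: (@cvg_atan_quotient_sg _ w D (w t) c) => //.
    - by apply: cvg_at_right_filter.
    - by rewrite -D0; apply: cvg_at_right_filter.
    near=> s.
    have st : t < s by near: s; exact: nbhs_right_gt.
    have sb : s < t + 2 * pi by near: s; exact: nbhs_right_lt.
    have ns : ~ eqmod2pi s t.
      move=> e; have es : s = t by apply: (eqmod2pi_near e); rewrite gtr0_norm ?subr_gt0//; lra.
      by move: st; rewrite es ltxx.
    by have := dpos s ns; rewrite pmulr_rgt0// subr_gt0.
  apply: cvg_trans L; apply: near_eq_cvg; near=> s.
  by rewrite AE// gt_eqF//; near: s; exact: nbhs_right_gt.
have lim1 : A s @[s --> (t + 2 * pi)^'-] --> Num.sg c * (pi / 2).
  have sh (f : R -> R) : {for t, continuous f} ->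
      (fun s => f (s - 2 * pi)) @ (t + 2 * pi)^'- --> f t.
    move=> fc'; apply: cvg_at_left_filter.
    have E1 : f t = f (t + 2 * pi - 2 * pi) by rewrite addrK.
    rewrite E1; apply: (@continuous_comp _ _ _ (fun s => s - 2 * pi) f).
      by apply: cvgB; [exact: cvg_id|exact: cvg_cst].
    by rewrite addrK.
  have L : (fun s => atan (c * w (s - 2 * pi) / - D (s - 2 * pi))) @ (t + 2 * pi)^'- -->
     Num.sg c * (pi / 2).
    apply: (@cvg_atan_quotient_sg _ (fun s => w (s - 2 * pi)) (fun s => - D (s - 2 * pi)) (w t) c) => //.
    - exact: sh.
    - by rewrite -oppr0 -D0; apply: cvgN; exact: sh.
    near=> s.
    have sb : s < t + 2 * pi by near: s; exact: nbhs_left_lt.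
    have st : t < s by near: s; exact: nbhs_left_gt.
    have ns : ~ eqmod2pi (s - 2 * pi) t.
      move=> e; have : s - 2 * pi = t by apply: (eqmod2pi_near e); rewrite ler0_norm; lra.
      lra.
    have := dpos _ ns; rewrite nmulr_rgt0; last by lra.
    by rewrite oppr_gt0.
  apply: cvg_trans L; apply: near_eq_cvg; near=> s.
  rewrite -Aper AE'// lt_eqF// ltrBlDr; near: s; exact: nbhs_left_lt.
have fi : mu.-integrable `[t, t + 2 * pi] (EFin \o (fun s => arg_form p s - arg_kernel t s)).
  by apply: continuous_integrable => s; apply: cvgB; [exact: fc|exact: kc].
rewrite (FTC_lim tt fi _ AD lim0 lim1); first by lra.
by move=> s _; apply: cvgB; [exact: fc|exact: kc].
Unshelve. all: by end_near. Qed.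

Hypothesis xccw : counterclockwise x.

Lemma winding_0_1 p : (~` range x) p -> winding x p = 0 \/ winding x p = 1.
Proof.
move=> px; have [b|nb] := pselect (bounded_set (connected_component (~` range x) p)).
  by right; apply: xccw.
by left; exact: winding_unbounded.
Qed.

Lemma Rintegral_arg_kernel t : 0 <= t -> \int[mu]_(s in `[0, 2 * pi]) arg_kernel t s = pi.
Proof.
move=> t0; have [e e0 pos] := chord_shift_pos t.
have p0 := @pi_gt0 R.
have e2 : `|e / 2| < e by rewrite gtr0_norm; lra.
have e2' : `|- (e / 2)| < e by rewrite normrN.
have n0 : e / 2 != 0 by rewrite gt_eqF//; lra.
have n0' : - (e / 2) != 0 by rewrite oppr_eq0.
have [px E1] := winding_jump n0 t0 (pos _ e2).
have [qx E2] := winding_jump n0' t0 (pos _ e2').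
move: E1 E2; rewrite sgrN gtr0_sg; last by lra.
(* Subtracting the two equations gives [w1 - w2 = 1]; only the case (1, 0) survives. *)
by move=> E1 E2; have [w1|w1] := winding_0_1 px; have [w2|w2] := winding_0_1 qx;
  rewrite w1 in E1; rewrite w2 in E2; lra.
Qed.

End ClosedCurve.

(** * Logarithmic singularities *)

Section LogSingularities.
Variable R : realType.
Local Notation mu := (@lebesgue_measure R).
Implicit Types (s t c : R) (f g : R -> R).

(** With [z = sqrt |h|] the left side is [4 z^2 |ln z|], and [z |ln z| <= 1] follows from
    [ln (1 / z) <= 1 / z - 1]. *)
Lemma mul_lnsq_le (h : R) : `|h| <= 1 -> `|h * ln (h ^+ 2)| <= 4 * Num.sqrt `|h|.
Proof.
have [->|h0] := eqVneq h 0; first by rewrite mul0r normr0 mulr_ge0// sqrtr_ge0.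
move=> h1; pose z := Num.sqrt `|h|.
have z0 : 0 < z by rewrite sqrtr_gt0 normr_gt0.
have zz : z ^+ 2 = `|h| by rewrite sqr_sqrtr.
have z1 : z <= 1 by rewrite -(@ler_pXn2r _ 2)// ?nnegrE ?(ltW z0)// zz expr1n.
have hz : h ^+ 2 = z ^+ 4 by rewrite -(real_normK (num_real h)) -zz -exprM.
have lz : ln z <= 0 by apply: ln_le0.
have zi : z * z^-1 = 1 by rewrite divff// gt_eqF.
have zi1 : 1 <= z^-1 by rewrite invr_ge1 ?unitfE ?gt_eqF.
have lz' : - ln z <= z^-1.
  rewrite -lnV ?posrE//; have := @le_ln1Dx R (z^-1 - 1).
  have -> : 1 + (z^-1 - 1) = z^-1 by rewrite addrC subrK.
  by move=> H; apply: le_trans (H _) _; lra.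
rewrite normrM hz lnXn// normrMn [X in _ * (X *+ _)]ler0_norm// -/z -zz.
have : z * (- ln z) <= 1 by rewrite -zi; apply: ler_wpM2l => //; exact: ltW.
have -> : z ^+ 2 * (- ln z *+ 4) = z * (4 * (z * - ln z)) by rewrite -mulr_natl; ring.
move=> H; rewrite mulrC; apply: ler_wpM2r; [exact: ltW|lra].
Qed.

Lemma cvg_mul_lnsq c : (fun s => (s - c) * ln ((s - c) ^+ 2)) @ c --> 0.
Proof.
have H : (fun s => 4 * Num.sqrt `|s - c|) @ c --> 0.
  have H1 : (fun s => Num.sqrt `|s - c|) @ c --> Num.sqrt `|c - c|.
    apply: (@continuous_comp _ _ _ (fun s => `|s - c|) Num.sqrt); last exact: sqrt_continuous.
    by apply: cvg_norm; apply: cvgB; [exact: cvg_id|exact: cvg_cst].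
  have E : 0 = 4 * Num.sqrt `|c - c| by rewrite subrr normr0 sqrtr0 mulr0.
  by rewrite [X in _ --> X]E; apply: cvgM => //; exact: cvg_cst.
apply/cvgrPdist_le => e e0; move/cvgrPdist_le : H => /(_ _ e0) H.
near=> s.
have h1 : `|s - c| < 1 by near: s; exact: norm_sub_lt_near.
rewrite sub0r normrN; apply: le_trans (mul_lnsq_le (ltW h1)) _.
have : `|0 - 4 * Num.sqrt `|s - c| | <= e by near: s.
by rewrite sub0r normrN ger0_norm// mulr_ge0// sqrtr_ge0.
Unshelve. all: by end_near. Qed.

Lemma sub_sqr_gt0 s c : s != c -> 0 < (s - c) ^+ 2.
Proof. by move=> sc; rewrite exprn_even_gt0//= subr_eq0. Qed.

Lemma is_derive_lnsq s c : s != c ->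
  is_derive s 1 (fun s => ln ((s - c) ^+ 2)) (2 / (s - c)).
Proof.
move=> sc; have sc0 : s - c != 0 by rewrite subr_eq0.
have D : is_derive s 1 (fun s => (s - c) ^+ 2) (2 * (s - c)).
  apply: is_derive_eq (is_derive_mul (is_derive_sub (is_derive_id1 s) (is_derive_cst1 c s))
   (is_derive_sub (is_derive_id1 s) (is_derive_cst1 c s))) _; ring.
apply: is_derive_eq (is_derive_ln (f := fun s => (s - c) ^+ 2) (sub_sqr_gt0 sc) D) _.
by field.
Qed.

Lemma measurable_lnsq c : measurable_fun setT (fun s => ln ((s - c) ^+ 2)).
Proof.
have mln : measurable_fun setT (@ln R) by [].
apply: (measurableT_comp mln).
apply: open_continuous_measurable_fun; first exact: openT.
move=> s _; rewrite /GRing.exp /=.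
by apply: cvgM; apply: cvgB; by [exact: cvg_id|exact: cvg_cst].
Qed.

(** Monotone convergence along closed segments exhausting the open interval: on each of them the
    integral is an increment of [W], hence at most [2 B]. *)
Lemma bounded_primitive_integral_lty (g W : R -> R) (a b B : R) : a < b ->
  (forall s, a < s < b -> is_derive s 1 W (g s)) ->
  (forall s, a < s < b -> {for s, continuous g}) ->
  (forall s, a < s < b -> 0 <= g s) ->
  (forall s, a < s < b -> `|W s| <= B) ->
  (\int[mu]_(s in `]a, b[) (g s)%:E < +oo)%E.
Proof.
move=> ab WD gc g0 WB.
(* The shift by 3 gives [d n <= (b - a) / 3], so that no segment is degenerate. *)
pose d n : R := (b - a) / (n + 3)%:R.
have d3 n : 0 < d n /\ d n <= (b - a) / 3.
  have ba : 0 < b - a by rewrite subr_gt0.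
  split; first by rewrite divr_gt0// ltr0n addn3.
  by rewrite /d ler_wpM2l ?(ltW ba)// lef_pV2 ?posrE ?ltr0n ?addn3// ler_nat.
pose F n := `[a + d n, b - d n]%classic.
have Fsub n s : F n s -> a < s < b.
  by rewrite /F /= in_itv/= => /andP[? ?]; have [? ?] := d3 n; lra.
have FE : \bigcup_n F n = `]a, b[%classic.
  apply/seteqP; split=> [s [n _ /Fsub]|s]; rewrite /= in_itv//= => /andP[as_ sb].
  pose m := Num.min (s - a) (b - s).
  have m0 : 0 < m by rewrite lt_min !subr_gt0 as_.
  have [ma mb] : m <= s - a /\ m <= b - s by rewrite !ge_min !lexx orbT.
  pose n := Num.bound ((b - a) / m).
  have ba : 0 < b - a by rewrite subr_gt0; exact: lt_trans sb.
  have nP : (b - a) / m < n%:R by apply: archi_boundP; rewrite divr_ge0 ?ltW.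
  exists n => //; have dm : d n <= m.
    rewrite /d ler_pdivrMr ?ltr0n ?addn3// mulrC -ler_pdivrMr//.
    by apply: (le_trans (ltW nP)); rewrite ler_nat -addn3 leq_addr.
  by rewrite /F /= in_itv/=; apply/andP; split; lra.
have nd : {homo F : n m / (n <= m)%N >-> (n <= m)%O}.
  move=> n m nm; apply/subsetPset => s; rewrite /F /= !in_itv/= => /andP[? ?].
  have : d m <= d n.
    rewrite /d ler_wpM2l ?subr_ge0 ?(ltW ab)// lef_pV2 ?posrE ?ltr0n ?addn3//.
    by rewrite ler_nat !ltnS.
  by move=> ?; apply/andP; split; lra.
have mF n : measurable (F n) by rewrite /F; exact: measurable_itv.
have mab : measurable_fun `]a, b[ g.
  apply: open_continuous_measurable_fun; first exact: interval_open.
  by move=> s; rewrite inE /= in_itv/=; exact: gc.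
have mg n : measurable_fun (F n) (EFin \o g).
  apply/measurable_EFinP; apply: measurable_funS mab => //.
  by move=> s /Fsub; rewrite /= in_itv.
have := ge0_nondecreasing_set_cvg_integral (mu := mu) nd mF mg _.
rewrite FE => /(_ _)/wrap[|cv].
  by move=> n s /Fsub sab; rewrite lee_fin; exact: g0.
apply: (@le_lt_trans _ _ (2 * B)%:E); last by rewrite ltry.
apply: (cvge_to_le cv); exists 0%N => // n _ /=.
have [dn0 dn1] := d3 n.
have ln : a + d n < b - d n by lra.
have gF : {within F n, continuous g}.
  by apply: continuous_in_subspaceT => s; rewrite inE => /Fsub; exact: gc.
rewrite (continuous_FTC2 (F := W) ln gF).
- have w1 : `|W (b - d n)| <= B by apply: WB; apply/andP; split; lra.
  have w2 : `|W (a + d n)| <= B by apply: WB; apply/andP; split; lra.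
  move: w1 w2; rewrite !ler_norml => /andP[? ?] /andP[? ?].
  by rewrite -EFinB lee_fin; lra.
- split.
  + move=> s; rewrite in_itv/= => /andP[? ?].
    by have [|//] := WD s _; apply/andP; split; lra.
  + apply: cvg_at_right_filter; apply: is_derive_continuous (WD _ _).
    by apply/andP; split; lra.
  + apply: cvg_at_left_filter; apply: is_derive_continuous (WD _ _).
    by apply/andP; split; lra.
- move=> s; rewrite in_itv/= => /andP[? ?]; rewrite derive1E.
  by have [|_ ->//] := WD s _; apply/andP; split; lra.
Qed.



Lemma lnsq_primitive_continuous (k c : R) :
  continuous (fun s => k * s - (s - c) * ln ((s - c) ^+ 2)).
Proof.
move=> s; apply: cvgB; first by apply: cvgM; [exact: cvg_cst|exact: cvg_id].
have [->|sc] := eqVneq s c.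
  have E : (c - c) * ln ((c - c) ^+ 2) = 0 by rewrite subrr mul0r.
  by rewrite /continuous_at E; exact: cvg_mul_lnsq.
apply: cvgM; first by apply: cvgB; [exact: cvg_id|exact: cvg_cst].
exact: is_derive_continuous (is_derive_lnsq sc).
Qed.

(** On each side of [c], the absolute value of the logarithm is dominated by the nonnegative
    [g = K - L + |K|], where [K] bounds [L] from above. The explicit primitive [W] of [g] extends
    continuously through [c], hence is bounded. *)
Lemma lnsq_integrable c a b : mu.-integrable `[a, b] (EFin \o (fun s => ln ((s - c) ^+ 2))).
Proof.
pose L s := ln ((s - c) ^+ 2).
have mL : measurable_fun setT L := measurable_lnsq c.
(* [[c - N, c + N]] contains [[a, b]] and is cut at [c] into two nondegenerate halves. *)
pose N := `|a - c| + `|b - c| + 1.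
have N0 : 1 <= N by rewrite lerDr addr_ge0.
pose K := ln (N ^+ 2).
pose g s := K - L s + `|K|.
pose W s := (K + `|K| + 2) * s - (s - c) * L s.
have WD s : s != c -> is_derive s 1 W (g s).
  move=> sc; have sc0 : s - c != 0 by rewrite subr_eq0.
  apply: is_derive_eq (is_derive_sub (is_derive_mull _ _) (is_derive_mul
    (is_derive_sub (is_derive_id1 s) (is_derive_cst1 c s)) (is_derive_lnsq sc))) _.
  by rewrite /g -/(L s) mulrCA divff//; ring.
have gc s : s != c -> {for s, continuous g}.
  move=> sc; apply: cvgD; last exact: cvg_cst.
  apply: cvgB; [exact: cvg_cst|exact: is_derive_continuous (is_derive_lnsq sc)].
have LK s : s != c -> c - N < s < c + N -> L s <= K.
  move=> sc /andP[? ?]; rewrite /L /K ler_ln ?posrE ?sub_sqr_gt0 ?exprn_gt0//; last lra.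
  rewrite -(real_normK (num_real (s - c))) ler_pXn2r// ?nnegrE//; last lra.
  by rewrite ler_norml; apply/andP; split; lra.
have [B WB] := continuous_bounded_box (K := fun=> W) 0 0 (c - N) (c + N)
  (continuous_snd2 (@lnsq_primitive_continuous _ c)).
have half (u v : R) : u < v -> c - N <= u -> v <= c + N -> (v <= c \/ c <= u) ->
    (\int[mu]_(s in `]u, v[) `|(L s)%:E| < +oo)%E.
  move=> uv cu vc out.
  have ne s : u < s < v -> s != c.
    by move=> /andP[? ?]; case: out => ?; [rewrite lt_eqF|rewrite gt_eqF]; lra.
  apply: (@le_lt_trans _ _ (\int[mu]_(s in `]u, v[) (g s)%:E)%E); last first.
    have h1 s : u < s < v -> is_derive s 1 W (g s) by move=> suv; apply: WD; exact: ne.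
    have h2 s : u < s < v -> {for s, continuous g} by move=> suv; apply: gc; exact: ne.
    have h3 s : u < s < v -> 0 <= g s.
      move=> suv; have sc := ne s suv.
      have : L s <= K by apply: LK => //; lra.
      by rewrite /g; have := normr_ge0 K; lra.
    have h4 s : u < s < v -> `|W s| <= B.
      by move=> suv; apply: (WB 0); rewrite ?lexx//; lra.
    exact: bounded_primitive_integral_lty uv h1 h2 h3 h4.
  apply: ge0_le_integral => //.
  - by apply/measurable_EFinP; apply: measurableT_comp => //; apply: measurable_funTS.
  - apply/measurable_EFinP; apply: measurable_funTS.
    by apply: measurable_funD => //; apply: measurable_funB.
  - move=> s; rewrite /= in_itv/= => suv; rewrite lee_fin /g.
    have sc := ne s suv.
    have : L s <= K by apply: LK => //; lra.
    have := ler_norm K; have := ler_norm (- K); rewrite normrN => ? ? ?.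
    by rewrite ler_norml; apply/andP; split; lra.
apply: (@integrableS _ _ _ mu `[c - N, c + N]%classic) => //.
  apply: subset_itv; rewrite bnd_simp /N.
    by have := ler_norm (- (a - c)); rewrite normrN; have := normr_ge0 (b - c); lra.
  by have := ler_norm (b - c); have := normr_ge0 (a - c); lra.
have mA (A : set R) : measurable_fun A (fun s => `|(L s)%:E|%E).
  by apply: measurable_funTS; apply/measurable_EFinP; apply: measurableT_comp.
apply/integrableP; split; first by apply/measurable_EFinP; exact: measurable_funTS.
have E : `[c - N, c + N]%classic = `[c - N, c]%classic `|` `]c, c + N]%classic.
  by rewrite -itv_bndbnd_setU// bnd_simp; lra.
rewrite E ge0_integral_setU//=.
- rewrite lte_add_pinfty//.
    rewrite -integral_itv_bndo_bndc; last exact: mA.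
    rewrite -integral_itv_obnd_cbnd; last exact: mA.
    by apply: half; [lra|lra|lra|left].
  rewrite -integral_itv_bndo_bndc; last exact: mA.
  by apply: half; [lra|lra|lra|right].
- exact: mA.
- apply/disj_set2P; rewrite -subset0 => z/=; rewrite !in_itv/= => -[/andP[_]].
  by rewrite leNgt => /negbTE ->.
Qed.

Lemma integrable_addR (A : set R) f g : measurable A -> mu.-integrable A (EFin \o f) ->
  mu.-integrable A (EFin \o g) -> mu.-integrable A (EFin \o (fun s => f s + g s)).
Proof.
move=> mA fi gi.
have -> : EFin \o (fun s => f s + g s) = ((EFin \o f) \+ (EFin \o g))%E by [].
exact: integrableD.
Qed.

Lemma integrable_normR (A : set R) f : measurable A -> mu.-integrable A (EFin \o f) ->
  mu.-integrable A (EFin \o (fun s => `|f s|)).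
Proof. by move=> mA fi; exact: (integrable_norm fi). Qed.

Lemma log_singular_integrable t f : 0 <= t <= 2 * pi ->
  (forall s, ~ eqmod2pi s t -> {for s, continuous f}) ->
  (forall s0, eqmod2pi s0 t -> exists C, \forall s \near s0^',
     `|f s| <= C * (1 + `|ln ((s - s0) ^+ 2)|)) ->
  mu.-integrable `[0, 2 * pi] (EFin \o f).
Proof.
move=> /andP[t0 t1] fc fs.
have p20 := @pi2_gt0 R.
pose l c s := ln ((s - c) ^+ 2) : R.
(* In [[0, 2 pi]] the only possible points congruent to [t] are [t] and [t +- 2 pi], the latter when
   [t] is an endpoint. One weight covers all of these cases. *)
pose w s := 1 + `|l t s| + `|l (t - 2 * pi) s| + `|l (t + 2 * pi) s|.
have w1 s : 1 <= w s by rewrite /w -!addrA lerDl !addr_ge0.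
have wl s s0 : 0 <= s0 <= 2 * pi -> eqmod2pi s0 t -> 1 + `|l s0 s| <= w s.
  move=> /andP[s00 s01] e.
  have := normr_ge0 (l t s); have := normr_ge0 (l (t - 2 * pi) s).
  have := normr_ge0 (l (t + 2 * pi) s); rewrite /w => ? ? ?.
  have [lt2|] := ltP `|s0 - t| (2 * pi).
    by rewrite (eqmod2pi_near e lt2); lra.
  rewrite ler_normr => /orP[h|h].
    have -> : s0 = t + 2 * pi by lra.
    lra.
  have -> : s0 = t - 2 * pi by lra.
  lra.
have wi : mu.-integrable `[0, 2 * pi] (EFin \o w).
  do 3 (apply: integrable_addR => //; last by apply: integrable_normR => //; exact: lnsq_integrable).
  by apply: continuous_integrable => ?; exact: cvg_cst.
have loc s0 : 0 <= s0 <= 2 * pi -> exists C, \forall s \near s0, `|f s| <= C * w s.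
  move=> s0i; have [e|ne] := pselect (eqmod2pi s0 t); last first.
    exists (`|f s0| + 1).
    have fc' : (fun s => `|f s|) @ s0 --> `|f s0| by apply: cvg_norm; exact: fc.
    near=> s; apply: (@le_trans _ _ (`|f s0| + 1)).
      by apply: ltW; near: s; apply: (cvgr_lt _ fc'); rewrite ltrDl.
    by rewrite ler_peMr ?addr_ge0.
  have [C HC] := fs s0 e; rewrite near_withinE in HC.
  exists (`|C| + `|f s0|); apply: filterS HC => s Hs.
  have w0 : 0 <= w s by apply: le_trans (w1 s).
  have [->|/Hs H] := eqVneq s s0.
    apply: (@le_trans _ _ ((`|C| + `|f s0|) * 1)); first by rewrite mulr1 lerDr.
    by apply: ler_wpM2l => //; rewrite addr_ge0.
  apply: (le_trans H); apply: (@le_trans _ _ (`|C| * (1 + `|l s0 s|))).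
    by apply: ler_wpM2r; [rewrite addr_ge0|exact: ler_norm].
  apply: (@le_trans _ _ (`|C| * w s)); first by apply: ler_wpM2l => //; exact: wl.
  by rewrite ler_wpM2r// lerDl.
have [C HC] := local_to_segment_bound (fun s => le_trans ler01 (w1 s)) loc.
have Cwi : mu.-integrable `[0, 2 * pi] (EFin \o (fun s => C * w s)).
  have -> : EFin \o (fun s => C * w s) = (fun s => C%:E * (EFin \o w) s)%E by [].
  exact: integrableZl.
apply: (le_integrable _ _ _ Cwi) => //; last first.
  move=> s; rewrite /= in_itv/= => si; rewrite lee_fin.
  by apply: le_trans (HC s si) _; exact: ler_norm.
apply/measurable_EFinP.
(* [f] is continuous on the open set [O], and adjoining three singletons covers the segment; this
   gives measurability whatever the values of [f] at the singular points. *)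
pose O := [set s | ~ eqmod2pi s t].
have oO : open O by rewrite openE => s; exact: eqmod2pi_near_neq.
have mO : measurable_fun O f.
  by apply: open_continuous_measurable_fun => // s; rewrite inE; exact: fc.
pose A := (((O `|` [set t]) `|` [set (t - 2 * pi)]) `|` [set (t + 2 * pi)]).
have mOs : measurable O by exact: open_measurable.
have mO1 : measurable (O `|` [set t]) by exact: measurableU.
have mO2 : measurable (O `|` [set t] `|` [set (t - 2 * pi)]) by exact: measurableU.
have mA : measurable A by exact: measurableU.
apply: (@measurable_funS _ _ _ _ A) => //.
  move=> s; rewrite /= in_itv/= => /andP[s0 s1].
  have [e|ne] := pselect (eqmod2pi s t); last by left; left; left.
  have [lt2|] := ltP `|s - t| (2 * pi).
    by left; left; right; exact: eqmod2pi_near e lt2.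
  rewrite ler_normr => /orP[h|h]; first by right => /=; lra.
  by left; right => /=; lra.
have f1 : measurable_fun (O `|` [set t]) f.
  by apply/measurable_funU => //; split=> //; exact: measurable_fun_set1.
have f2 : measurable_fun (O `|` [set t] `|` [set (t - 2 * pi)]) f.
  by apply/measurable_funU => //; split=> //; exact: measurable_fun_set1.
by apply/measurable_funU => //; split=> //; exact: measurable_fun_set1.
Unshelve. all: by end_near. Qed.

(** The equation is imposed only off [t], so a value or a derivative at [t] itself has to be
    established separately. *)
Definition log_singular (k : nat) t f : Prop :=
  exists E1 E2 : R -> R, [/\ analytic_at E1 t, analytic_at E2 t &
    \forall s \near t^', f s = (s - t) ^+ k * (E1 s * ln ((s - t) ^+ 2) + E2 s)].

Lemma is_derive_expS (k : nat) t s :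
  is_derive s 1 (fun s => (s - t) ^+ k.+1) (k.+1%:R * (s - t) ^+ k).
Proof.
have D1 : is_derive s 1 (fun s => s - t) 1.
  by apply: is_derive_eq (is_derive_sub (is_derive_id1 s) (is_derive_cst1 t s)) _; rewrite subr0.
elim: k => [|k IH]; first by rewrite expr0 mulr1.
have -> : (fun s => (s - t) ^+ k.+2) = (fun s => (s - t) * (s - t) ^+ k.+1).
  by apply/funext => u; rewrite exprS.
apply: is_derive_eq (is_derive_mul D1 IH) _.
by rewrite -[in RHS]natr1 exprS; ring.
Qed.

Lemma analytic_at_is_derive1 f t : analytic_at f t ->
  \forall s \near t, is_derive (s : R) 1 f (derive1 f s).
Proof.
by move=> /analytic_at_derivable; apply: filterS => s fd; split=> //; rewrite derive1E.
Qed.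

(** The derivative [2 / (s - t)] of the logarithm uses up one power of [s - t]; its contribution
    [2 * E1] joins the analytic part. *)
Lemma log_singular_derive1 k t f : log_singular k.+1 t f -> log_singular k t (derive1 f).
Proof.
move=> [E1 [E2 [A1 A2 fE]]].
exists (fun s => k.+1%:R * E1 s + (s - t) * derive1 E1 s).
exists (fun s => k.+1%:R * E2 s + 2 * E1 s + (s - t) * derive1 E2 s).
have Aid : analytic_at (fun s => s - t) t.
  by apply: analytic_atB; [exact: analytic_at_id|exact: analytic_at_cst].
have Ac (b : R) : analytic_at (fun=> b) t := analytic_at_cst b t.
split.
- apply: analytic_atD; apply: analytic_atM => //; exact: analytic_at_derive1.
- apply: analytic_atD; last by apply: analytic_atM => //; exact: analytic_at_derive1.
  by apply: analytic_atD; apply: analytic_atM.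
have D1 := analytic_at_is_derive1 A1; have D2 := analytic_at_is_derive1 A2.
(* Differentiating at a nearby [s] needs the formula on a whole neighbourhood of [s]. *)
move: fE; rewrite !near_withinE => /near_join fE.
near=> s => st.
have d1 : is_derive s 1 E1 (derive1 E1 s) by near: s.
have d2 : is_derive s 1 E2 (derive1 E2 s) by near: s.
have fs : \forall u \near s, u != t -> f u = (u - t) ^+ k.+1 * (E1 u * ln ((u - t) ^+ 2) + E2 u).
  by near: s.
have un : \forall u \near s, u != t.
  have := norm_sub_lt_near s (_ : 0 < `|s - t|); rewrite normr_gt0 subr_eq0 => /(_ st).
  by apply: filterS => u; apply: contraTN => /eqP ->; rewrite distrC ltxx.
have st0 : s - t != 0 by rewrite subr_eq0.
have D := is_derive_mul (is_derive_expS k t s)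
  (is_derive_add (is_derive_mul d1 (is_derive_lnsq st)) d2).
have eqf : \forall u \near s, f u = (u - t) ^+ k.+1 * (E1 u * ln ((u - t) ^+ 2) + E2 u).
  by apply: filterS2 un fs => u ut; apply.
rewrite derive1E (near_eq_derive _ eqf).
apply: etrans (@derive_val _ _ _ _ _ _ _ D) _.
rewrite (exprS _ k); move: (ln _) (_ ^+ k) => l p.
by field.
Unshelve. all: by end_near. Qed.

Lemma log_singular_cvg0 k t f : log_singular k.+1 t f -> f s @[s --> t^'] --> 0.
Proof.
move=> [E1 [E2 [A1 A2 fE]]].
have H : (fun s => (s - t) ^+ k * (E1 s * ((s - t) * ln ((s - t) ^+ 2)) + (s - t) * E2 s)) @ t^' --> 0.
  apply: cvg_within_filter.
  have c1 : (fun s => s - t) @ t --> 0.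
    by rewrite -(subrr t); apply: cvgB; [exact: cvg_id|exact: cvg_cst].
  have ck : (fun s => (s - t) ^+ k) @ t --> (t - t) ^+ k.
    apply: (@analytic_at_continuous _ (fun s => (s - t) ^+ k)); apply: analytic_atX.
    by apply: analytic_atB; [exact: analytic_at_id|exact: analytic_at_cst].
  have E0 : 0 = (t - t) ^+ k * (E1 t * 0 + 0 * E2 t) by rewrite mulr0 mul0r addr0 mulr0.
  suff H : (fun s => (s - t) ^+ k * (E1 s * ((s - t) * ln ((s - t) ^+ 2)) + (s - t) * E2 s)) @ t
    --> (t - t) ^+ k * (E1 t * 0 + 0 * E2 t) by rewrite -E0 in H.
  apply: cvgM => //; apply: cvgD; apply: cvgM => //.
  - exact: analytic_at_continuous.
  - exact: cvg_mul_lnsq.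
  - exact: analytic_at_continuous.
apply: cvg_trans H; apply: near_eq_cvg; apply: filterS fE => s ->.
by rewrite (exprSr _ k); move: (ln _) (_ ^+ k) => l p; ring.
Qed.

(** As [f t = 0], the difference quotient is [f s / (s - t)], again log-singular with a positive
    exponent, so it tends to 0. *)
Lemma log_singular_is_derive0 k t f : log_singular k.+2 t f -> f t = 0 -> is_derive t 1 f 0.
Proof.
move=> [E1 [E2 [A1 A2 fE]]] ft; apply: cvg_is_derive.
have H : log_singular k.+1 t (fun s => (s - t)^-1 * f s).
  exists E1, E2; split=> //; move: fE; rewrite !near_withinE; apply: filterS => s H st.
  by rewrite H// exprS !mulrA mulVf ?mul1r// subr_eq0.
have := log_singular_cvg0 H => /cvgrPdist_lt H0; apply/cvgrPdist_lt => e /H0.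
rewrite !near_withinE => /nbhs_ballP[d /= d0 Hd]; apply/nbhs_ballP; exists d => //= h hd h0.
have := Hd (h + t); rewrite ft subr0 addrK; apply.
  by move: hd; rewrite /ball/= sub0r opprD addrCA subrr addr0.
by rewrite -subr_eq0 addrK.
Qed.

Lemma log_singular_bound t f : log_singular 0 t f ->
  exists C, \forall s \near t^', `|f s| <= C * (1 + `|ln ((s - t) ^+ 2)|).
Proof.
move=> [E1 [E2 [A1 A2 fE]]].
have b (E : R -> R) : analytic_at E t -> \forall s \near t, `|E s| <= `|E t| + 1.
  move=> /analytic_at_continuous Ec.
  have Ec' : (fun s => `|E s|) @ t --> `|E t| by apply: cvg_norm.
  near=> s; apply: ltW; near: s; apply: (cvgr_lt _ Ec'); by rewrite ltrDl.
exists (`|E1 t| + 1 + (`|E2 t| + 1)); move: fE; rewrite !near_withinE => fE.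
near=> s => st.
have -> : f s = (s - t) ^+ 0 * (E1 s * ln ((s - t) ^+ 2) + E2 s).
  by move: st; near: s.
have b1 : `|E1 s| <= `|E1 t| + 1 by near: s; exact: b.
have b2 : `|E2 s| <= `|E2 t| + 1 by near: s; exact: b.
rewrite expr0 mul1r; apply: le_trans (ler_normD _ _) _; rewrite normrM.
set l := `|ln _|; have l0 : 0 <= l by exact: normr_ge0.
have h1 : `|E1 s| * l <= (`|E1 t| + 1) * l by exact: ler_wpM2r.
have h2 : 0 <= (`|E2 t| + 1) * l by rewrite mulr_ge0// addr_ge0.
have := normr_ge0 (E1 t); lra.
Unshelve. all: by end_near. Qed.

Lemma log_singular_derive1n k t f n : log_singular (n + k) t f -> log_singular k t (derive1n n f).
Proof.
elim: n k => // n IH k; rewrite addSnnS => H.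
by rewrite derive1nS; apply: log_singular_derive1; exact: IH.
Qed.

End LogSingularities.

(** * Green's identity along a curve *)

Section Flux.
Variable R : realType.
Local Notation mu := (@lebesgue_measure R).
Variables (u g1 g2 g11 g12 : R * R -> R) (p : R * R).
Implicit Types (f : R * R -> R) (tau s : R).
Hypotheses (uP : has_partials u g1 g2) (g1P : has_partials g1 g11 g12)
  (g2P : has_partials g2 g12 (fun p => - g11 p)).

Section FluxCurve.
(** The displacement is left abstract so that the results also apply to the dilated curves [p + s D]
    in [Rintegral_mean_flux]. *)
Variables (D1 D2 d1 d2 : R -> R).
Hypotheses (D1D : forall s : R, is_derive s 1 D1 (d1 s)) (D2D : forall s : R, is_derive s 1 D2 (d2 s))
  (d1c : continuous d1) (d2c : continuous d2).

Definition along (f : R * R -> R) (tau s : R) : R := f (p.1 + s * D1 tau, p.2 + s * D2 tau).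

(** Flux of the gradient across the segment from [p] to [p + D], that is, the increment of a
    harmonic conjugate along it. *)
Definition flux (tau : R) : R :=
  \int[mu]_(s in `[0, 1]) (along g1 tau s * D2 tau - along g2 tau s * D1 tau).

Definition mean_flux (tau : R) : R :=
  \int[mu]_(s in `[0, 1]) (along g1 tau s * d2 tau - along g2 tau s * d1 tau).

Let D1c : continuous D1. Proof. by move=> s; exact: is_derive_continuous (D1D s). Qed.
Let D2c : continuous D2. Proof. by move=> s; exact: is_derive_continuous (D2D s). Qed.

Lemma along_continuous2 f : continuous f -> continuous (fun q : R * R => along f q.1 q.2).
Proof.
move=> fc q; apply: (@continuous_comp _ _ _ (fun q : R * R => (p.1 + q.2 * D1 q.1, p.2 + q.2 * D2 q.1)) f).
  by apply: continuous_pair; apply: cvgD; try exact: cvg_cst;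
    apply: cvgM; try exact: cvg_snd; exact: continuous_fst2.
exact: fc.
Qed.

Lemma along_continuous f tau : continuous f -> continuous (along f tau).
Proof. by move=> fc; exact: (continuous_section1 (along_continuous2 fc)). Qed.

Lemma along_derive1 f (f1 f2 : R * R -> R) tau s : has_partials f f1 f2 ->
  is_derive tau 1 (along f ^~ s)
    (along f1 tau s * (s * d1 tau) + along f2 tau s * (s * d2 tau)).
Proof.
move=> fP; apply: (chain_rule2 (c1 := fun tau => p.1 + s * D1 tau) (c2 := fun tau => p.2 + s * D2 tau) fP).
- apply: is_derive_eq (is_derive_add (is_derive_cst1 _ _) (is_derive_mul (is_derive_cst1 s _) (D1D tau))) _.
  by ring.
- apply: is_derive_eq (is_derive_add (is_derive_cst1 _ _) (is_derive_mul (is_derive_cst1 s _) (D2D tau))) _.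
  by ring.
Qed.

Lemma along_derive2 f (f1 f2 : R * R -> R) tau s : has_partials f f1 f2 ->
  is_derive s 1 (along f tau) (along f1 tau s * D1 tau + along f2 tau s * D2 tau).
Proof.
move=> fP; apply: (chain_rule2 (c1 := fun s => p.1 + s * D1 tau) (c2 := fun s => p.2 + s * D2 tau) fP).
- apply: is_derive_eq (is_derive_add (is_derive_cst1 _ _) (is_derive_mul (is_derive_id1 s) (is_derive_cst1 (D1 tau) s))) _.
  by ring.
- apply: is_derive_eq (is_derive_add (is_derive_cst1 _ _) (is_derive_mul (is_derive_id1 s) (is_derive_cst1 (D2 tau) s))) _.
  by ring.
Qed.

Lemma continuous_flux_form (a b : R -> R) tau :
  continuous (fun s => along g1 tau s * a tau - along g2 tau s * b tau).
Proof.
case: g1P => _ _ g11c g12c; case: uP => _ _ g1c g2c s.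
by apply: cvgB; apply: cvgM; try exact: cvg_cst; exact: along_continuous.
Qed.

Lemma continuous_flux_form2 (a b : R -> R) : continuous a -> continuous b ->
  continuous (fun q : R * R => along g1 q.1 q.2 * a q.1 - along g2 q.1 q.2 * b q.1).
Proof.
case: uP => _ _ g1c g2c ac bc s.
by apply: cvgB; apply: cvgM; try exact: along_continuous2; exact: continuous_fst2.
Qed.

(* Differentiating under the integral, the trace-free Hessian turns the
   integrand into the exact derivative [d/ds (s * (grad u x c'))]. *)
Lemma is_derive_flux (tau : R) :
  is_derive tau 1 flux (along g1 tau 1 * d2 tau - along g2 tau 1 * d1 tau).
Proof.
have [_ _ g1c g2c] := uP; have [_ _ g11c g12c] := g1P.
pose dK tau s := ((along g11 tau s * (s * d1 tau) + along g12 tau s * (s * d2 tau)) * D2 tau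
   + along g1 tau s * d2 tau) -
  ((along g12 tau s * (s * d1 tau) + along (fun p => - g11 p) tau s * (s * d2 tau)) * D1 tau
   + along g2 tau s * d1 tau).
have c1 (f : R -> R) : continuous f -> continuous (fun q : R * R => f q.1) := @continuous_fst2 R f.
have cs (q : R * R) : {for q, continuous (fun q : R * R => q.2)} by exact: cvg_snd.
have dKc : continuous (fun q : R * R => dK q.1 q.2).
  have g11Nc : continuous (fun p => - g11 p) by move=> q; apply: cvgN; exact: g11c.
  move=> q; apply: cvgB; apply: cvgD; apply: cvgM; try exact: c1; try exact: along_continuous2;
    apply: cvgD; apply: cvgM; try exact: along_continuous2; apply: cvgM; try exact: c1; exact: cs.
have KD (tau' s : R) : tau - 1 < tau' < tau + 1 ->
    is_derive tau' 1 (fun tau => along g1 tau s * D2 tau - along g2 tau s * D1 tau) (dK tau' s).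
  move=> _; exact: is_derive_sub (is_derive_mul (along_derive1 _ _ g1P) (D2D _))
    (is_derive_mul (along_derive1 _ _ g2P) (D1D _)).
have tau1 : tau - 1 < tau < tau + 1 by lra.
have := is_derive_under_integral 0 1 (@continuous_flux_form D2 D1) dKc KD tau1.
suff -> : \int[mu]_(s in `[0, 1]) dK tau s = along g1 tau 1 * d2 tau - along g2 tau 1 * d1 tau by [].
have FD (s : R) : is_derive s 1 (fun s => s * (along g1 tau s * d2 tau - along g2 tau s * d1 tau)) (dK tau s).
  have A1 := is_derive_mul (along_derive2 tau s g1P) (is_derive_cst1 (d2 tau) s).
  have A2 := is_derive_mul (along_derive2 tau s g2P) (is_derive_cst1 (d1 tau) s).
  apply: is_derive_eq (is_derive_mul (is_derive_id1 s) (is_derive_sub A1 A2)) _.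
  by rewrite /dK /along; ring.
by rewrite (FTC2_continuous ler01 (continuous_section1 dKc) FD); ring.
Qed.

Lemma flux0 tau : D1 tau = 0 -> D2 tau = 0 -> flux tau = 0.
Proof.
move=> e1 e2; rewrite -[RHS](mul0r (1 - 0)) -Rintegral_cst_itv//.
by apply: eq_Rintegral => s _; rewrite e1 e2 !mulr0 subrr.
Qed.

Lemma ray_increment tau : along u tau 1 - u p =
  \int[mu]_(s in `[0, 1]) (along g1 tau s * D1 tau + along g2 tau s * D2 tau).
Proof.
have [_ _ g1c g2c] := uP.
rewrite (FTC2_continuous ler01 _ (fun s => along_derive2 tau s uP)).
  by rewrite /along !mul0r !addr0 -surjective_pairing.
by move=> s; apply: cvgD; apply: cvgM; try exact: cvg_cst; exact: along_continuous.
Qed.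

(* [(g . D) (D x d) + (g x D) (D . d) = |D|^2 (g x d)], averaged over the ray. *)
Lemma ray_flux_identity tau :
  (along u tau 1 - u p) * (D1 tau * d2 tau - D2 tau * d1 tau) +
  flux tau * (D1 tau * d1 tau + D2 tau * d2 tau) =
  (D1 tau * D1 tau + D2 tau * D2 tau) * mean_flux tau.
Proof.
have [_ _ g1c g2c] := uP.
have cg : continuous (along g1 tau) by exact: along_continuous.
have cg' : continuous (along g2 tau) by exact: along_continuous.
rewrite ray_increment ![_ * (D1 tau * _ - _)]mulrC ![flux _ * _]mulrC.
rewrite -!continuous_RintegralZ; last 3 first.
- exact: continuous_flux_form.
- exact: continuous_flux_form.
- by move=> s; apply: cvgD; apply: cvgM; try exact: cvg_cst; [exact: cg|exact: cg'].
rewrite -continuous_RintegralD; last 2 first.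
- move=> s; apply: cvgM; first exact: cvg_cst.
  by apply: cvgD; apply: cvgM; try exact: cvg_cst; [exact: cg|exact: cg'].
- by move=> s; apply: cvgM; [exact: cvg_cst|exact: continuous_flux_form].
by apply: eq_Rintegral => s _; ring.
Qed.

Lemma mean_flux_continuous : continuous mean_flux.
Proof. have Kc := continuous_flux_form2 d2c d1c.
have H := @continuous_under_integral R (fun tau s => along g1 tau s * d2 tau - along g2 tau s * d1 tau) 0 1 Kc. exact H. Qed.

(** [flux] is a primitive of the integrand and depends on the parameter only through the
    displacement, so it closes up with the curve. *)
Lemma Rintegral_flux_form a b : a <= b -> D1 a = D1 b -> D2 a = D2 b ->
  \int[mu]_(tau in `[a, b]) (along g1 tau 1 * d2 tau - along g2 tau 1 * d1 tau) = 0.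
Proof.
move=> ab e1 e2.
have fc : continuous (fun tau => along g1 tau 1 * d2 tau - along g2 tau 1 * d1 tau).
  have Kc := continuous_flux_form2 d2c d1c.
  have H := @continuous_section2 R (fun tau s => along g1 tau s * d2 tau - along g2 tau s * d1 tau) 1 Kc. exact H.
rewrite (FTC2_continuous ab fc is_derive_flux).
by rewrite /flux /along e1 e2 subrr.
Qed.

End FluxCurve.

(** After exchanging the integrals, [s] times the inner one is the total flux across the closed
    curve [p + s D], which is 0. *)
Lemma Rintegral_mean_flux (D1 D2 d1 d2 : R -> R) (a b : R) :
  (forall s : R, is_derive s 1 D1 (d1 s)) -> (forall s : R, is_derive s 1 D2 (d2 s)) ->
  continuous d1 -> continuous d2 -> a <= b -> D1 a = D1 b -> D2 a = D2 b ->
  \int[mu]_(tau in `[a, b]) mean_flux D1 D2 d1 d2 tau = 0.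
Proof.
move=> D1D D2D d1c d2c ab e1 e2; have [_ _ g1c g2c] := uP.
have D1c : continuous D1 by move=> s; exact: is_derive_continuous (D1D s).
have D2c : continuous D2 by move=> s; exact: is_derive_continuous (D2D s).
have Kc : continuous (fun q : R * R => along D1 D2 g1 q.2 q.1 * d2 q.2 - along D1 D2 g2 q.2 q.1 * d1 q.2).
  move=> q; apply: (@continuous_comp _ _ _ (fun q : R * R => (q.2, q.1))
    (fun q : R * R => along D1 D2 g1 q.1 q.2 * d2 q.1 - along D1 D2 g2 q.1 q.2 * d1 q.1)).
    by apply: continuous_pair; [exact: cvg_snd|exact: cvg_fst].
  exact: continuous_flux_form2.
apply: (Rintegral_iterated_eq0 Kc) => s.
have Kcs : continuous (fun tau => along D1 D2 g1 tau s * d2 tau - along D1 D2 g2 tau s * d1 tau).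
  exact: (continuous_section1 (K := fun s tau => along D1 D2 g1 tau s * d2 tau - along D1 D2 g2 tau s * d1 tau) Kc).
have mc (f : R -> R) : continuous f -> continuous (fun tau : R => s * f tau).
  by move=> fc tau; apply: cvgM; [exact: cvg_cst|exact: fc].
(* For [s = 0] the dilated curve is a point and the factor [s] cannot be cancelled; the gradient is
   then frozen at [p] and the integrand is the derivative of a linear function of [D]. *)
have [s0|s0] := eqVneq s 0.
  have E (tau : R) : is_derive tau 1 (fun tau => g1 p * D2 tau - g2 p * D1 tau)
      (along D1 D2 g1 tau s * d2 tau - along D1 D2 g2 tau s * d1 tau).
    apply: is_derive_eq (is_derive_sub (is_derive_mul (is_derive_cst1 (g1 p) _) (D2D tau))
      (is_derive_mul (is_derive_cst1 (g2 p) _) (D1D tau))) _.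
    by rewrite /along s0 !mul0r !addr0 !add0r -surjective_pairing.
  by rewrite (FTC2_continuous ab Kcs E) e1 e2 subrr.
have sD (f f' : R -> R) : (forall tau : R, is_derive tau 1 f (f' tau)) ->
    forall tau : R, is_derive tau 1 (fun tau => s * f tau) (s * f' tau).
  move=> fD tau; apply: is_derive_eq (is_derive_mul (is_derive_cst1 s tau) (fD tau)) _.
  by rewrite mul0r add0r.
have := Rintegral_flux_form (sD _ _ D1D) (sD _ _ D2D) (mc _ d1c) (mc _ d2c) ab.
rewrite e1 e2 => /(_ erefl erefl) H.
apply: (mulfI s0); rewrite mulr0 -[RHS]H -continuous_RintegralZ//.
by apply: eq_Rintegral => tau _; rewrite /along !mul1r; ring.
Qed.

End Flux.

(** * Order of vanishing of analytic and log-singular functions *)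

Section VanishingOrder.
Variable R : realType.
Implicit Types (f g : R -> R) (s t : R).

Lemma derive1n_mulX g t n : analytic_at g t ->
  \forall s \near t, derive1n n.+1 (fun s => (s - t) * g s) s =
    (s - t) * derive1n n.+1 g s + n.+1%:R * derive1n n g s.
Proof.
move=> gA; elim: n => [|n IH].
  have gD := analytic_at_is_derive1 gA.
  near=> s.
  have D : is_derive s 1 g (derive1 g s) by near: s.
  rewrite !derive1n1 derive1n0 derive1E.
  apply: etrans (@derive_val _ _ _ _ _ _ _ (is_derive_mul (is_derive_sub (is_derive_id1 s) (is_derive_cst1 t s)) D)) _.
  by rewrite subr0 !mul1r addrC.
have gD := analytic_at_is_derive1 (analytic_at_derive1n n gA).
have gD' := analytic_at_is_derive1 (analytic_at_derive1n n.+1 gA).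
move/near_join : IH => IH.
near=> s.
have IHs : \forall u \near s, derive1n n.+1 (fun s => (s - t) * g s) u =
  (u - t) * derive1n n.+1 g u + n.+1%:R * derive1n n g u by near: s.
have D : is_derive s 1 (derive1n n g) (derive1n n.+1 g s) by rewrite derive1nS; near: s.
have D' : is_derive s 1 (derive1n n.+1 g) (derive1n n.+2 g s) by rewrite [derive1n n.+2 g]derive1nS; near: s.
rewrite derive1nS derive1E (near_eq_derive _ IHs).
apply: etrans (@derive_val _ _ _ _ _ _ _ (is_derive_add
  (is_derive_mul (is_derive_sub (is_derive_id1 s) (is_derive_cst1 t s)) D')
  (is_derive_mul (is_derive_cst1 n.+1%:R s) D))) _.
by rewrite -[n.+2%:R]natr1; ring.
Unshelve. all: by end_near. Qed.

(** Factors [s - t] are removed one at a time; Leibniz's rule at [t] reads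
    [f^(m+1) = (m + 1) g^(m)], so the quotient inherits one vanishing derivative fewer. *)
Lemma analytic_at_vanish f t M : analytic_at f t ->
  (forall m, (m < M)%N -> derive1n m f t = 0) ->
  exists2 E, analytic_at E t & forall s, f s = (s - t) ^+ M * E s.
Proof.
elim: M f => [|M IH] f fA f0.
  by exists f => // s; rewrite expr0 mul1r.
have [g gA [fE _ _]] := analytic_at_sub_factor fA.
have ft : f t = 0 by exact: (f0 0%N).
have [m mM|E EA gE] := IH g gA.
  have := nbhs_singleton (derive1n_mulX m gA).
  have -> : (fun s => (s - t) * g s) = f by apply/funext => s; rewrite -fE ft subr0.
  rewrite f0// subrr mul0r add0r => /eqP; rewrite eq_sym mulf_eq0 pnatr_eq0 /=.
  by move/eqP.
by exists E => // s; rewrite -[LHS]subr0 -ft fE gE exprS mulrA.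
Qed.

Lemma log_singular_mul k n t f L E : log_singular k t L -> analytic_at E t ->
  (forall s, f s = (s - t) ^+ n * E s * L s) -> log_singular (n + k) t f.
Proof.
move=> [E1 [E2 [A1 A2 LE]]] EA fE; exists (fun s => E s * E1 s), (fun s => E s * E2 s).
split; [exact: analytic_atM|exact: analytic_atM|].
by apply: filterS LE => s Ls; rewrite fE Ls exprD; move: (ln _) => l; ring.
Qed.

Lemma log_singular_continuous k t f : log_singular k.+1 t f -> f t = 0 ->
  {for t, continuous f}.
Proof. by move=> H f0; apply/continuous_withinNx; rewrite f0; exact: log_singular_cvg0 H. Qed.

(** The value 0 at [t] is passed from one derivative to the next. The step from [m] to [m + 1] needs
    exponent [k - m + 1 >= 2], which is why [m] stops at [k]. *)
Lemma derive1n_log_singular0 k t f m : log_singular k.+1 t f -> f t = 0 -> (m <= k)%N ->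
  derive1n m f t = 0.
Proof.
move=> H f0; elim: m => // m IH mk.
have Hm : log_singular (k - m).+1 t (derive1n m f).
  by apply: log_singular_derive1n; rewrite addnS subnKC// ltnW.
rewrite derive1nS derive1E.
have E : (k - m).+1 = ((k - m.+1).+2)%N by rewrite subnSK.
rewrite E in Hm; exact: (@derive_val _ _ _ _ _ _ _ (log_singular_is_derive0 Hm (IH (ltnW mk)))).
Qed.

End VanishingOrder.

(** * Green's identity for the logarithm of the chord *)

Section GreenIdentity.
Variables (R : realType) (x : R -> R * R).
Local Notation mu := (@lebesgue_measure R).
Implicit Types (s tau a : R).
Hypotheses (x1A : forall a, analytic_at (fst \o x) a)
  (x2A : forall a, analytic_at (snd \o x) a)
  (xper : periodic x (2 * pi))
  (xreg : forall t, dcurve x 1 t != (0, 0))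
  (xinj : forall s t, 0 <= s < 2 * pi -> 0 <= t < 2 * pi -> x s = x t -> s = t)
  (xccw : counterclockwise x).
Variables (u : R * R -> R) (t : R).
Hypotheses (uh : harmonic_fun u) (t_itv : 0 <= t <= 2 * pi).

Definition log_dist s : R := ln (dot (x s - x t) (x s - x t)) / 2.

(** The normal derivative times the speed, in which the normalization of the normal cancels. *)
Definition conormal_derivative s : R :=
  'D_(1, 0) u (x s) * (dcurve x 1 s).2 - 'D_(0, 1) u (x s) * (dcurve x 1 s).1.

Lemma ln_enorm (p : R * R) : ln (enorm p) = ln (dot p p) / 2.
Proof.
have [->|p0] := eqVneq p (0, 0).
  by rewrite /enorm /dot /= !mul0r addr0 sqrtr0 ln0 ?mul0r.
have d0 := dot_self_gt0 p0.
have e0 : 0 < enorm p by rewrite sqrtr_gt0.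
by rewrite -sqr_enorm lnXn// -[_ *+ 2]mulr_natr mulfK.
Qed.

Lemma log_dist_periodic : periodic log_dist (2 * pi).
Proof. by move=> s; rewrite /log_dist xper. Qed.

Lemma log_dist_analytic a : ~ eqmod2pi a t -> analytic_at log_dist a.
Proof.
move=> nat_; apply: analytic_atM; last exact: analytic_at_cst.
apply: analytic_at_ln; [exact: (chord_sqr_gt0 xper xinj)|exact: chord_sqr_analytic].
Qed.

Lemma log_dist_singular s0 : eqmod2pi s0 t -> log_singular 0 s0 log_dist.
Proof.
move=> s0t; have [d1 [d2 [d1A d2A E F _]]] := chord_factor x1A x2A s0.
have dA : analytic_at (fun s => d1 s * d1 s + d2 s * d2 s) s0.
  by apply: analytic_atD; apply: analytic_atM.
have d0 : 0 < d1 s0 * d1 s0 + d2 s0 * d2 s0.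
  by have := speed_sqr_gt0 xreg s0; rewrite -F.
exists (fun=> 2^-1), (fun s => ln (d1 s * d1 s + d2 s * d2 s) / 2); split.
- exact: analytic_at_cst.
- by apply: analytic_atM; [exact: analytic_at_ln|exact: analytic_at_cst].
rewrite near_withinE.
have := continuous_gt0_near (analytic_at_continuous dA) d0.
apply: filterS => s ds ss0; rewrite expr0 mul1r /log_dist.
have -> : dot (x s - x t) (x s - x t) = (s - s0) ^+ 2 * (d1 s * d1 s + d2 s * d2 s).
  by rewrite -(curve_eqmod xper s0t) E /dot /=; ring.
rewrite lnM ?posrE//; last exact: sub_sqr_gt0.
by rewrite mulrDl [2^-1 * _]mulrC.
Qed.

Lemma trace_analytic a : analytic_at (u \o x) a.
Proof.
have := harmonic_comp_analytic uh (x1A a) (x2A a).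
have -> // : (fun s => u ((fst \o x) s, (snd \o x) s)) = u \o x.
by apply/funext => s /=; rewrite -surjective_pairing.
Qed.

Lemma conormal_derivative_analytic a : analytic_at conormal_derivative a.
Proof.
have [A1 A2] := harmonic_grad_comp_analytic uh (x1A a) (x2A a).
have E (g : R * R -> R) : (fun s => g ((fst \o x) s, (snd \o x) s)) = g \o x.
  by apply/funext => s /=; rewrite -surjective_pairing.
have {}A1 : analytic_at ('D_(1, 0) u \o x) a by rewrite -E.
have {}A2 : analytic_at ('D_(0, 1) u \o x) a by rewrite -E.
exact: (analytic_atB (analytic_atM A1 (dcurve2_analytic x2A 1 a))
  (analytic_atM A2 (dcurve1_analytic x1A 1 a))).
Qed.

Lemma conormal_derivative_periodic : periodic conormal_derivative (2 * pi).
Proof. by move=> s; rewrite /conormal_derivative xper dcurve_periodic. Qed.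

Let p := x t.
Let D1 s := (x s - p).1.
Let D2 s := (x s - p).2.
Let d1 s := (dcurve x 1 s).1.
Let d2 s := (dcurve x 1 s).2.

Let D1D s : is_derive s 1 D1 (d1 s).
Proof.
have := is_derive_sub (derive1_curve1 x1A s) (is_derive_cst1 p.1 s).
by rewrite subr0.
Qed.

Let D2D s : is_derive s 1 D2 (d2 s).
Proof.
have := is_derive_sub (derive1_curve2 x2A s) (is_derive_cst1 p.2 s).
by rewrite subr0.
Qed.

Let d1c : continuous d1.
Proof. by move=> s; exact: analytic_at_continuous (dcurve1_analytic x1A 1 s). Qed.

Let d2c : continuous d2.
Proof. by move=> s; exact: analytic_at_continuous (dcurve2_analytic x2A 1 s). Qed.

Let along1 f s : along p D1 D2 f s 1 = f (x s).
Proof.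
by rewrite /along /D1 /D2 !mul1r /= !addrA ![_ + (x s).1]addrC ![_ + (x s).2]addrC
  !addrK -surjective_pairing.
Qed.

Lemma Rintegral_conormal_log_dist :
  mu.-integrable `[0, 2 * pi] (EFin \o (fun s => conormal_derivative s * log_dist s)) /\
  \int[mu]_(s in `[0, 2 * pi]) (conormal_derivative s * log_dist s) =
  \int[mu]_(s in `[0, 2 * pi]) (arg_kernel x t s * u (x s)) - pi * u (x t).
Proof.
have [g11 [g12 [uP g1P g2P]]] := harmonic_partials uh.
pose v := flux ('D_(1, 0) u) ('D_(0, 1) u) p D1 D2.
pose h := mean_flux ('D_(1, 0) u) ('D_(0, 1) u) p D1 D2 d1 d2.
have vD s : is_derive s 1 v (conormal_derivative s).
  have := is_derive_flux p uP g1P g2P D1D D2D d1c d2c s.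
  by rewrite !along1.
have vA s : analytic_at v s.
  apply: (analytic_at_primitive (conormal_derivative_analytic s)).
  by near=> s'; exact: vD.
have v0 s : eqmod2pi s t -> v s = 0.
  move=> st; apply: flux0; rewrite /D1 /D2 (curve_eqmod xper st) subrr//.
have hc : continuous h := mean_flux_continuous uP D1D D2D d1c d2c.
have KA s : analytic_at (arg_kernel x t) s by exact: arg_kernel_analytic.
have uA := trace_analytic.
pose W s := v s * log_dist s.
have WD s : ~ eqmod2pi s t -> is_derive s 1 W
    (conormal_derivative s * log_dist s + (h s - (u (x s) - u (x t)) * arg_kernel x t s)).
  move=> nst; have dot0 := chord_sqr_gt0 xper xinj nst.
  have dD : is_derive s 1 (fun s => dot (x s - x t) (x s - x t)) (2 * (D1 s * d1 s + D2 s * d2 s)).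
    apply: is_derive_eq (is_derive_add (is_derive_mul (D1D s) (D1D s)) (is_derive_mul (D2D s) (D2D s))) _.
    by ring.
  have lD : is_derive s 1 log_dist ((D1 s * d1 s + D2 s * d2 s) / dot (x s - x t) (x s - x t)).
    apply: is_derive_eq (is_derive_mul (is_derive_ln (f := fun s => dot (x s - x t) (x s - x t)) dot0 dD)
      (is_derive_cst1 2^-1 s)) _.
    by field; rewrite gt_eqF.
  apply: is_derive_eq (is_derive_mul (vD s) lD) _.
  congr (_ + _).
  have dE : dot (x s - x t) (x s - x t) = D1 s * D1 s + D2 s * D2 s by [].
  have := ray_flux_identity p uP g1P D1D D2D s (d1 := d1) (d2 := d2).
  rewrite along1 -/v -/h => I.
  have -> : h s = ((u (x s) - u p) * (D1 s * d2 s - D2 s * d1 s) + v s * (D1 s * d1 s + D2 s * d2 s)) /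
      dot (x s - x t) (x s - x t).
    by rewrite I -dE mulrAC divff ?mul1r// gt_eqF.
  rewrite /arg_kernel asboolF// /arg_form -/(D1 s) -/(D2 s) -/(d1 s) -/(d2 s).
  by field; rewrite gt_eqF.
(* The vanishing of [v] at [t] supplies the one power that makes [W] continuous across the
   logarithm. *)
have Wsing s0 : eqmod2pi s0 t -> log_singular 1 s0 W.
  move=> s0t; have [g gA [vE _ _]] := analytic_at_sub_factor (vA s0).
  apply: (log_singular_mul (n := 1) (log_dist_singular s0t) gA) => s.
  by rewrite expr1 -vE (v0 _ s0t) subr0.
have Wc : continuous W.
  move=> s; have [st|nst] := pselect (eqmod2pi s t).
    by apply: (log_singular_continuous (Wsing _ st)); rewrite /W v0// mul0r.
  exact: is_derive_continuous (WD s nst).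
(* [W' = f + k] off the diagonal: [f] carries the logarithm and [k] is continuous, so they can be
   integrated separately once the sum is known. *)
pose f s := conormal_derivative s * log_dist s.
pose k s := h s - (u (x s) - u (x t)) * arg_kernel x t s.
have kc : continuous k.
  move=> s; apply: cvgB; first exact: hc.
  apply: cvgM; last exact: analytic_at_continuous.
  by apply: cvgB; [exact: analytic_at_continuous (uA s)|exact: cvg_cst].
have fc s : ~ eqmod2pi s t -> {for s, continuous f}.
  move=> nst; apply: analytic_at_continuous; apply: analytic_atM.
    exact: conormal_derivative_analytic.
  exact: log_dist_analytic.
have fi : mu.-integrable `[0, 2 * pi] (EFin \o f).
  apply: (log_singular_integrable t_itv fc) => s0 s0t; apply: log_singular_bound.
  apply: (log_singular_mul (n := 0) (log_dist_singular s0t) (conormal_derivative_analytic s0)) => s.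
  by rewrite expr0 mul1r.
split=> //.
have ki := continuous_integrable 0 (2 * pi) kc.
have fki : mu.-integrable `[0, 2 * pi] (EFin \o (fun s => f s + k s)) by exact: integrable_addR.
(* The period is cut at [t]; the case [a = b] occurs when [t] is 0 or [2 pi]. *)
have part a b : 0 <= a -> b <= 2 * pi -> a <= b -> (forall s, a < s < b -> ~ eqmod2pi s t) ->
    \int[mu]_(s in `[a, b]) (f s + k s) = W b - W a.
  move=> a0 b2 /ge0_gt0_itv[->|ab] nst; first by rewrite Rintegral_id_itv subrr.
  apply: (@FTC_lim R (fun s => f s + k s) W a b (W a) (W b) ab).
  - apply: integrableS fki => //; apply: subset_itv; by rewrite bnd_simp.
  - by move=> s sab; apply: cvgD; [exact: fc (nst s sab)|exact: kc].
  - by move=> s sab; exact: WD (nst s sab).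
  - by apply: cvg_within_filter; exact: Wc.
  - by apply: cvg_within_filter; exact: Wc.
have /andP[t0 t2] := t_itv.
have I0 : \int[mu]_(s in `[0, 2 * pi]) (f s + k s) = 0.
  rewrite (Rintegral_itv_split t0 t2 fki) !part//.
  - have -> : W (2 * pi) = W 0.
      by rewrite /W /v /flux /along /D1 /D2 /log_dist (curve_2pi xper).
    by rewrite addrC addrA subrK subrr.
  - by move=> s /andP[s1 s2] st; have := eqmod2pi_near st; rewrite ltr_norml => e; lra.
  - by move=> s /andP[s1 s2] st; have := eqmod2pi_near st; rewrite ltr_norml => e; lra.
have hi : \int[mu]_(s in `[0, 2 * pi]) h s = 0.
  apply: (Rintegral_mean_flux p uP g1P g2P D1D D2D d1c d2c (two_pi_ge0 R)).
  - by rewrite /D1 (curve_2pi xper).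
  - by rewrite /D2 (curve_2pi xper).
have Kc : continuous (arg_kernel x t) by move=> s; exact: analytic_at_continuous.
have Kuc : continuous (fun s => arg_kernel x t s * u (x s)).
  by move=> s; apply: cvgM; [exact: Kc|exact: analytic_at_continuous (uA s)].
have utKc : continuous (fun s => u (x t) * arg_kernel x t s).
  by move=> s; apply: cvgM; [exact: cvg_cst|exact: Kc].
have : \int[mu]_(s in `[0, 2 * pi]) k s = - (\int[mu]_(s in `[0, 2 * pi]) (arg_kernel x t s * u (x s)) - pi * u (x t)).
  have EK := Rintegral_arg_kernel x1A x2A xper xreg xinj xccw t0.
  rewrite [pi * _]mulrC -[X in u (x t) * X]EK.
  rewrite -continuous_RintegralZ// -continuous_RintegralB//.
  rewrite -[RHS]add0r -[X in X - _]hi -continuous_RintegralB//; last first.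
    by move=> s; apply: cvgB; [exact: Kuc|exact: utKc].
  by apply: eq_Rintegral => s _; rewrite /k; ring.
rewrite -/(f _) => Ik; move: I0; rewrite RintegralD// Ik => /eqP; rewrite subr_eq0 => /eqP; exact.
Unshelve. all: by end_near. Qed.

End GreenIdentity.

(** * The single-layer representation *)

Section Representation.
Variables (R : realType) (x : R -> R * R) (U : R * R -> R * R -> R) (phi : R -> R) (t : R).
Local Notation mu := (@lebesgue_measure R).
Implicit Types (s tau a : R).
Hypotheses (x1A : forall a, analytic_at (fst \o x) a)
  (x2A : forall a, analytic_at (snd \o x) a)
  (xper : periodic x (2 * pi))
  (xreg : forall t, dcurve x 1 t != (0, 0))
  (xinj : forall s t, 0 <= s < 2 * pi -> 0 <= t < 2 * pi -> x s = x t -> s = t).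

Local Notation u := (U ^~ (x t)).
Local Notation Q := (fun tau => neumann_trace x U tau t - phi tau).

Hypothesis uh : harmonic_fun u.

Lemma speed_gt0 s : 0 < speed x s.
Proof. by rewrite sqrtr_gt0; exact: speed_sqr_gt0. Qed.

Lemma speed_periodic : periodic (speed x) (2 * pi).
Proof. by move=> s; rewrite /speed dcurve_periodic. Qed.

Lemma speed_analytic a : analytic_at (speed x) a.
Proof.
apply: analytic_at_sqrt; first exact: speed_sqr_gt0.
apply: analytic_atD; apply: analytic_atM;
  by [exact: dcurve1_analytic|exact: dcurve2_analytic].
Qed.

Lemma neumann_trace_speed s :
  neumann_trace x U s t * speed x s = conormal_derivative x u s.
Proof.
rewrite /neumann_trace /conormal_derivative /dot /normal /grad /=.
by field; rewrite gt_eqF// speed_gt0.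
Qed.

Lemma neumann_traceE s :
  neumann_trace x U s t = conormal_derivative x u s / speed x s.
Proof. by rewrite -neumann_trace_speed mulfK// gt_eqF// speed_gt0. Qed.

Lemma neumann_trace_analytic a : analytic_at (fun s => neumann_trace x U s t) a.
Proof.
have -> : (fun s => neumann_trace x U s t) = (fun s => conormal_derivative x u s / speed x s).
  by apply/funext => s; exact: neumann_traceE.
apply: analytic_atM; first exact: (conormal_derivative_analytic x1A x2A uh).
by apply: analytic_atV; [rewrite gt_eqF// speed_gt0|exact: speed_analytic].
Qed.

Lemma neumann_trace_periodic : periodic (fun s => neumann_trace x U s t) (2 * pi).
Proof.
by move=> s /=; rewrite !neumann_traceE speed_periodic (conormal_derivative_periodic xper).
Qed.

(* The speed and the Dirichlet trace are periodic, so the two branches of [RP]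
   are those of the angular kernel. *)
Lemma RPE s : RP x U s t = - (2 * pi)^-1 * (arg_kernel x t s / speed x s * u (x s)).
Proof.
have pi0 : pi != 0 :> R by rewrite gt_eqF// pi_gt0.
rewrite /RP /arg_kernel /dirichlet_trace; case: asboolP => st.
  have -> : speed x s = speed x t by case: st => k ->; rewrite (periodic_int _ speed_periodic).
  have v0 : speed x t != 0 by rewrite gt_eqF// speed_gt0.
  rewrite (curve_eqmod xper st) -sqr_enorm -/(speed x t) /dot /normal.
  move: (U _ _) (dcurve x 2 t) (speed x t) v0 => w [a1 a2] v v0; case: (dcurve x 1 t) => b1 b2 /=.
  by move: pi pi0 => P P0; field; rewrite v0 P0.
have r0 := chord_sqr_gt0 xper xinj st.
rewrite sqr_enorm /arg_form.
have -> : dot (x t - x s) (x t - x s) = dot (x s - x t) (x s - x t) by rewrite /dot /=; ring.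
move: (dot (x s - x t) _) r0 => r r0.
rewrite /dot /normal /=.
by move: pi pi0 => P P0; field; rewrite P0 (gt_eqF r0) (gt_eqF (speed_gt0 s)).
Qed.

Lemma RP_analytic a : analytic_at (RP x U ^~ t) a.
Proof.
have -> : RP x U ^~ t = (fun s => - (2 * pi)^-1 * (arg_kernel x t s / speed x s * u (x s))).
  by apply/funext => s; exact: RPE.
apply: analytic_atM; first exact: analytic_at_cst.
apply: analytic_atM; last exact: (trace_analytic x1A x2A uh).
apply: analytic_atM; first exact: arg_kernel_analytic.
by apply: analytic_atV; [rewrite gt_eqF// speed_gt0|exact: speed_analytic].
Qed.

Lemma RP_periodic : periodic (RP x U ^~ t) (2 * pi).
Proof. by move=> s /=; rewrite !RPE arg_kernel_periodic// speed_periodic xper. Qed.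

Lemma enormN (p q : R * R) : enorm (p - q) = enorm (q - p).
Proof. by rewrite /enorm; congr Num.sqrt; rewrite /dot /=; ring. Qed.

(* Since [ln 0 = 0], this also holds at [eqmod2pi s t]. *)
Lemma RQE s : RQ x U phi s t = (2 * pi)^-1 * Q s * log_dist x t s.
Proof.
rewrite /RQ enormN ln_enorm -/(log_dist x t s); case: asboolP => st; last by ring.
by rewrite /log_dist (curve_eqmod xper st) subrr /dot /= mul0r addr0 ln0// mul0r mulr0.
Qed.

Hypothesis phiA : forall a, analytic_at phi a.
Hypothesis phiper : periodic phi (2 * pi).

Lemma RQ_periodic : periodic (RQ x U phi ^~ t) (2 * pi).
Proof.
by move=> s /=; rewrite !RQE (log_dist_periodic xper) neumann_trace_periodic phiper.
Qed.

Lemma RQ_analytic a : ~ eqmod2pi a t -> analytic_at (RQ x U phi ^~ t) a.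
Proof.
have -> : RQ x U phi ^~ t = (fun s => (2 * pi)^-1 * Q s * log_dist x t s).
  by apply/funext => s; exact: RQE.
move=> nat_; apply: analytic_atM; last exact: (log_dist_analytic x1A x2A xper xinj).
apply: analytic_atM; first exact: analytic_at_cst.
by apply: analytic_atB => //; exact: neumann_trace_analytic.
Qed.

Section Interpolation.
Variable M : nat.
Hypothesis Q_interp : forall m, (m <= M)%N -> Q^`(m) tau @[tau --> t^'] --> (0 : R).

Let QA a : analytic_at Q a.
Proof. by apply: analytic_atB => //; exact: neumann_trace_analytic. Qed.

(** The hypothesis is a limit over a punctured neighbourhood; analyticity of [Q] turns it into a
    value, and periodicity carries this value to every point congruent to [t]. *)
Lemma interpolation_vanish m s0 : (m <= M)%N -> eqmod2pi s0 t -> derive1n m Q s0 = 0.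
Proof.
move=> mM [k ->].
have Qper : periodic Q (2 * pi) by move=> s /=; rewrite neumann_trace_periodic phiper.
rewrite (periodic_int _ (periodic_derive1n m Qper)).
have Qc := analytic_at_continuous (analytic_at_derive1n m (QA t)).
have Qt : derive1n m Q @ t^' --> derive1n m Q t by apply: cvg_within_filter; exact: Qc.
exact: (cvg_unique _ Qt (Q_interp mM)).
Qed.

Lemma RQ_log_singular s0 : eqmod2pi s0 t -> log_singular M.+1 s0 (RQ x U phi ^~ t).
Proof.
move=> s0t; have [m mM|E EA QE] := analytic_at_vanish (M := M.+1) (QA s0).
  exact: interpolation_vanish.
rewrite -[M.+1]addn0.
apply: (log_singular_mul (E := fun s => (2 * pi)^-1 * E s) (log_dist_singular x1A x2A xper xreg s0t)).
  by apply: analytic_atM => //; exact: analytic_at_cst.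
by move=> s; rewrite RQE QE; ring.
Qed.

Lemma RQ_derive1n_singular m s0 : (m <= M)%N -> eqmod2pi s0 t ->
  log_singular (M - m).+1 s0 (derive1n m (RQ x U phi ^~ t)) /\
  derive1n m (RQ x U phi ^~ t) s0 = 0.
Proof.
move=> mM s0t; have H := RQ_log_singular s0t; split.
  by apply: log_singular_derive1n; rewrite addnS subnKC.
by apply: derive1n_log_singular0 H _ mM; rewrite /RQ asboolT.
Qed.

Lemma RQ_cont_diff : cont_diff M (RQ x U phi ^~ t).
Proof.
split=> [m s mM|m mM s]; have [st|nst] := pselect (eqmod2pi s t).
- have [+ e] := RQ_derive1n_singular (ltnW mM) st.
  have -> : (M - m).+1 = ((M - m.+1).+2)%N by rewrite subnSK.
  by move=> H; have [] := log_singular_is_derive0 H e.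
- exact: nbhs_singleton (analytic_at_derivable (analytic_at_derive1n m (RQ_analytic nst))).
- have [H e] := RQ_derive1n_singular mM st; exact: log_singular_continuous H e.
- exact: analytic_at_continuous (analytic_at_derive1n m (RQ_analytic nst)).
Qed.

Lemma RQ_derivable s : ~ eqmod2pi s t -> derivable (derive1n M (RQ x U phi ^~ t)) s 1.
Proof.
move=> nst.
exact: nbhs_singleton (analytic_at_derivable (analytic_at_derive1n M (RQ_analytic nst))).
Qed.

Lemma RQ_derive1n_integrable : 0 <= t <= 2 * pi ->
  mu.-integrable `[0, 2 * pi] (EFin \o derive1n M.+1 (RQ x U phi ^~ t)).
Proof.
move=> t_itv; apply: (log_singular_integrable t_itv) => s st.
  exact: analytic_at_continuous (analytic_at_derive1n M.+1 (RQ_analytic st)).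
(* The [M + 1] derivatives use up the exponent [M + 1] exactly, leaving at worst a logarithm. *)
apply: log_singular_bound; apply: log_singular_derive1n; rewrite addn0.
exact: RQ_log_singular.
Qed.

End Interpolation.

Hypothesis xccw : counterclockwise x.

Lemma integral_EFin (f : R -> R) : mu.-integrable `[0, 2 * pi] (EFin \o f) ->
  (\int[mu]_(s in `[0%R, (2 * pi)%R]) (f s)%:E)%E = (\int[mu]_(s in `[0, 2 * pi]) f s)%:E.
Proof. by move=> fi; rewrite /Rintegral fineK//; exact: integrable_fin_num. Qed.

(** Up to the factor [- 1 / (2 pi)], the layer potential is the integral of [a] and the remainder
    integral that of [b + a - c]. Green's identity says that [c] integrates to the integral of [b]
    minus [pi * u (x t)]; so [b] cancels, and the surplus [- u (x t) / 2] is compensated by the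
    Dirichlet term. *)
Lemma single_layer_representation : 0 <= t <= 2 * pi ->
  single_layer x phi t = ((dirichlet_trace x U t t / 2)%R%:E +
    \int[mu]_(tau in `[0%R, (2 * pi)%R])
      ((RP x U tau t + RQ x U phi tau t) * speed x tau)%R%:E)%E.
Proof.
move=> t_itv.
have pi0 : pi != 0 :> R by rewrite gt_eqF// pi_gt0.
have [ci cE] := Rintegral_conormal_log_dist x1A x2A xper xreg xinj xccw uh t_itv.
pose a s := phi s * speed x s * log_dist x t s.
pose b s := arg_kernel x t s * u (x s).
pose c s := conormal_derivative x u s * log_dist x t s.
have psA s : analytic_at (fun s => phi s * speed x s) s.
  by apply: analytic_atM => //; exact: speed_analytic.
have ai : mu.-integrable `[0, 2 * pi] (EFin \o a).
  apply: (log_singular_integrable t_itv) => s0 s0t.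
    apply: analytic_at_continuous; apply: analytic_atM => //.
    exact: (log_dist_analytic x1A x2A xper xinj).
  apply: log_singular_bound.
  apply: (log_singular_mul (n := 0) (log_dist_singular x1A x2A xper xreg s0t) (psA s0)) => s.
  by rewrite expr0 mul1r.
have bi : mu.-integrable `[0, 2 * pi] (EFin \o b).
  apply: continuous_integrable => s; apply: analytic_at_continuous.
  apply: analytic_atM; first exact: arg_kernel_analytic.
  exact: (trace_analytic x1A x2A uh).
have Zi (k : R) (f : R -> R) : mu.-integrable `[0, 2 * pi] (EFin \o f) ->
    mu.-integrable `[0, 2 * pi] (EFin \o (fun s => k * f s)).
  move=> fi; have -> : EFin \o (fun s => k * f s) = (fun s => k%:E * (EFin \o f) s)%E.
    by apply/funext => s; rewrite /= EFinM.
  exact: integrableZl.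
have bai : mu.-integrable `[0, 2 * pi] (EFin \o (fun s => b s + a s)) by exact: integrable_addR.
have Nci := Zi (-1) _ ci.
have baci : mu.-integrable `[0, 2 * pi] (EFin \o (fun s => (b s + a s) + -1 * c s)).
  exact: integrable_addR.
rewrite /single_layer.
rewrite (_ : (fun s => _) = fun s => (- (2 * pi)^-1 * a s)%:E); last first.
  apply/funext => s; congr _%:E.
  by rewrite /green enormN ln_enorm -/(log_dist x t s) /a; ring.
rewrite [X in (_ + integral _ _ X)%E](_ : _ =
    fun s => (- (2 * pi)^-1 * ((b s + a s) + -1 * c s))%:E); last first.
  apply/funext => s; congr _%:E.
  have v0 : speed x s != 0 by rewrite gt_eqF// speed_gt0.
  rewrite RPE RQE /a /b /c -neumann_trace_speed.
  by move: pi pi0 => P P0; field; rewrite v0 P0.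
rewrite !integral_EFin; [|exact: Zi|exact: Zi].
rewrite -EFinD; congr _%:E.
rewrite !RintegralZl// RintegralD// RintegralD// RintegralZl//.
have {}cE : \int[mu]_(s in `[0, 2 * pi]) c s = \int[mu]_(s in `[0, 2 * pi]) b s - pi * u (x t) := cE.
rewrite cE /dirichlet_trace.
set A := \int[mu]_(s in _) a s; set B := \int[mu]_(s in _) b s.
by move: A B pi pi0 => A B P P0; field.
Qed.

End Representation.
Theorem lemma2p2 (R : realType) (x : R -> R * R) (phi : R -> R) (M : nat)
    (U : R * R -> R * R -> R)
    (x_curve : simple_closed_analytic_ccw x)
    (phi_analytic : real_analytic phi)
    (phi_periodic : periodic phi (2 * pi))
    (U_harmonic : forall t, 0 <= t <= 2 * pi -> harmonic_fun (U ^~ (x t)))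
    (Q_interp : forall t, 0 <= t <= 2 * pi -> forall m, (m <= M)%N ->
       (fun tau => neumann_trace x U tau t - phi tau)^`(m) tau
         @[tau --> t^'] --> (0 : R)) :
  forall t, 0 <= t <= 2 * pi ->
    [/\ single_layer x phi t =
          ((dirichlet_trace x U t t / 2)%R%:E +
           \int[@lebesgue_measure R]_(tau in `[0%R, (2 * pi)%R])
             ((RP x U tau t + RQ x U phi tau t) * speed x tau)%R%:E)%E,
        real_analytic (RP x U ^~ t) /\ periodic (RP x U ^~ t) (2 * pi),
        cont_diff M (RQ x U phi ^~ t) /\
          periodic (RQ x U phi ^~ t) (2 * pi) &
        (forall tau, ~ eqmod2pi tau t ->
           derivable ((RQ x U phi ^~ t)^`(M)) tau 1) /\
        (@lebesgue_measure R).-integrable `[0, 2 * pi]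
          (EFin \o (RQ x U phi ^~ t)^`(M.+1))].
Proof.
move=> t t_itv.
have [[/real_analyticP x1A /real_analyticP x2A] xper xreg xinj xccw] := x_curve.
have uh := U_harmonic t t_itv; have phiA := (real_analyticP phi).1 phi_analytic.
have interp := Q_interp t t_itv.
split.
- exact: single_layer_representation.
- split; last exact: RP_periodic.
  by apply/real_analyticP => a; exact: RP_analytic.
- split; last exact: RQ_periodic.
  exact: RQ_cont_diff.
- split; last exact: RQ_derive1n_integrable.
  by move=> tau; exact: RQ_derivable.
Qed.
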